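(* Fix $\mu>0$. Let $h\in\mathbb C$, $\alpha\in\mathbb R\setminus\{0\}$, $a>0$. If $\operatorname{Re}h+\mu>0$, let $\widetilde R(h,\alpha,a)$ be the integral operator in $\mathcal K$ with kernel $$M_{h,\alpha,a}(z,u)=\frac1{\Gamma(\mu)}z^{-\mu-h}\,\mathbb L_{\alpha,h+\mu}\bigl(\bar ua/z^\alpha\bigr),$$ i.e. $\widetilde R(h,\alpha,a)F(z)=\langle F,\overline{M_{h,\alpha,a}(z,\cdot)}\rangle_\mu$ (in the sense made precise in the context). Otherwise, choose a positive integer $n$ such that $\operatorname{Re}h+n>0$ and put $$\widetilde R(h,\alpha,a)=(-1)^nI^n\circ\widetilde R(h+n,\alpha,a),\qquad If(z)=\int_{-i\infty}^zf(u)\,du .$$ Then all these operators are bounded in $\mathcal K$, and their product is given by $$\widetilde R(g,\beta,b)\,\widetilde R(h,\alpha,a)=b^h\,\widetilde R(g+h\beta,\alpha\beta,ab^\alpha)$$ for all $g,h\in\mathbb C$, $\alpha,\beta\in\mathbb R\setminus\{0\}$, $a,b>0$. The group generated by the operators $\widetilde R(h,\alpha,a)$ is isomorphic to the group $G^\circ$.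
   Context: $\Pi=\{z\in\mathbb C:\operatorname{Re}z>0\}$. $\mathcal K$ is the space of functions $f$ holomorphic in $\Pi$, smooth up to $\operatorname{Re}z=0$, and such that for each integer $k\ge0$ and $N>0$ there is $M$ with $|f^{(k)}(z)|\le M(1+|z|)^{-N}$ for $\operatorname{Re} z\ge 0$; it carries the Fréchet topology given by the seminorms $\sup_z(1+|z|)^N|f^{(k)}(z)|$, and ''bounded'' means continuous. Functions given by formulas for $\operatorname{Re}z>0$ are extended to $\operatorname{Re}z=0$ by continuity. The function $\mathbb L_{\alpha,\beta}$ ($\alpha\in\mathbb R$, $\operatorname{Re}\beta>0$) is $$\mathbb L_{\alpha,\beta}(z)=\frac1{2\pi i}\int_{c-i\infty}^{c+i\infty}\Gamma(s)\Gamma(\beta-\alpha s)z^{-s}\,ds,\qquad |\arg z|<(1+|\alpha|)\pi/2,$$ with $c>0$ such that $\operatorname{Re}\beta-\alpha c>0$; $z$ is a point of the universal cover of $\mathbb C\setminus\{0\}$ and $z^{-s}=e^{-s\ln z}$ with $\ln z\in\mathbb R$ for $z>0$. The argument of $\bar ua/z^\alpha$ is $-\arg u-\alpha\arg z$, with $\arg z\in(-\pi/2,\pi/2)$ and $\arg u\in[-\pi/2,\pi/2]$; powers of $z\in\Pi$ are principal. Meaning of $\langle F,\overline{M_{h,\alpha,a}(z,\cdot)}\rangle_\mu$ for $F\in\mathcal K$, $z\in\Pi$, $\operatorname{Re}h+\mu>0$ (it is the extension of the inner product of the Hilbert space $H_\mu$ of holomorphic functions on $\Pi$ with reproducing kernel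 $(z+\bar u)^{-\mu}$). For $\mu>1$: $$\widetilde R(h,\alpha,a)F(z)=\frac{2^{\mu-2}}{\pi\Gamma(\mu-1)}z^{-\mu-h}\int_\Pi\mathbb L_{\alpha,h+\mu}(\bar ua/z^\alpha)F(u)(\operatorname{Re}u)^{\mu-2}\,dA(u),$$ $dA$ being Lebesgue measure. For $\mu=1$: $$\widetilde R(h,\alpha,a)F(z)=\frac1{2\pi}z^{-1-h}\int_{-\infty}^\infty\mathbb L_{\alpha,h+1}(-ita/z^\alpha)F(it)\,dt.$$ For $0<\mu<1$ (the formula also holds for $\mu\ge1$): let $\mathcal L_\mu f(z)=\frac1{\Gamma(\mu)}\int_0^\infty f(x)e^{-zx}x^{\mu-1}dx$. Write $F=\mathcal L_\mu f$ and $M_{h,\alpha,a}(z,u)=\frac1{\Gamma(\mu)}\int_0^\infty m_z(y)e^{-\bar uy}y^{\mu-1}dy$, where $m_z(y)y^{\mu-1}$ is integrable on $(0,\infty)$. Then $$\widetilde R(h,\alpha,a)F(z)=\frac1{\Gamma(\mu)}\int_0^\infty f(y)m_z(y)y^{\mu-1}\,dy.$$ $\mathcal S(\mathbb R_+)$ is the space of smooth functions $f$ on $[0,\infty)$ with $f^{(k)}(0)=0$ for all $k\ge0$ and $\lim_{x\to+\infty}f^{(k)}(x)x^N=0$ for all $k\ge0$, $N>0$. $G^\circ$ is the group of operators in $\mathcal S(\mathbb R_+)$ consisting of $\lambda R(h,\alpha,a)$, $\lambda\in\mathbb C^*$, $h\in\mathbb C$, $\alpha\in\mathbb R\setminus\{0\}$,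 $a>0$, where $R(h,\alpha,a)f(x)=x^hf(ax^\alpha)$. *)

(* Defs.v *)
From HB Require Import structures.
From mathcomp Require Import all_boot all_order all_algebra.
From mathcomp Require Import all_classical all_reals all_analysis.
From mathcomp Require Import complex.

Set Implicit Arguments.
Unset Strict Implicit.
Unset Printing Implicit Defensive.

Import Order.TTheory GRing.Theory Num.Theory.
Import numFieldNormedType.Exports.
Import ComplexField.

Local Open Scope complex_scope.
Local Open Scope ring_scope.
Local Open Scope classical_set_scope.

Local Notation Re := complex.Re.
Local Notation Im := complex.Im.

(* Packaging R[i] as a numFieldType lets it inherit the topology, the
   norm and the (complex) derivative that MathComp-Analysis puts on every
   numFieldType. *)
Definition Cplx (R : realType) : numFieldType := R[i].

Section ComplexFunctions.
Context {R : realType}.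
Local Notation C := (Cplx R).

Definition cexp (z : C) : C :=
  (expR (Re z) * cos (Im z)) +i* (expR (Re z) * sin (Im z)).

(* Principal logarithm on the closed right half-plane minus 0, where the
   argument lies in [-pi/2, pi/2] and is thus asin (Im z / |z|). *)
Definition cln (z : C) : C :=
  ln (Normc.normc z) +i* asin (Im z / Normc.normc z).

Definition cpow (z s : C) : C := cexp (s * cln z).

Definition Cintegrable d (T : measurableType d)
    (m : {measure set T -> \bar R}) (D : set T) (f : T -> C) : Prop :=
  m.-integrable D (fun x => (Re (f x))%:E) /\
  m.-integrable D (fun x => (Im (f x))%:E).

Definition Cintegral d (T : measurableType d)
    (m : {measure set T -> \bar R}) (D : set T) (f : T -> C) : C :=
  (\int[m]_(x in D) Re (f x)) +i* (\int[m]_(x in D) Im (f x)).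

Local Notation leb := (@lebesgue_measure R).

(* Euler's integral; only used for Re s > 0. *)
Definition CGamma (s : C) : C :=
  Cintegral leb `]0, +oo[ (fun t : R => cexp ((s - 1) * (ln t)%:C - t%:C)).

(* The value of L_{alpha,beta} at the point exp w of the universal cover of
   C \ {0}, which is parametrized by the logarithm w, computed along the
   contour s = c + i t. *)
Definition LL (c alpha : R) (beta w : C) : C :=
  ((2 * pi)^-1)%:C *
  Cintegral leb setT (fun t : R =>
    let s : C := c +i* t in
    CGamma s * CGamma (beta - alpha%:C * s) * cexp (- (s * w))).

(* Logarithm of (conj u) a / z ^ alpha. *)
Definition log_arg (alpha a : R) (z u : C) : C :=
  conjc (cln u) + (ln a)%:C - alpha%:C * cln z.

Definition Mker (c mu : R) (h : C) (alpha a : R) (z u : C) : C :=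
  (CGamma mu%:C)^-1 * cpow z (- mu%:C - h) *
  LL c alpha (h + mu%:C) (log_arg alpha a z u).

Definition Laplace (mu : R) (f : R -> C) (z : C) : C :=
  (CGamma mu%:C)^-1 *
  Cintegral leb `]0, +oo[
    (fun x : R => f x * cexp (- (z * x%:C)) * (x `^ (mu - 1))%:C).

(* The integral of f from -i oo to z, along the vertical ray ending at z. *)
Definition Iop (f : C -> C) (z : C) : C :=
  (0 +i* 1) * Cintegral leb `]-oo, 0[ (fun t : R => f (z + (0 +i* t))).

End ComplexFunctions.

Section DeriveLin.
Variables (K : numFieldType) (a : K) (f g : K -> K) (z : K).
Hypotheses (df : derivable f z 1) (dg : derivable g z 1).

Lemma derivable_lin : derivable (a *: f + g) z 1.
Proof. by apply: derivableD => //; exact: derivableZ. Qed.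

Lemma derive_lin : 'D_1 (a *: f + g) z = a *: 'D_1 f z + 'D_1 g z.
Proof. by rewrite deriveD ?deriveZ //; exact: derivableZ. Qed.
End DeriveLin.

Section SpaceK.
Context {R : realType}.
Local Notation C := (Cplx R).

Definition RHP : set C := [set z | 0 < Re z].
Definition cRHP : set C := [set z | 0 <= Re z].

(* The k-th complex derivative of f in the open half-plane, extended to the
   closed half-plane by continuity. *)
Definition derivK (k : nat) (f : C -> C) (z : C) : C :=
  lim (derive1n k f w @[w --> within RHP (nbhs z)]).

(* Elements of K are represented by total functions vanishing outside the closed
   half-plane, so that equality of functions is equality in K.  Holomorphy is
   the case k = 0 of is_spaceK_hol (it implies the other cases). *)
Record is_spaceK (f : C -> C) : Prop := {
  is_spaceK_out : forall z, ~ cRHP z -> f z = 0;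
  is_spaceK_hol : forall k z, RHP z -> derivable (derive1n k f) z 1;
  is_spaceK_smooth : forall k z, cRHP z ->
    derive1n k f w @[w --> within RHP (nbhs z)] --> derivK k f z;
  is_spaceK_cont : forall k, {within cRHP, continuous (derivK k f)};
  is_spaceK_bdry : forall z, cRHP z -> f z = derivK 0 f z;
  is_spaceK_decay : forall k N : nat, exists M : R, forall z, cRHP z ->
    Normc.normc (derivK k f z) <= M * (1 + Normc.normc z) ^- N
}.

Definition spaceK_pred : {pred C -> C} := [pred f | `[< is_spaceK f >]].

Lemma open_RHP : open RHP.
Proof.
rewrite openE => z /= zP; apply/nbhs_ballP.
have z0 : (0 : C) < (Re z)%:C by rewrite -[0]/((0:R)%:C) ltcR.
exists (Re z)%:C => // w /=; rewrite -ball_normE /= /RHP /= => zw.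
have : (`|Re (z - w)|%:C : C) < (Re z)%:C.
  by apply: le_lt_trans zw; exact: (@normc_ge_Re R (z - w)).
rewrite ltcR => h; case: z w zP z0 zw h => [a b] [c d] /= a0 _ _.
by move/(le_lt_trans (ler_norm _)); rewrite ltrBlDl ltrDr.
Qed.

Lemma RHP_filter (z : C) : cRHP z -> ProperFilter (within RHP (nbhs z)).
Proof.
move=> z0; split; last exact: within_filter.
move=> /nbhs_ballP [e /= e0 he].
have [ee eR] : e = (Re e)%:C /\ 0 < Re e.
  by move: e0; rewrite ltcE /=; case: (e) => a b /= /andP[/eqP -> ->].
apply: (he (z + (Re e / 2)%:C)).
  rewrite -ball_normE /= opprD addNKr normrN ee.
  suff : `|((Re e / 2)%:C : C)| < (Re e)%:C by [].
  have h2 : 0 <= Re e / 2 by rewrite divr_ge0// ltW.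
  rewrite ger0_norm; last by rewrite -[0]/((0:R)%:C) lecR.
  by rewrite ltcR gtr_pMr// invf_lt1// ltr1n.
by rewrite /RHP /=; move: z0; rewrite /cRHP /=; case: (z) => a b /= a0; rewrite ltr_wpDl// divr_gt0.
Qed.

Lemma derive1n_lin (a : C) (f g : C -> C) k (z : C) :
  is_spaceK f -> is_spaceK g -> RHP z ->
  derive1n k (a *: f + g) z = a *: derive1n k f z + derive1n k g z.
Proof.
move=> Kf Kg; elim: k z => [//|k IH] z z0.
rewrite !derive1nS !derive1E.
have df := is_spaceK_hol Kf (k := k) z0; have dg := is_spaceK_hol Kg (k := k) z0.
rewrite (@near_eq_derive _ _ _ _ (a *: derive1n k f + derive1n k g)).
- exact: derive_lin.
- by near=> w; apply: IH; near: w; exact: open_nbhs_nbhs (conj open_RHP z0).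
Unshelve. all: by end_near. Qed.

Lemma derivK_lin_cvg (a : C) (f g : C -> C) k (z : C) :
  is_spaceK f -> is_spaceK g -> cRHP z ->
  derive1n k (a *: f + g) w @[w --> within RHP (nbhs z)] -->
  a *: derivK k f z + derivK k g z.
Proof.
move=> Kf Kg z0; have FF := RHP_filter z0.
apply: (@cvg_trans _ ((a *: derive1n k f w + derive1n k g w) @[w --> within RHP (nbhs z)])).
  apply: near_eq_cvg; near=> w; rewrite derive1n_lin//.
  by near: w; exact: withinT.
by apply: cvgD; [apply: cvgZr|]; exact: is_spaceK_smooth.
Unshelve. all: by end_near. Qed.

Lemma derivK_lin (a : C) (f g : C -> C) k (z : C) :
  is_spaceK f -> is_spaceK g -> cRHP z ->
  derivK k (a *: f + g) z = a *: derivK k f z + derivK k g z.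
Proof.
move=> Kf Kg z0; have FF := RHP_filter z0.
exact/cvg_lim/derivK_lin_cvg.
Qed.

Lemma is_spaceK_lin (a : C) (f g : C -> C) :
  is_spaceK f -> is_spaceK g -> is_spaceK (a *: f + g).
Proof.
move=> Kf Kg; split.
- move=> z nz; have -> : (a *: f + g) z = a * f z + g z by [].
  by rewrite (is_spaceK_out Kf nz) (is_spaceK_out Kg nz) mulr0 addr0.
- move=> k z z0.
  apply: (@near_eq_derivable _ _ _ (a *: derive1n k f + derive1n k g)).
  + near=> w; apply/esym; apply: derive1n_lin => //.
    by near: w; exact: open_nbhs_nbhs (conj open_RHP z0).
  + by apply: derivable_lin; exact: is_spaceK_hol.
- by move=> k z z0; rewrite derivK_lin //; exact: derivK_lin_cvg.
- move=> k.
  apply: (@subspace_eq_continuous _ _ _ (fun z => a *: derivK k f z + derivK k g z)).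
    by move=> z /set_mem z0; apply/esym; exact: derivK_lin.
  move=> z; apply: cvgD; [apply: cvgZr|]; exact: is_spaceK_cont.
- by move=> z z0; rewrite derivK_lin // -(is_spaceK_bdry Kf z0) -(is_spaceK_bdry Kg z0).
- move=> k N.
  have [M hM] := is_spaceK_decay Kf k N; have [M' hM'] := is_spaceK_decay Kg k N.
  exists (Normc.normc a * M + M') => z z0.
  rewrite derivK_lin // (le_trans (@le_normcD R _ _)) // mulrDl lerD //; last exact: hM'.
  rewrite (@Normc.normcM R) -mulrA ler_wpM2l ?hM //.
  by case: (a) => ? ?; exact: sqrtr_ge0.
Unshelve. all: by end_near. Qed.

Lemma is_spaceK0 : is_spaceK (0 : C -> C).
Proof.
have d0 k : derive1n k (0 : C -> C) = 0.
  by elim: k => // k IH; rewrite derive1nS IH; apply/funext => z; rewrite derive1_cst.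
have D0 k z : cRHP z -> derivK k (0 : C -> C) z = 0.
  by move=> z0; have FF := RHP_filter z0; rewrite /derivK d0; apply: cvg_lim => //; exact: cvg_cst.
split => //.
- by move=> k z _; rewrite d0; exact: derivable_cst.
- by move=> k z z0; rewrite D0 // d0; exact: cvg_cst.
- move=> k; apply: (@subspace_eq_continuous _ _ _ (fun=> 0)).
    by move=> z /set_mem z0; apply/esym; exact: D0.
  by move=> z; exact: cvg_cst.
- by move=> z z0; rewrite D0.
- by move=> k N; exists 0 => z z0; rewrite D0 // mul0r Normc.normc0.
Qed.

Lemma spaceK_submod_closed : submod_closed spaceK_pred.
Proof.
split; first by rewrite inE; exact: is_spaceK0.
by move=> a f g; rewrite !inE; exact: is_spaceK_lin.
Qed.
HB.instance Definition _ :=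
  GRing.isSubmodClosed.Build C (C -> C) spaceK_pred spaceK_submod_closed.

End SpaceK.

Record spaceK (R : realType) := SpaceK {
  spaceK_val :> Cplx R -> Cplx R;
  _ : spaceK_val \in @spaceK_pred R
}.

Section SpaceKTheory.
Context {R : realType}.
Local Notation C := (Cplx R).

HB.instance Definition _ := [isSub for @spaceK_val R].
HB.instance Definition _ := [Choice of spaceK R by <:].
HB.instance Definition _ := [SubChoice_isSubLmodule of spaceK R by <:].
HB.instance Definition _ := isPointed.Build (spaceK R) 0.

Definition seminormK (k N : nat) (f : C -> C) : R :=
  sup [set (1 + Normc.normc z) ^+ N * Normc.normc (derivK k f z) | z in cRHP].

(* The topology generated by the seminorms: a subbase is given by the balls
   {F | seminormK k N (F - G) < e}, indexed by (k, N, G, e) with 0 < e. *)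
HB.instance Definition _ := @isSubBaseTopological.Build (spaceK R)
  (nat * nat * spaceK R * R)%type [set i | 0 < i.2]
  (fun i => [set F | seminormK i.1.1.1 i.1.1.2 (F - i.1.2) < i.2]).

End SpaceKTheory.

Section SpaceS.
Context {R : realType}.
Local Notation C := (Cplx R).

(* A function on [0, +oo[ is represented by its extension by 0 to R; it is
   smooth with all derivatives vanishing at 0 iff this extension is smooth. *)
Record is_spaceS_real (f : R -> R) : Prop := {
  is_spaceS_out : forall x, x < 0 -> f x = 0;
  is_spaceS_smooth : forall k x, derivable (derive1n k f) x 1;
  is_spaceS_flat : forall k, derive1n k f 0 = 0;
  is_spaceS_decay : forall k N : nat,
    derive1n k f x * x ^+ N @[x --> +oo] --> (0 : R)
}.

Definition is_spaceS (f : R -> C) : Prop :=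
  is_spaceS_real (fun x => Re (f x)) /\ is_spaceS_real (fun x => Im (f x)).

End SpaceS.

Record spaceS (R : realType) := SpaceS {
  spaceS_val :> R -> Cplx R;
  spaceS_prop : is_spaceS spaceS_val
}.

Section Operators.
Context {R : realType}.
Local Notation C := (Cplx R).
Local Notation leb := (@lebesgue_measure R).

(* v is the value at z of the operator with kernel Mker applied to F, the
   function L being computed along the line Re s = c, i.e. the inner product of
   F and conj (Mker z _) in the Hilbert space H_mu.  That space is a weighted
   Bergman space for 1 < mu (the factor (CGamma mu)^-1 of Mker cancels against
   the normalization of the measure) and the Hardy space for mu = 1; otherwise
   the inner product is written through the Laplace transforms of both sides,
   f and m being then determined (m almost everywhere). *)
Definition Rtilde_value (c mu : R) (h : C) (alpha a : R)
    (F : spaceK R) (z v : C) : Prop :=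
  if 1 < mu then
    let g (p : R * R) : C := let u : C := p.1 +i* p.2 in
      LL c alpha (h + mu%:C) (log_arg alpha a z u) * F u *
      (Re u `^ (mu - 2))%:C in
    let D := [set p : R * R | 0 < p.1] in
    Cintegrable (leb \x leb)%E D g /\
    v = (2 `^ (mu - 2) / pi)%:C * (CGamma (mu - 1)%:C)^-1 *
        cpow z (- mu%:C - h) * Cintegral (leb \x leb)%E D g
  else if mu == 1 then
    let g (t : R) : C := let u : C := 0 +i* t in
      LL c alpha (h + 1) (log_arg alpha a z u) * F u in
    Cintegrable leb setT g /\
    v = ((2 * pi)^-1)%:C * cpow z (- 1 - h) * Cintegral leb setT g
  else
    exists (f : spaceS R) (m : R -> C),
    [/\ forall w, RHP w -> F w = Laplace mu f w,
        Cintegrable leb `]0, +oo[ (fun y => m y * (y `^ (mu - 1))%:C),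
        forall u, RHP u -> Mker c mu h alpha a z u = Laplace mu m (conjc u) &
        v = (CGamma mu%:C)^-1 *
            Cintegral leb `]0, +oo[
              (fun y => f y * m y * (y `^ (mu - 1))%:C)].

(* The case Re h + mu > 0; the value must not depend on the admissible c. *)
Definition is_Rtilde_pos (mu : R) (h : C) (alpha a : R)
    (T : spaceK R -> spaceK R) : Prop :=
  forall (c : R), 0 < c -> 0 < Re h + mu - alpha * c ->
  forall (F : spaceK R) (z : C), RHP z ->
  Rtilde_value c mu h alpha a F z (T F z).

(* Otherwise; the operator must not depend on the admissible n. *)
Definition is_Rtilde (mu : R) (h : C) (alpha a : R)
    (T : spaceK R -> spaceK R) : Prop :=
  if 0 < Re h + mu then is_Rtilde_pos mu h alpha a T
  else forall n : nat, (0 < n)%N -> 0 < Re h + n%:R ->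
    exists2 T' : spaceK R -> spaceK R,
      is_Rtilde_pos mu (h + n%:R) alpha a T' &
      forall (F : spaceK R) (z : C), cRHP z ->
        T F z = (- 1) ^+ n * iter n Iop (T' F) z.

Definition G_circ : set (spaceS R -> spaceS R) :=
  [set T | exists (lambda h : C) (alpha a : R),
    [/\ lambda != 0, alpha != 0, 0 < a &
        forall (f : spaceS R) (x : R), 0 < x ->
          T f x = lambda * (cpow x%:C h * f (a * x `^ alpha))]].

End Operators.

Section OperatorGroups.

Definition is_opgroup (V : Type) (A : set (V -> V)) : Prop :=
  [/\ A id, forall S T, A S -> A T -> A (S \o T) &
      forall T, A T -> exists2 S, A S & S \o T = id /\ T \o S = id].

Definition generated_opgroup (V : Type) (A : set (V -> V)) : set (V -> V) :=
  smallest (@is_opgroup V) A.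

Definition opgroup_isog (V W : Type) (A : set (V -> V)) (B : set (W -> W)) :
    Prop :=
  [/\ is_opgroup A, is_opgroup B &
      exists2 phi : (V -> V) -> (W -> W), set_bij A B phi &
        forall S T, A S -> A T -> phi (S \o T) = phi S \o phi T].

End OperatorGroups.

(* Main.v *)
Require Import Defs.
From HB Require Import structures.
From mathcomp Require Import all_boot all_order all_algebra.
From mathcomp Require Import all_classical all_reals all_analysis.
From mathcomp Require Import measurable_realfun complex.
From mathcomp Require finmap.
From mathcomp Require Import ring lra.

(* The Laplace transform [Lam f z = \int_0^oo f(x) exp(- z x) dx] is a bijection
   from S(R_+) onto K, with inverse a Fourier integral along a vertical line.
   The operator is the conjugate
     [Rt mu h al a = Lam o a^(1 - mu) R(h + (mu - 1)(1 - al), al, a) o Lam^-1],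
   so that linearity, the product formula and the group are read off on S(R_+),
   while continuity follows from weighted bounds that are stable under
   differentiation.  It has the prescribed kernel because, by Mellin inversion,
     [z^(-mu - h) L(conj u a / z^al)
        = \int_R e^((h + mu) t) exp(- z e^t) exp(- conj u a e^(al t)) dt]:
   pairing with [F = Lam phi] in any of the three forms of the inner product
   yields, by Fubini,
     [\int_R e^((h + mu) t) exp(- z e^t) Psi(a e^(al t)) dt],
   where [Psi y = y^(1 - mu) phi y].  The case [Re h + mu <= 0] reduces to this
   one through [I (Lam (x f)) = - Lam f]. *)

Set Implicit Arguments.
Unset Strict Implicit.
Unset Printing Implicit Defensive.

Import Order.TTheory GRing.Theory Num.Theory.
Import numFieldNormedType.Exports.
Import ComplexField.

Local Open Scope complex_scope.
Local Open Scope ring_scope.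
Local Open Scope classical_set_scope.

Local Notation Re := complex.Re.
Local Notation Im := complex.Im.
Local Notation nc := Normc.normc.

(** * Complex numbers and the complex exponential *)

Arguments cexp : simpl never.
Arguments cln : simpl never.
Arguments Normc.normc : simpl never.
Arguments Cintegral : simpl never.
Arguments cpow : simpl never.
Arguments CGamma : simpl never.

Section ComplexNumbers.
Context {R : realType}.
Local Notation C := (Cplx R).
Implicit Types (z w : C) (x y : R).

Lemma cReD z w : Re (z + w) = Re z + Re w. Proof. by case: z; case: w. Qed.
Lemma cImD z w : Im (z + w) = Im z + Im w. Proof. by case: z; case: w. Qed.
Lemma cReN z : Re (- z) = - Re z. Proof. by case: z. Qed.
Lemma cImN z : Im (- z) = - Im z. Proof. by case: z. Qed.
Lemma cReM z w : Re (z * w) = Re z * Re w - Im z * Im w.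
Proof. by case: z; case: w. Qed.
Lemma cImM z w : Im (z * w) = Re z * Im w + Im z * Re w.
Proof. by case: z; case: w. Qed.
Lemma cReC x : Re (x%:C : C) = x. Proof. by []. Qed.
Lemma cImC x : Im (x%:C : C) = 0. Proof. by []. Qed.
Lemma cRe0 : Re (0 : C) = 0. Proof. by []. Qed.
Lemma cIm0 : Im (0 : C) = 0. Proof. by []. Qed.
Lemma cRe1 : Re (1 : C) = 1. Proof. by []. Qed.
Lemma cIm1 : Im (1 : C) = 0. Proof. by []. Qed.
Lemma cReJ z : Re (conjc z) = Re z. Proof. by case: z. Qed.
Lemma cImJ z : Im (conjc z) = - Im z. Proof. by case: z. Qed.
Lemma cReMr x z : Re (x%:C * z) = x * Re z.
Proof. by rewrite cReM cImC mul0r subr0. Qed.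
Lemma cImMr x z : Im (x%:C * z) = x * Im z.
Proof. by rewrite cImM cImC mul0r addr0. Qed.
Definition ii : C := 0 +i* 1.
Lemma Reii : Re ii = 0. Proof. by []. Qed.
Lemma Imii : Im ii = 1. Proof. by []. Qed.
Definition ReImE := (cReD, cImD, cReN, cImN, cReMr, cImMr, cReM, cImM, cRe0, cIm0, cRe1, cIm1,
  cReJ, cImJ, Reii, Imii).

End ComplexNumbers.

Ltac csimp := rewrite ?ReImE /= ?ReImE /=.

Section ComplexNumbers.
Context {R : realType}.
Local Notation C := (Cplx R).
Implicit Types (z w : C) (x y : R).

Lemma complex_ext z w : Re z = Re w -> Im z = Im w -> z = w.
Proof. by case: z; case: w => /= ? ? ? ? -> ->. Qed.

Lemma realCD x y : ((x + y)%:C : C) = x%:C + y%:C.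
Proof. by apply: complex_ext; csimp; rewrite ?addr0. Qed.
Lemma realCN x : ((- x)%:C : C) = - x%:C.
Proof. by apply: complex_ext; csimp; rewrite ?oppr0. Qed.
Lemma realCM x y : ((x * y)%:C : C) = x%:C * y%:C.
Proof. by apply: complex_ext; csimp; ring. Qed.
Lemma realC1 : ((1 : R)%:C : C) = 1. Proof. by []. Qed.
Lemma realC0 : ((0 : R)%:C : C) = 0. Proof. by []. Qed.

Lemma mkCE x y : (x +i* y : C) = x%:C + ii * y%:C.
Proof. by apply: complex_ext; csimp; ring. Qed.

Lemma nc_ge0 z : 0 <= nc z. Proof. by case: z => a b; exact: sqrtr_ge0. Qed.
Lemma nc_sqr z : nc z ^+ 2 = Re z ^+ 2 + Im z ^+ 2.
Proof. by case: z => a b; rewrite /Normc.normc /= sqr_sqrtr // addr_ge0 ?sqr_ge0. Qed.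
Lemma ncM z w : nc (z * w) = nc z * nc w. Proof. exact: Normc.normcM. Qed.
Lemma ncD z w : nc (z + w) <= nc z + nc w. Proof. exact: le_normcD. Qed.
Lemma ncN z : nc (- z) = nc z. Proof. exact: normcN. Qed.
Lemma ncB z w : nc (z - w) <= nc z + nc w.
Proof. by rewrite -(ncN w) ncD. Qed.
Lemma ncC z w : nc (z - w) = nc (w - z). Proof. by rewrite -ncN opprB. Qed.
Lemma nc0 : nc (0 : C) = 0. Proof. exact: Normc.normc0. Qed.
Lemma nc1 : nc (1 : C) = 1. Proof. exact: Normc.normc1. Qed.
Lemma nc_real x : nc (x%:C : C) = `|x|.
Proof. by rewrite /Normc.normc /= expr0n addr0 sqrtr_sqr. Qed.
Lemma nc_realM x z : nc (x%:C * z) = `|x| * nc z.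
Proof. by rewrite ncM nc_real. Qed.
Lemma nc_Re z : `|Re z| <= nc z.
Proof.
rewrite -(@ler_pXn2r _ 2) ?nnegrE ?nc_ge0 ?normr_ge0 //.
by rewrite nc_sqr real_normK ?num_real// lerDl sqr_ge0.
Qed.
Lemma nc_Im z : `|Im z| <= nc z.
Proof.
rewrite -(@ler_pXn2r _ 2) ?nnegrE ?nc_ge0 ?normr_ge0 //.
by rewrite nc_sqr real_normK ?num_real// lerDr sqr_ge0.
Qed.
Lemma nc_imag x : nc (0 +i* x : C) = `|x|.
Proof. by rewrite /Normc.normc /= expr0n add0r sqrtr_sqr. Qed.
Lemma nc_ReIm z : nc z <= `|Re z| + `|Im z|.
Proof.
by rewrite {1}(_ : z = (Re z)%:C + (0 +i* Im z)) ?(le_trans (ncD _ _)) ?nc_real ?nc_imag//;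
  apply: complex_ext; csimp; rewrite ?addr0 ?add0r.
Qed.
Lemma nc_eq0 z : (nc z == 0) = (z == 0).
Proof.
by apply/eqP/eqP => [/Normc.eq0_normc//|->]; rewrite nc0.
Qed.
Lemma nc_gt0 z : (0 < nc z) = (z != 0).
Proof. by rewrite lt_def nc_ge0 nc_eq0 andbT. Qed.
Lemma ncX z n : nc (z ^+ n) = nc z ^+ n.
Proof. by elim: n => [|n IH]; rewrite ?expr0 ?nc1// !exprS ncM IH. Qed.
Lemma ncV z : nc (z^-1) = (nc z)^-1. Proof. exact: Normc.normcV. Qed.
Lemma ncJ z : nc (conjc z) = nc z.
Proof. by case: z => a b; rewrite /Normc.normc /= sqrrN. Qed.
Lemma nc_ii : nc (ii : C) = 1. Proof. by rewrite nc_imag normr1. Qed.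
Lemma mulii : ii * ii = -1 :> C.
Proof. by apply: complex_ext; csimp; ring. Qed.
Lemma normcE z : `|z| = (nc z)%:C :> C. Proof. by []. Qed.

Lemma Re_cexp z : Re (cexp z) = expR (Re z) * cos (Im z). Proof. by []. Qed.
Lemma Im_cexp z : Im (cexp z) = expR (Re z) * sin (Im z). Proof. by []. Qed.
Definition cexpE := (Re_cexp, Im_cexp).
Lemma Re_cln z : Re (cln z) = ln (nc z). Proof. by []. Qed.
Lemma Im_clnE z : Im (cln z) = asin (Im z / nc z). Proof. by []. Qed.
Definition clnE := (Re_cln, Im_clnE).

Lemma cexpD z w : cexp (z + w) = cexp z * cexp w.
Proof.
by apply: complex_ext; rewrite !ReImE !cexpE !ReImE expRD ?cosD ?sinD; ring.
Qed.
Lemma cexp0 : cexp 0 = 1 :> C.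
Proof. by apply: complex_ext; rewrite cexpE; csimp; rewrite expR0 ?cos0 ?sin0 !mul1r. Qed.
Lemma cexp_real x : cexp (x%:C) = (expR x)%:C :> C.
Proof. by apply: complex_ext; rewrite cexpE; csimp; rewrite ?cos0 ?sin0 ?mulr1 ?mulr0. Qed.
Lemma nc_cexp z : nc (cexp z) = expR (Re z).
Proof.
have e0 := expR_ge0 (Re z).
rewrite /cexp /Normc.normc /= !exprMn -mulrDr cos2Dsin2 mulr1 sqrtr_sqr ger0_norm//.
Qed.
Lemma cexpN z : cexp (- z) = (cexp z)^-1.
Proof.
have h : cexp z * cexp (- z) = 1 by rewrite -cexpD subrr cexp0.
have z0 : cexp z != 0.
  by apply/eqP => e; move: h; rewrite e mul0r => /eqP; rewrite eq_sym oner_eq0.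
by apply: (mulfI z0); rewrite h mulfV.
Qed.
Lemma cexp_neq0 z : cexp z != 0.
Proof. by rewrite -nc_eq0 nc_cexp gt_eqF// expR_gt0. Qed.

Lemma cln_pos x : 0 < x -> cln (x%:C) = (ln x)%:C :> C.
Proof.
move=> x0; apply: complex_ext; rewrite clnE nc_real gtr0_norm//= mul0r.
have p2 : (0 : R) \in `[(- (pi / 2)), (pi / 2)]%R by rewrite /= in_itv /= oppr_le0 divr_ge0 ?pi_ge0.
by rewrite -[in LHS]sin0 sinK.
Qed.

Lemma cexp_cln z : 0 <= Re z -> z != 0 -> cexp (cln z) = z.
Proof.
move=> rz z0.
have n0 : 0 < nc z by rewrite nc_gt0.
have b : -1 <= Im z / nc z <= 1.
  by rewrite -ler_norml normrM normfV (ger0_norm (ltW n0)) ler_pdivrMr// mul1r nc_Im.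
apply: complex_ext; rewrite cexpE !clnE lnK//.
- rewrite cos_asin// (_ : 1 - _ = (Re z / nc z) ^+ 2); last first.
    rewrite !expr_div_n -[X in X - _](@divff _ (nc z ^+ 2)) ?expf_neq0 ?gt_eqF//.
    by rewrite -mulrBl nc_sqr addrK.
  rewrite sqrtr_sqr ger0_norm ?divr_ge0 ?nc_ge0//.
  by rewrite mulrC divfK ?gt_eqF.
- by rewrite asinK// mulrC divfK ?gt_eqF.
Qed.

Lemma Im_cln z : 0 < Re z -> - (pi / 2) < Im (cln z) < pi / 2.
Proof.
move=> rz.
have n0 : 0 < nc z by rewrite (lt_le_trans rz)// (le_trans (ler_norm _))// nc_Re.
have b : -1 < Im z / nc z < 1.
  rewrite -ltr_norml normrM normfV (ger0_norm (ltW n0)) ltr_pdivrMr// mul1r.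
  rewrite -(@ltr_pXn2r _ 2) ?nnegrE ?nc_ge0 ?normr_ge0 //.
  by rewrite nc_sqr real_normK ?num_real// ltrDr exprn_gt0.
by rewrite Im_clnE; apply/andP; split; [apply: asin_gtNpi2 | apply: asin_ltpi2];
  case/andP: b => ? ?; apply/andP; split => //; exact: ltW.
Qed.

Lemma cpow_pos x (h : C) : 0 < x -> cpow x%:C h = cexp (h * (ln x)%:C).
Proof. by move=> x0; rewrite /cpow cln_pos. Qed.

End ComplexNumbers.

(** * Derivatives *)

Section ComplexCalculus.
Context {R : realType}.
Local Notation C := (Cplx R).
Implicit Types (z w : C) (x y : R).

Lemma posC_real (e : C) : 0 < e -> e = (Re e)%:C /\ 0 < Re e.
Proof. by rewrite ltcE /=; case: e => a b /= /andP[/eqP -> ->]. Qed.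

Lemma posC (e : R) : 0 < e -> (0 : C) < e%:C.
Proof. by move=> e0; rewrite -[0]/((0:R)%:C) ltcR. Qed.

Definition cder (f : R -> C) (x : R) (l : C) : Prop :=
  is_derive x 1 (fun y => Re (f y)) (Re l) /\
  is_derive x 1 (fun y => Im (f y)) (Im l).

Lemma is_deriveC_epsP (F : C -> C) (z l : C) :
  is_derive z 1 F l <->
  forall e : R, 0 < e -> exists2 d : R, 0 < d & forall h : C, nc h < d ->
    nc (F (z + h) - F z - h * l) <= e * nc h.
Proof.
split=> [[dF <-] e e0|H].
- move/cvgrPdist_le : dF => /(_ _ (posC e0)) [/= d /posC_real[dE d0] dP].
  exists (Re d) => // h hd.
  have [->|h0] := eqVneq h 0; first by rewrite addr0 subrr mul0r subrr nc0 mulr0.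
  have := dP h; rewrite /= sub0r normrN dE normcE ltcR => /(_ hd h0).
  rewrite normcE lecR => hh.
  rewrite -ler_pdivrMr ?nc_gt0// -ncV -ncM -ncN.
  rewrite [X in nc X <= _](_ : _ = 'D_1 F z - h^-1 *: (F (h *: 1 + z) - F z))//.
  rewrite [h *: 1]mulr1 [h^-1 *: _]mulrC [h + z]addrC.
  by field.
- have cv : h^-1 *: (F (h *: 1 + z) - F z) @[h --> (0:C)^'] --> l.
    apply/cvgrPdist_le => /= e /posC_real[-> e0].
    have [d d0 dP] := H _ e0.
    exists d%:C; first exact: posC.
    move=> h /=; rewrite sub0r normrN normcE ltcR => hd h0.
    rewrite normcE lecR.
    have := dP _ hd; rewrite -ler_pdivrMr ?nc_gt0// -ncV -ncM -ncN.
    rewrite [X in nc X <= _ -> _](_ : _ = l - h^-1 *: (F (h *: 1 + z) - F z))//.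
    rewrite [h *: 1]mulr1 [h^-1 *: _]mulrC [h + z]addrC.
    by field.
  by split; [apply/cvg_ex; exists l|exact/cvg_lim].
Qed.

Lemma is_derive_epsP (f : R -> R) (x l : R) :
  is_derive x 1 f l <->
  forall e : R, 0 < e -> exists2 d : R, 0 < d & forall h : R, `|h| < d ->
    `|f (x + h) - f x - h * l| <= e * `|h|.
Proof.
split=> [[dF <-] e e0|H].
- move/cvgrPdist_le : dF => /(_ _ e0) [/= d d0 dP].
  exists d => // h hd.
  have [->|h0] := eqVneq h 0; first by rewrite addr0 subrr mul0r subrr normr0 mulr0.
  have := dP h; rewrite /= sub0r normrN => /(_ hd h0) hh.
  rewrite -ler_pdivrMr ?normr_gt0// -normfV -normrM -normrN.
  rewrite [X in `|X| <= _](_ : _ = 'D_1 f x - h^-1 *: (f (h *: 1 + x) - f x))//.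
  rewrite [h *: 1]mulr1 [h^-1 *: _]mulrC [h + x]addrC.
  by field.
- have cv : h^-1 *: (f (h *: 1 + x) - f x) @[h --> (0:R)^'] --> l.
    apply/cvgrPdist_le => /= e e0.
    have [d d0 dP] := H _ e0.
    exists d => //.
    move=> h /=; rewrite sub0r normrN => hd h0.
    rewrite (_ : l - _ = - ((f (x + h) - f x - h * l) * h^-1)); last first.
      by rewrite [h *: 1]mulr1 [h^-1 *: _]mulrC [h + x]addrC; field.
    by rewrite normrN normrM normfV ler_pdivrMr ?normr_gt0// dP.
  by split; [apply/cvg_ex; exists l|exact/cvg_lim].
Qed.

Lemma cder_epsP (f : R -> C) (x : R) (l : C) :
  cder f x l <->
  forall e : R, 0 < e -> exists2 d : R, 0 < d & forall h : R, `|h| < d ->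
    nc (f (x + h) - f x - h%:C * l) <= e * `|h|.
Proof.
split=> [[/is_derive_epsP hr /is_derive_epsP hi] e e0|H].
- have e2 : 0 < e / 2 by rewrite divr_gt0.
  have [d1 d10 h1] := hr _ e2; have [d2 d20 h2] := hi _ e2.
  exists (Num.min d1 d2); first by rewrite lt_min d10.
  move=> h; rewrite lt_min => /andP[hd1 hd2].
  rewrite (le_trans (nc_ReIm _))// (splitr e) mulrDl; csimp.
  apply: lerD; [exact: h1|exact: h2].
- split; apply/is_derive_epsP => e /H[d d0 dP]; exists d => // h /dP;
    apply: le_trans.
  + by apply: le_trans (nc_Re _); csimp.
  + by apply: le_trans (nc_Im _); csimp.
Qed.

Lemma cder_cst (c : C) x : cder (fun=> c) x 0.
Proof. by split; exact: is_derive_cst. Qed.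

Lemma cder_real (f : R -> R) x l : is_derive x 1 f l -> cder (fun y => (f y)%:C) x l%:C.
Proof. by move=> h; split => //=; exact: is_derive_cst. Qed.

Lemma cderD (f g : R -> C) x l k : cder f x l -> cder g x k ->
  cder (fun y => f y + g y) x (l + k).
Proof.
move=> [fr fi] [gr gi]; split.
- rewrite cReD (_ : (fun y => _) = (fun y => Re (f y)) + (fun y => Re (g y))).
    exact: is_deriveD.
  by apply/funext => y; rewrite cReD.
- rewrite cImD (_ : (fun y => _) = (fun y => Im (f y)) + (fun y => Im (g y))).
    exact: is_deriveD.
  by apply/funext => y; rewrite cImD.
Qed.

Lemma cderN (f : R -> C) x l : cder f x l -> cder (fun y => - f y) x (- l).
Proof.
move=> [fr fi]; split.
- rewrite cReN (_ : (fun y => _) = - (fun y => Re (f y))).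
    exact: is_deriveN.
  by apply/funext => y; rewrite cReN.
- rewrite cImN (_ : (fun y => _) = - (fun y => Im (f y))).
    exact: is_deriveN.
  by apply/funext => y; rewrite cImN.
Qed.

Lemma cderB (f g : R -> C) x l k : cder f x l -> cder g x k ->
  cder (fun y => f y - g y) x (l - k).
Proof. by move=> hf hg; apply: cderD => //; exact: cderN. Qed.

Lemma cderM (f g : R -> C) x l k : cder f x l -> cder g x k ->
  cder (fun y => f y * g y) x (l * g x + f x * k).
Proof.
move=> [fr fi] [gr gi]; split.
- rewrite (_ : (fun y => _) =
    (fun y => Re (f y)) * (fun y => Re (g y)) - (fun y => Im (f y)) * (fun y => Im (g y))).
    apply: is_derive_eq; csimp; rewrite /GRing.scale /=; ring.
  by apply/funext => y; rewrite cReM.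
- rewrite (_ : (fun y => _) =
    (fun y => Re (f y)) * (fun y => Im (g y)) + (fun y => Im (f y)) * (fun y => Re (g y))).
    apply: is_derive_eq; csimp; rewrite /GRing.scale /=; ring.
  by apply/funext => y; rewrite cImM.
Qed.

Lemma cderZ (c : C) (f : R -> C) x l : cder f x l -> cder (fun y => c * f y) x (c * l).
Proof. by move=> /(cderM (cder_cst c x)); rewrite mul0r add0r. Qed.

Lemma cder_comp (f : R -> C) (g : R -> R) x l k :
  is_derive x 1 g k -> cder f (g x) l -> cder (fun y => f (g y)) x (k%:C * l).
Proof.
move=> hg [fr fi]; split; csimp; rewrite mulrC.
- exact: (@is_derive1_comp _ (fun y => Re (f y)) g).
- exact: (@is_derive1_comp _ (fun y => Im (f y)) g).
Qed.

Lemma cder_cexp (f : R -> C) x l : cder f x l ->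
  cder (fun y => cexp (f y)) x (l * cexp (f x)).
Proof.
move=> [fr fi].
have he := @is_derive1_comp _ expR (fun y => Re (f y)) x _ _ (is_derive_expR _) fr.
have hc := @is_derive1_comp _ cos (fun y => Im (f y)) x _ _ (is_derive_cos _) fi.
have hs := @is_derive1_comp _ sin (fun y => Im (f y)) x _ _ (is_derive_sin _) fi.
split.
- rewrite (_ : (fun y => _) =
    (expR \o (fun y => Re (f y))) * (cos \o (fun y => Im (f y)))); last first.
    by apply/funext => y; rewrite cexpE.
  by apply: is_derive_eq; rewrite cReM !cexpE /GRing.scale /=; ring.
- rewrite (_ : (fun y => _) =
    (expR \o (fun y => Re (f y))) * (sin \o (fun y => Im (f y)))); last first.
    by apply/funext => y; rewrite cexpE.
  by apply: is_derive_eq; rewrite cImM !cexpE /GRing.scale /=; ring.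
Qed.

Lemma cder_eq (f : R -> C) x l k : cder f x l -> l = k -> cder f x k.
Proof. by move=> + <-. Qed.

Lemma cder_id x : cder (fun y => y%:C) x 1.
Proof. by apply: cder_real. Qed.

Lemma cder_chain (F : C -> C) (g : R -> C) x (l w : C) :
  is_derive (g x) 1 F l -> cder g x w -> cder (fun y => F (g y)) x (w * l).
Proof.
move=> /is_deriveC_epsP hF /cder_epsP hg; apply/cder_epsP => e e0.
pose K := nc w + 1; have K0 : 0 < K by rewrite ltr_wpDl ?nc_ge0.
have eK : 0 < e / (K *+ 2) by rewrite divr_gt0// mulrn_wgt0.
have [d d0 dP] := hF _ eK.
pose L := nc l + 1; have L0 : 0 < L by rewrite ltr_wpDl ?nc_ge0.
have eL : 0 < e / (L *+ 2) by rewrite divr_gt0// mulrn_wgt0.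
have [d1 d10 h1] := hg _ eL.
have [d2 d20 h2] := hg _ (@ltr01 R).
exists (Num.min (d / K) (Num.min d1 d2)).
  by rewrite !lt_min divr_gt0//= d10.
move=> h; rewrite !lt_min => /and3P[hd hd1 hd2].
set k := g (x + h) - g x.
have kh : nc k <= K * `|h|.
  rewrite (_ : k = (k - h%:C * w) + h%:C * w); last by ring.
  rewrite (le_trans (ncD _ _))// nc_realM /K mulrDl addrC mulrC lerD//.
  exact: h2.
have kd : nc k < d by rewrite (le_lt_trans kh)// mulrC -ltr_pdivlMr.
have := dP _ kd; rewrite (_ : g x + k = g (x + h)); last by rewrite /k; ring.
move=> hk.
rewrite (_ : _ - _ = (F (g (x + h)) - F (g x) - k * l) + (k - h%:C * w) * l); last by ring.
rewrite (le_trans (ncD _ _))// (splitr (e * `|h|)) lerD//.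
- rewrite (le_trans hk)// (le_trans (ler_wpM2l (ltW eK) kh))//.
  rewrite le_eqVlt; apply/orP; left; apply/eqP.
  by rewrite -mulr_natr; field; rewrite gt_eqF.
- rewrite ncM (le_trans (ler_wpM2r (nc_ge0 _) (h1 _ hd1)))//.
  rewrite -(mulr_natr L) (_ : e / (L * 2) * `|h| * nc l = (e * `|h| / 2) * (nc l / L)); last first.
    by field; rewrite gt_eqF.
  rewrite ler_piMr ?divr_ge0 ?mulr_ge0 ?(ltW e0)//.
  by rewrite ler_pdivrMr// mul1r lerDl.
Qed.

Lemma cder_continuous (f : R -> C) x l : cder f x l ->
  {for x, continuous (fun y => Re (f y))} /\ {for x, continuous (fun y => Im (f y))}.
Proof.
by move=> [[a _] [b _]]; split; apply: differentiable_continuous; exact/derivable1_diffP.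
Qed.

Lemma cMVT (f f' : R -> C) (a b M : R) : a <= b ->
  (forall y, a <= y <= b -> cder f y (f' y)) ->
  (forall y, a <= y <= b -> nc (f' y) <= M) ->
  nc (f b - f a) <= M * (b - a).
Proof.
move=> ab df bf'.
set xi := f b - f a.
have [->|xi0] := eqVneq xi 0.
  rewrite nc0 mulr_ge0 ?subr_ge0//.
  by apply: le_trans (bf' a _); rewrite ?nc_ge0 ?lexx.
have d y : a <= y <= b -> cder (fun y => conjc xi * f y) y (conjc xi * f' y).
  by move=> ?; apply: cderZ; exact: df.
pose g y := Re (conjc xi * f y).
have [||c] := @MVT_segment R g (fun y => Re (conjc xi * f' y)) a b ab.
- by move=> y /[!in_itv]/= /andP[? ?]; apply: (d y _).1; rewrite !ltW.
- apply: continuous_in_subspaceT => y /set_mem /=; rewrite in_itv => /d h.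
  by have [] := cder_continuous h.
- rewrite in_itv /= => hc; rewrite /g -cReN -cReD -mulrBr -/xi => E.
  have : nc xi ^+ 2 <= nc xi * M * (b - a).
    rewrite [leLHS](_ : _ = Re (conjc xi * f' c) * (b - a)).
      rewrite ler_wpM2r ?subr_ge0// (le_trans (ler_norm _))// (le_trans (nc_Re _))//.
      by rewrite ncM ncJ ler_wpM2l ?nc_ge0// bf'.
    by rewrite -E nc_sqr; csimp; ring.
  by rewrite expr2 -mulrA ler_pM2l ?nc_gt0.
Qed.

Lemma cexp_lip (A B : C) : Re A <= 0 -> Re (A + B) <= 0 ->
  nc (cexp (A + B) - cexp A) <= nc B.
Proof.
move=> hA hAB.
pose f (s : R) := cexp (A + s%:C * B).
have df s : cder f s (B * f s).
  apply: cder_cexp.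
  rewrite -[X in cder _ _ X]add0r -[X in _ + X]mul1r.
  apply: cderD (cder_cst _ _) _.
  by rewrite -[X in cder _ _ X]addr0 -(mulr0 s%:C); apply: cderM (cder_id _) (cder_cst _ _).
have := @cMVT f (fun s => B * f s) 0 1 (nc B) ler01 (fun s _ => df s).
rewrite subr0 mulr1 /f realC1 realC0 mul1r mul0r addr0; apply => y /andP[y0 y1].
rewrite ncM nc_cexp ler_piMr ?nc_ge0// -expR0 ler_expR; csimp.
rewrite (_ : _ + _ = (1 - y) * Re A + y * (Re A + Re B)); last by ring.
rewrite cReD in hAB.
by rewrite -[leRHS]addr0 lerD// mulr_ge0_le0// subr_ge0.
Qed.

Lemma cexp_quad (A B : C) : Re A <= 0 -> Re (A + B) <= 0 ->
  nc (cexp (A + B) - cexp A - B * cexp A) <= nc B ^+ 2.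
Proof.
move=> hA hAB.
pose f (s : R) := cexp (A + s%:C * B) - s%:C * (B * cexp A).
have df s : cder f s (B * (cexp (A + s%:C * B) - cexp A)).
  rewrite mulrBr; apply: cderB.
    apply: cder_cexp.
    rewrite -[X in cder _ _ X]add0r -[X in _ + X]mul1r.
    apply: cderD (cder_cst _ _) _.
    by rewrite -[X in cder _ _ X]addr0 -(mulr0 s%:C); apply: cderM (cder_id _) (cder_cst _ _).
  rewrite -[X in cder _ _ X]mul1r -[X in cder _ _ X]addr0 -(mulr0 s%:C).
  by apply: cderM (cder_id _) (cder_cst _ _).
have := @cMVT f _ 0 1 (nc B ^+ 2) ler01 (fun s _ => df s).
rewrite subr0 mulr1 /f realC1 realC0 !mul1r !mul0r addr0 subr0 => H.
rewrite addrAC; apply: H => y /andP[y0 y1].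
rewrite ncM expr2 ler_wpM2l ?nc_ge0//.
have yB : nc (y%:C * B) <= nc B by rewrite nc_realM ger0_norm// ler_piMl ?nc_ge0.
apply: le_trans yB; apply: cexp_lip => //; csimp.
rewrite (_ : _ + _ = (1 - y) * Re A + y * (Re A + Re B)); last by ring.
rewrite cReD in hAB.
by rewrite -[leRHS]addr0 lerD// mulr_ge0_le0// subr_ge0.
Qed.

Lemma is_deriveC_quad (F : C -> C) (z l : C) (d K : R) : 0 < d ->
  (forall h, nc h < d -> nc (F (z + h) - F z - h * l) <= K * nc h ^+ 2) ->
  is_derive z 1 F l.
Proof.
move=> d0 H; apply/is_deriveC_epsP => e e0.
pose K' := Num.max K 1.
have K0 : 0 < K' by rewrite lt_max ltr01 orbT.
exists (Num.min d (e / K')); first by rewrite lt_min d0 divr_gt0.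
move=> h; rewrite lt_min => /andP[/H hd he].
rewrite (le_trans hd)// expr2 mulrA ler_wpM2r ?nc_ge0//.
rewrite (@le_trans _ _ (K' * nc h))// ?ler_wpM2r ?nc_ge0// ?le_max ?lexx//.
by rewrite mulrC -ler_pdivlMr// ltW.
Qed.

Lemma cder_quad (f : R -> C) (x : R) (l : C) (d K : R) : 0 < d ->
  (forall h : R, `|h| < d -> nc (f (x + h) - f x - h%:C * l) <= K * `|h| ^+ 2) ->
  cder f x l.
Proof.
move=> d0 H; apply/cder_epsP => e e0.
pose K' := Num.max K 1.
have K0 : 0 < K' by rewrite lt_max ltr01 orbT.
exists (Num.min d (e / K')); first by rewrite lt_min d0 divr_gt0.
move=> h; rewrite lt_min => /andP[/H hd he].
rewrite (le_trans hd)// expr2 mulrA ler_wpM2r//.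
rewrite (@le_trans _ _ (K' * `|h|))// ?ler_wpM2r// ?le_max ?lexx//.
by rewrite mulrC -ler_pdivlMr// ltW.
Qed.

End ComplexCalculus.

(** * Integrals of complex functions *)

Section RealIntegrable.
Context d (T : measurableType d) (R : realType) (m : {measure set T -> \bar R}).
Implicit Types (f g : T -> R).

Definition rintg f := m.-integrable setT (EFin \o f).

Lemma rintg_meas f : rintg f -> measurable_fun setT f.
Proof. by move=> /measurable_int/measurable_EFinP. Qed.

Lemma rintg_le f g : measurable_fun setT f -> (forall x, `|f x| <= g x) ->
  rintg g -> rintg f.
Proof.
move=> mf fg ig; apply: le_integrable ig => //; first exact/measurable_EFinP.
by move=> x _ /=; rewrite lee_fin (le_trans (fg x))// ler_norm.
Qed.

Lemma rintgD f g : rintg f -> rintg g -> rintg (fun x => f x + g x).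
Proof. by move=> hf hg; exact: integrableD hf hg. Qed.

Lemma rintgZ (k : R) f : rintg f -> rintg (fun x => k * f x).
Proof. by move=> hf; exact: integrableZl hf. Qed.

Lemma rintg_norm f : rintg f -> rintg (fun x => `|f x|).
Proof. exact: integrable_norm. Qed.
End RealIntegrable.

Section ComplexMeasurable.
Context d (T : measurableType d) (R : realType).
Local Notation C := (Cplx R).
Implicit Types (f g : T -> C).

Definition cmeas f := measurable_fun setT (fun x => Re (f x)) /\
  measurable_fun setT (fun x => Im (f x)).

Lemma cmeas_cst (c : C) : cmeas (fun=> c).
Proof. by split; exact: measurable_cst. Qed.

Lemma cmeas_real (f : T -> R) : measurable_fun setT f -> cmeas (fun x => (f x)%:C).
Proof. by move=> mf; split => //=; exact: measurable_cst. Qed.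

Lemma cmeas_mk (f g : T -> R) : measurable_fun setT f -> measurable_fun setT g ->
  cmeas (fun x => f x +i* g x).
Proof. by []. Qed.

Lemma cmeasD f g : cmeas f -> cmeas g -> cmeas (fun x => f x + g x).
Proof.
move=> [fr fi] [gr gi]; split.
- by under eq_fun do rewrite cReD; exact: measurable_funD.
- by under eq_fun do rewrite cImD; exact: measurable_funD.
Qed.

Lemma cmeasN f : cmeas f -> cmeas (fun x => - f x).
Proof.
move=> [fr fi]; split.
- by under eq_fun do rewrite cReN; exact: measurableT_comp.
- by under eq_fun do rewrite cImN; exact: measurableT_comp.
Qed.

Lemma cmeasB f g : cmeas f -> cmeas g -> cmeas (fun x => f x - g x).
Proof. by move=> hf hg; apply: cmeasD => //; exact: cmeasN. Qed.

Lemma cmeasM f g : cmeas f -> cmeas g -> cmeas (fun x => f x * g x).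
Proof.
move=> [fr fi] [gr gi]; split.
- by under eq_fun do rewrite cReM; apply: measurable_funB; exact: measurable_funM.
- by under eq_fun do rewrite cImM; apply: measurable_funD; exact: measurable_funM.
Qed.

Lemma cmeas_conj f : cmeas f -> cmeas (fun x => conjc (f x)).
Proof.
move=> [fr fi]; split.
- by under eq_fun do rewrite cReJ.
- by under eq_fun do rewrite cImJ; exact: measurableT_comp.
Qed.

Lemma cmeas_cexp f : cmeas f -> cmeas (fun x => cexp (f x)).
Proof.
move=> [fr fi]; split.
- under eq_fun do rewrite cexpE; apply: measurable_funM.
    exact: measurableT_comp (@measurable_expR R) fr.
  apply: measurableT_comp fi; apply: continuous_measurable_fun.
  exact: continuous_cos.
- under eq_fun do rewrite cexpE; apply: measurable_funM.
    exact: measurableT_comp (@measurable_expR R) fr.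
  apply: measurableT_comp fi; apply: continuous_measurable_fun.
  exact: continuous_sin.
Qed.

Lemma ncE (z : C) : nc z = Num.sqrt (Re z ^+ 2 + Im z ^+ 2).
Proof. by case: z. Qed.

Lemma cmeas_nc f : cmeas f -> measurable_fun setT (fun x => nc (f x)).
Proof.
move=> [fr fi]; under eq_fun do rewrite ncE.
apply: (@measurableT_comp _ _ _ _ _ _ (@Num.sqrt R)).
  by apply: continuous_measurable_fun; exact: sqrt_continuous.
by apply: measurable_funD; exact: measurable_funX.
Qed.
End ComplexMeasurable.

Lemma cmeas_comp d d' (T : measurableType d) (T' : measurableType d') (R : realType)
  (f : T' -> Cplx R) (h : T -> T') :
  measurable_fun setT h -> cmeas f -> cmeas (fun x => f (h x)).
Proof. by move=> mh [fr fi]; split; [exact: measurableT_comp fr mh|exact: measurableT_comp fi mh]. Qed.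

Section ComplexIntegral.
Context d (T : measurableType d) (R : realType) (m : {measure set T -> \bar R}).
Local Notation C := (Cplx R).
Local Notation cintg := (Cintegrable m setT).
Local Notation cint := (Cintegral m setT).
Implicit Types (f g : T -> C).

Lemma cintg_meas f : cintg f -> cmeas f.
Proof. by move=> [a b]; split; [exact: rintg_meas a|exact: rintg_meas b]. Qed.

Lemma cintg_dom f (g : T -> R) : cmeas f -> (forall x, nc (f x) <= g x) ->
  rintg m g -> cintg f.
Proof.
move=> [fr fi] fg ig; split.
- by apply: rintg_le ig => // x; exact: le_trans (nc_Re _) (fg x).
- by apply: rintg_le ig => // x; exact: le_trans (nc_Im _) (fg x).
Qed.

Lemma cintg_nc f : cintg f -> rintg m (fun x => nc (f x)).
Proof.
move=> hf; have [a b] := hf.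
apply: rintg_le (rintgD (rintg_norm a) (rintg_norm b)).
  exact: cmeas_nc (cintg_meas hf).
by move=> x; rewrite ger0_norm ?nc_ge0// nc_ReIm.
Qed.

Lemma cintgD f g : cintg f -> cintg g -> cintg (fun x => f x + g x).
Proof.
move=> hf hg; apply: cintg_dom (rintgD (cintg_nc hf) (cintg_nc hg)).
  by apply: cmeasD; exact: cintg_meas.
by move=> x; exact: ncD.
Qed.

Lemma cintgMbnd f g (B : R) : cmeas f -> (forall x, nc (f x) <= B) -> cintg g ->
  cintg (fun x => f x * g x).
Proof.
move=> mf fB hg; apply: cintg_dom (rintgZ B (cintg_nc hg)).
  by apply: cmeasM => //; exact: cintg_meas.
by move=> x; rewrite ncM ler_wpM2r ?nc_ge0.
Qed.

Lemma cintgZ (c : C) f : cintg f -> cintg (fun x => c * f x).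
Proof. by move=> hf; apply: (@cintgMbnd (fun=> c) _ (nc c)) => //; exact: cmeas_cst. Qed.

Lemma cintgN f : cintg f -> cintg (fun x => - f x).
Proof. by move=> /(cintgZ (-1)); under [X in cintg X -> _]eq_fun do rewrite mulN1r. Qed.

Lemma cintgB f g : cintg f -> cintg g -> cintg (fun x => f x - g x).
Proof. by move=> hf hg; apply: cintgD => //; exact: cintgN. Qed.

Lemma Re_cint f : Re (cint f) = \int[m]_x Re (f x). Proof. by []. Qed.
Lemma Im_cint f : Im (cint f) = \int[m]_x Im (f x). Proof. by []. Qed.

Lemma cintD f g : cintg f -> cintg g -> cint (fun x => f x + g x) = cint f + cint g.
Proof.
move=> [fr fi] [gr gi]; apply: complex_ext; csimp.
- by under eq_Rintegral do rewrite cReD; rewrite RintegralD.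
- by under eq_Rintegral do rewrite cImD; rewrite RintegralD.
Qed.

Lemma cintZ (c : C) f : cintg f -> cint (fun x => c * f x) = c * cint f.
Proof.
move=> [fr fi]; apply: complex_ext; csimp.
- under eq_Rintegral do rewrite cReM.
  by rewrite RintegralB ?RintegralZl//; exact: rintgZ.
- under eq_Rintegral do rewrite cImM.
  by rewrite RintegralD ?RintegralZl//; exact: rintgZ.
Qed.

Lemma cintN f : cintg f -> cint (fun x => - f x) = - cint f.
Proof.
by move=> hf; rewrite -mulN1r -cintZ//; congr cint; apply/funext => x; rewrite mulN1r.
Qed.

Lemma cintB f g : cintg f -> cintg g -> cint (fun x => f x - g x) = cint f - cint g.
Proof. by move=> hf hg; rewrite cintD ?cintN//; exact: cintgN. Qed.

Lemma cint0 : cint (fun=> 0) = 0.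
Proof. by apply: complex_ext; csimp; rewrite Rintegral_cst// mul0r. Qed.

Lemma cint_norm f : cintg f -> nc (cint f) <= \int[m]_x nc (f x).
Proof.
move=> hf; set I := cint f.
have [->|I0] := eqVneq I 0.
  by rewrite nc0; apply: Rintegral_ge0 => x _; exact: nc_ge0.
have h1 : nc I ^+ 2 = \int[m]_x Re (conjc I * f x).
  by rewrite -Re_cint cintZ// -/I cReM cReJ cImJ nc_sqr; ring.
have h2 : nc I ^+ 2 <= nc I * \int[m]_x nc (f x).
  rewrite h1 -RintegralZl//; last exact: cintg_nc.
  apply: le_Rintegral => //; first by have [] := cintgZ (conjc I) hf.
    exact: rintgZ (cintg_nc hf).
  move=> x _; rewrite (le_trans (ler_norm _))// (le_trans (nc_Re _))//.
  by rewrite ncM ncJ.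
by rewrite expr2 ler_pM2l ?nc_gt0 in h2.
Qed.

Lemma cint_norm_le f (g : T -> R) : cmeas f -> (forall x, nc (f x) <= g x) ->
  rintg m g -> nc (cint f) <= \int[m]_x g x.
Proof.
move=> mf fg ig; have hf := cintg_dom mf fg ig.
by apply: le_trans (cint_norm hf) _; apply: le_Rintegral => //; exact: cintg_nc.
Qed.

Lemma cdct (f_ : nat -> T -> C) f (g : T -> R) : (forall n, cmeas (f_ n)) -> cmeas f ->
  (forall n x, nc (f_ n x) <= g x) -> (forall x, nc (f x) <= g x) -> rintg m g ->
  (forall x, nc (f_ n x - f x) @[n --> \oo] --> (0 : R)) ->
  nc (cint (f_ n) - cint f) @[n --> \oo] --> (0 : R).
Proof.
move=> mf_ mf f_g fg ig cv.
have hd n : rintg m (fun x => nc (f_ n x - f x)).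
  by apply: cintg_nc; apply: cintgB; [exact: cintg_dom ig|exact: cintg_dom ig].
have ub n x : nc (f_ n x - f x) <= 2 * g x.
  by rewrite mulr2n mulrDl mul1r (le_trans (ncB _ _))// lerD.
have [|||||_ _] := @dominated_convergence _ _ _ m setT measurableT
  (fun n x => (nc (f_ n x - f x))%:E) (fun=> 0%E) (fun x => (2 * g x)%:E).
- by move=> n; have /measurable_int := hd n.
- exact: measurable_cst.
- apply: aeW => x _; apply: cvg_EFin; first exact: nearW.
  exact: cv.
- exact: rintgZ.
- by apply: aeW => x n _; rewrite /= lee_fin ger0_norm ?nc_ge0.
rewrite integral0 => H.
apply: (@squeeze_cvgr _ _ _ _ (cst 0) (fun n => \int[m]_x nc (f_ n x - f x))).
- apply: nearW => n /=; rewrite nc_ge0/= -cintB.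
  + by apply: cint_norm; apply: cintgB; exact: cintg_dom ig.
  + exact: cintg_dom ig.
  + exact: cintg_dom ig.
- exact: cvg_cst.
- by apply/fine_cvg; exact: H.
Qed.

End ComplexIntegral.

Section ComplexFubini.
Context d1 d2 (T1 : measurableType d1) (T2 : measurableType d2) (R : realType).
Context (m1 : {sigma_finite_measure set T1 -> \bar R}) (m2 : {sigma_finite_measure set T2 -> \bar R}).
Local Notation C := (Cplx R).

Lemma rfubini (f : T1 * T2 -> R) : rintg (m1 \x m2)%E f ->
  (forall x, rintg m2 (fun y => f (x, y))) -> (forall y, rintg m1 (fun x => f (x, y))) ->
  [/\ rintg m1 (fun x => \int[m2]_y f (x, y)), rintg m2 (fun y => \int[m1]_x f (x, y)),
   \int[m1]_x (\int[m2]_y f (x, y)) = \int[(m1 \x m2)%E]_z f z &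
   \int[m2]_y (\int[m1]_x f (x, y)) = \int[(m1 \x m2)%E]_z f z].
Proof.
move=> hf h2 h1.
have e1 x : (\int[m2]_y f (x, y))%:E = (\int[m2]_y (f (x, y))%:E)%E.
  by rewrite /Rintegral fineK//; exact: (integrable_fin_num measurableT (h2 x)).
have e2 y : (\int[m1]_x f (x, y))%:E = (\int[m1]_x (f (x, y))%:E)%E.
  by rewrite /Rintegral fineK//; exact: (integrable_fin_num measurableT (h1 y)).
split.
- by rewrite /rintg (_ : _ \o _ = fubini_F m2 (EFin \o f)); [exact: integrable_fubini_F|exact/funext].
- rewrite /rintg (_ : _ \o _ = fubini_G m1 (EFin \o f)); last exact/funext.
  have mf := measurable_int _ hf.
  have maf : measurable_fun setT (abse \o (EFin \o f)) by exact: measurableT_comp.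
  apply/integrableP; split; first exact: measurable_fubini_G hf.
  apply: le_lt_trans ((integrable21ltyP m1 m2 mf).1 hf); apply: ge0_le_integral => //.
  + by apply: measurableT_comp => //; exact: measurable_fubini_G hf.
  + by apply: (measurable_fun_fubini_tonelli_G (m1 := m1) (abse \o (EFin \o f))) => //= ?; exact: abse_ge0.
  + move=> y _; apply: le_abse_integral => //.
    exact: (measurable_int _ (h1 y)).
- rewrite {1}/Rintegral; congr fine; under eq_integral do rewrite e1.
  exact: integral12_prod_meas1 hf.
- rewrite {1}/Rintegral; congr fine; under eq_integral do rewrite e2.
  exact: integral21_prod_meas1 hf.
Qed.

Lemma cfubini (f : T1 * T2 -> C) : Cintegrable (m1 \x m2)%E setT f ->
  (forall x, Cintegrable m2 setT (fun y => f (x, y))) ->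
  (forall y, Cintegrable m1 setT (fun x => f (x, y))) ->
  [/\ Cintegrable m1 setT (fun x => Cintegral m2 setT (fun y => f (x, y))),
   Cintegrable m2 setT (fun y => Cintegral m1 setT (fun x => f (x, y))),
   Cintegral m1 setT (fun x => Cintegral m2 setT (fun y => f (x, y))) =
     Cintegral (m1 \x m2)%E setT f &
   Cintegral m2 setT (fun y => Cintegral m1 setT (fun x => f (x, y))) =
     Cintegral (m1 \x m2)%E setT f].
Proof.
move=> [fr fi] h2 h1.
have [a1 a2 a3 a4] := rfubini fr (fun x => (h2 x).1) (fun y => (h1 y).1).
have [b1 b2 b3 b4] := rfubini fi (fun x => (h2 x).2) (fun y => (h1 y).2).
by split; [split|split|apply: complex_ext|apply: complex_ext].
Qed.

Lemma cprod_kernel (n : T1 -> C) (k : T2 -> C) (e : T1 * T2 -> C) (B : R) :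
  Cintegrable m1 setT n -> Cintegrable m2 setT k -> cmeas e ->
  (forall z, nc (e z) <= B) ->
  [/\ Cintegrable (m1 \x m2)%E setT (fun z => n z.1 * (k z.2 * e z)),
   Cintegrable m1 setT (fun x => n x * Cintegral m2 setT (fun y => k y * e (x, y))),
   Cintegrable m2 setT (fun y => k y * Cintegral m1 setT (fun x => n x * e (x, y))),
   Cintegral m1 setT (fun x => n x * Cintegral m2 setT (fun y => k y * e (x, y))) =
   Cintegral (m1 \x m2)%E setT (fun z => n z.1 * (k z.2 * e z)) &
   Cintegral m2 setT (fun y => k y * Cintegral m1 setT (fun x => n x * e (x, y))) =
   Cintegral (m1 \x m2)%E setT (fun z => n z.1 * (k z.2 * e z))].
Proof.
move=> hn hk me eB.
have B0 : 0 <= `|B| by [].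
have eB' z : nc (e z) <= `|B| by rewrite (le_trans (eB z))// ler_norm.
have s2 x : Cintegrable m2 setT (fun y => k y * e (x, y)).
  under eq_fun do rewrite mulrC; apply: (@cintgMbnd _ _ _ _ _ _ `|B|) => //.
  by apply: (cmeas_comp _ me); exact: measurable_pair1.
have s1 y : Cintegrable m1 setT (fun x => n x * e (x, y)).
  under eq_fun do rewrite mulrC; apply: (@cintgMbnd _ _ _ _ _ _ `|B|) => //.
  by apply: (cmeas_comp _ me); exact: measurable_pair2.
pose f z := n z.1 * (k z.2 * e z).
have mf : cmeas f.
  apply: cmeasM; first exact: cmeas_comp measurable_fst (cintg_meas hn).
  by apply: cmeasM => //; exact: cmeas_comp measurable_snd (cintg_meas hk).
have hN := cintg_nc hn; have hK := cintg_nc hk.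
pose g z := nc (n z.1) * nc (k z.2).
have mg : measurable_fun setT g.
  apply: measurable_funM.
    exact: (measurableT_comp (rintg_meas hN) measurable_fst).
  exact: (measurableT_comp (rintg_meas hK) measurable_snd).
have ig : rintg (m1 \x m2)%E g.
  apply/integrable12ltyP; first exact/measurable_EFinP.
  have E x : (\int[m2]_y `|(EFin \o g) (x, y)|)%E =
      ((nc (n x))%:E * \int[m2]_y (nc (k y))%:E)%E.
    rewrite -integralZl//; apply: eq_integral => y _.
    by rewrite /= ger0_norm ?mulr_ge0 ?nc_ge0// EFinM.
  rewrite (eq_integral _ _ (fun x _ => E x)).
  have fk := integrable_fin_num measurableT hK.
  rewrite -(fineK fk) integralZr//.
  have fn := integrable_fin_num measurableT hN.
  by rewrite -(fineK fn) -EFinM ltry.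
have hf : Cintegrable (m1 \x m2)%E setT f.
  apply: (@cintg_dom _ _ _ _ f _ mf _ (rintgZ `|B| ig)).
  move=> z; rewrite /f !ncM /g mulrA mulrC ler_wpM2r//.
  by rewrite mulr_ge0 ?nc_ge0.
have t2 x : Cintegrable m2 setT (fun y => f (x, y)) by exact: (cintgZ (n x) (s2 x)).
have fE y : (fun x => f (x, y)) = (fun x => k y * (n x * e (x, y))).
  by apply/funext => x; rewrite /f /= mulrCA.
have t1 y : Cintegrable m1 setT (fun x => f (x, y)) by rewrite fE; exact: (cintgZ (k y) (s1 y)).
have [a1 a2 a3 a4] := cfubini hf t2 t1.
have E1 : (fun x => Cintegral m2 setT (fun y => f (x, y))) =
  (fun x => n x * Cintegral m2 setT (fun y => k y * e (x, y))).
  by apply/funext => x; rewrite /f /= cintZ.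
have E2 : (fun y => Cintegral m1 setT (fun x => f (x, y))) =
  (fun y => k y * Cintegral m1 setT (fun x => n x * e (x, y))).
  by apply/funext => y; rewrite fE cintZ.
by rewrite -E1 -E2.
Qed.

Lemma cfubini_kernel (n : T1 -> C) (k : T2 -> C) (e : T1 * T2 -> C) (B : R) :
  Cintegrable m1 setT n -> Cintegrable m2 setT k -> cmeas e ->
  (forall z, nc (e z) <= B) ->
  [/\ Cintegrable m1 setT (fun x => n x * Cintegral m2 setT (fun y => k y * e (x, y))),
   Cintegrable m2 setT (fun y => k y * Cintegral m1 setT (fun x => n x * e (x, y))) &
   Cintegral m1 setT (fun x => n x * Cintegral m2 setT (fun y => k y * e (x, y))) =
   Cintegral m2 setT (fun y => k y * Cintegral m1 setT (fun x => n x * e (x, y)))].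
Proof.
move=> hn hk me eB; have [_ h1 h2 h3 h4] := cprod_kernel hn hk me eB.
by split=> //; rewrite h3.
Qed.

End ComplexFubini.

(** * Change of variables *)

Section RealLine.
Context (R : realType).
Local Notation C := (Cplx R).
Local Notation leb := (@lebesgue_measure R).
Implicit Types (f g F : R -> R) (E : R -> C).

Lemma derivable_LR F a b : (forall x, derivable F x 1) -> derivable_oo_LRcontinuous F a b.
Proof.
move=> dF; have cF x : {for x, continuous F}.
  by apply: differentiable_continuous; exact/derivable1_diffP.
by split => [x _||]; [exact: dF|apply: cvg_at_right_filter; exact: cF|apply: cvg_at_left_filter; exact: cF].
Qed.

Lemma rintg_cauchy : rintg leb (fun x => (1 + x ^+ 2)^-1).
Proof.
have c : continuous (fun x : R => (1 + x ^+ 2)^-1) by exact: continuous_oneDsqrV.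
have p x : 0 <= (1 + x ^+ 2)^-1 :> R by rewrite invr_ge0 addr_ge0 ?sqr_ge0.
apply/integrableP; split; first by apply/measurable_EFinP; exact: continuous_measurable_fun.
under eq_integral do rewrite /= ger0_norm ?p//.
rewrite ge0_symfun_integralT//; last by move=> x /=; rewrite sqrrN.
by rewrite -set_itvcy integral0y_oneDsqr -EFinM ltry.
Qed.

Lemma int_cauchy : \int[leb]_x ((1 + x ^+ 2)^-1) = pi.
Proof.
have c : continuous (fun x : R => (1 + x ^+ 2)^-1) by exact: continuous_oneDsqrV.
have p x : 0 <= (1 + x ^+ 2)^-1 :> R by rewrite invr_ge0 addr_ge0 ?sqr_ge0.
rewrite /Rintegral ge0_symfun_integralT//; last by move=> x /=; rewrite sqrrN.
by rewrite -set_itvcy integral0y_oneDsqr -EFinM /= mulrC divfK.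
Qed.

Lemma ge0_subst (F F' G : R -> R) (D : set R) : measurable D ->
  (forall x : R, is_derive x 1 F (F' x)) -> continuous F' -> (forall x, 0 <= F' x) ->
  {homo F : x y / x < y} -> D = \bigcup_n `[F (- n%:R), F n%:R] ->
  (forall x, D x -> {for x, continuous G}) -> (forall x, D x -> 0 <= G x) ->
  (\int[leb]_(x in D) (G x)%:E = \int[leb]_x (G (F x) * F' x)%:E)%E.
Proof.
move=> mD dF cF' F'0 iF DE cG G0.
have ddF x : derivable F x 1 by apply: ex_derive.
have F'E : derive1 F = F' by apply/funext => x; rewrite derive1E derive_val.
have cF x : {for x, continuous F}.
  by apply: differentiable_continuous; exact/derivable1_diffP.
have iF' : {mono F : x y / x <= y} by apply: le_mono.
have bigT : setT = \bigcup_n `[- n%:R : R, n%:R]%classic.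
  apply/esym; rewrite -subTset => x _.
  exists (Num.Def.archi_bound `|x|) => //=.
  by rewrite in_itv /= -ler_norml ltW// archi_boundP.
have sD n : `[F (- n%:R), F n%:R] `<=` D by rewrite DE => x hx; exists n.
have DF x : D (F x).
  have : setT x by []; rewrite bigT => -[n _] /=; rewrite in_itv /= => xn.
  by apply: (sD n); rewrite /= in_itv /= !iF'.
have cGF x : {for x, continuous (fun x => G (F x) * F' x)}.
  by apply: cvgM; [apply: (@continuous_comp _ _ _ F G) => //; exact: cG|exact: cF'].
have nd1 : nondecreasing_seq (fun n => `[F (- n%:R), F n%:R]%classic).
  move=> m n mn; apply/subsetPset => x /=; rewrite !in_itv /= => /andP[h1 h2].
  rewrite (le_trans _ h1) ?(le_trans h2) ?iF' ?lerN2 ?ler_nat//.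
have nd2 : nondecreasing_seq (fun n => `[- n%:R : R, n%:R]%classic).
  move=> m n mn; apply/subsetPset => x /=; rewrite !in_itv /= => /andP[h1 h2].
  rewrite (le_trans _ h1) ?(le_trans h2) ?lerN2 ?ler_nat//.
have c1 := @ge0_nondecreasing_set_cvg_integral _ (measurableTypeR R) R _ (fun x => (G x)%:E) leb nd1.
have c2 := @ge0_nondecreasing_set_cvg_integral _ (measurableTypeR R) R _ (fun x => (G (F x) * F' x)%:E) leb nd2.
pose A (i : nat) : set R := `[F (- i%:R), F i%:R]%classic.
pose B (i : nat) : set R := `[- i%:R, i%:R]%classic.
have eqi : (fun i : nat => \int[leb]_(x in B i) (G (F x) * F' x)%:E)%E =
   (fun i : nat => \int[leb]_(x in A i) (G x)%:E)%E.
  apply/funext => i; rewrite (@integration_by_substitution_increasing R F G) ?F'E//.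
  - by rewrite lerNl -subr_ge0 opprK -natrD.
  - by move=> x y _ _; exact: iF.
  - by apply/cvg_ex; exists (F' (- i%:R)); apply: cvg_at_right_filter; exact: cF'.
  - by apply/cvg_ex; exists (F' i%:R); apply: cvg_at_left_filter; exact: cF'.
  - exact: (derivable_LR _ _ ddF).
  - by apply: continuous_in_subspaceT => x /set_mem /sD; exact: cG.
rewrite -DE in c1; rewrite -bigT -/B eqi in c2.
apply: (cvg_unique _ (c1 _ _ _) (c2 _ _ _)) => //.
- move=> i; apply/measurable_EFinP; apply: subspace_continuous_measurable_fun => //.
  by apply: continuous_in_subspaceT => x /set_mem /sD; exact: cG.
- by move=> i x /sD xD; rewrite lee_fin G0.
- move=> i; apply/measurable_EFinP; apply: subspace_continuous_measurable_fun => //.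
  by apply: continuous_subspaceT => x; exact: cGF.
- by move=> i x _; rewrite lee_fin mulr_ge0// G0.
Qed.

Lemma rsubst (F F' G : R -> R) (D : set R) : measurable D -> measurable_fun D G ->
  (forall x : R, is_derive x 1 F (F' x)) -> continuous F' -> (forall x, 0 <= F' x) ->
  {homo F : x y / x < y} -> D = \bigcup_n `[F (- n%:R), F n%:R] ->
  (forall x, D x -> {for x, continuous G}) ->
  rintg leb (fun x => G (F x) * F' x) ->
  leb.-integrable D (EFin \o G) /\
  \int[leb]_(x in D) G x = \int[leb]_x (G (F x) * F' x).
Proof.
move=> mD mG dF cF' F'0 iF DE cG iG.
have sub H := @ge0_subst F F' H D mD dF cF' F'0 iF DE.
have cp x : D x -> {for x, continuous (G^\+)%R}.
  by move=> Dx; apply: continuous_max; [exact: cG|exact: cvg_cst].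
have cn x : D x -> {for x, continuous (G^\-)%R}.
  move=> Dx; apply: continuous_max; last exact: cvg_cst.
  by apply: cvgN; exact: cG.
have cN x : D x -> {for x, continuous (fun x => `|G x|)}.
  by move=> Dx; apply: cvg_norm; exact: cG.
split.
  apply/integrableP; split; first exact/measurable_EFinP.
  have -> : (\int[leb]_(x in D) `|(EFin \o G) x| = \int[leb]_(x in D) (`|G x|%R)%:E)%E by [].
  rewrite sub//.
  have /integrableP[_] := iG; apply: le_lt_trans.
  rewrite le_eqVlt; apply/orP; left; apply/eqP; apply: eq_integral => x _ /=.
  by rewrite normrM (ger0_norm (F'0 x)).
rewrite /Rintegral integralE [in RHS]integralE; congr fine; congr (_ - _)%E.
- rewrite [X in integral _ _ X](funerpos G) [in RHS](funerpos (fun x => G (F x) * F' x)).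
  rewrite sub//.
  apply: eq_integral => x _; rewrite /funrpos /=.
  by rewrite maxr_pMl// mul0r.
- rewrite [X in integral _ _ X](funerneg G) [in RHS](funerneg (fun x => G (F x) * F' x)).
  rewrite sub//.
  apply: eq_integral => x _; rewrite /funrneg /=.
  by rewrite maxr_pMl// mul0r mulNr.
Qed.

End RealLine.

Section ComplexLine.
Context (R : realType).
Local Notation C := (Cplx R).
Local Notation leb := (@lebesgue_measure R).
Local Notation cintg := (Cintegrable leb setT).
Local Notation cint := (Cintegral leb setT).
Implicit Types (f g : R -> R) (E : R -> C).

Definition cdiff E (x : R) := exists l, cder E x l.

Lemma cdiff_cont E x : cdiff E x ->
  {for x, continuous (fun y => Re (E y))} /\ {for x, continuous (fun y => Im (E y))}.
Proof. by move=> [l]; exact: cder_continuous. Qed.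

Lemma cdiff_meas E : (forall x, cdiff E x) -> cmeas E.
Proof.
by move=> dE; split; apply: continuous_measurable_fun => x; have [] := cdiff_cont (dE x).
Qed.

Lemma cdiffM E F x : cdiff E x -> cdiff F x -> cdiff (fun y => E y * F y) x.
Proof. by move=> [l h] [k h']; exists (l * F x + E x * k); exact: cderM. Qed.
Lemma cdiffD E F x : cdiff E x -> cdiff F x -> cdiff (fun y => E y + F y) x.
Proof. by move=> [l h] [k h']; exists (l + k); exact: cderD. Qed.
Lemma cdiffN E x : cdiff E x -> cdiff (fun y => - E y) x.
Proof. by move=> [l h]; exists (- l); exact: cderN. Qed.
Lemma cdiff_cexp E x : cdiff E x -> cdiff (fun y => cexp (E y)) x.
Proof. by move=> [l h]; exists (l * cexp (E x)); exact: cder_cexp. Qed.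
Lemma cdiff_cst (c : C) x : cdiff (fun=> c) x.
Proof. by exists 0; exact: cder_cst. Qed.
Lemma cdiff_real f x : derivable f x 1 -> cdiff (fun y => (f y)%:C) x.
Proof. by move=> /derivableP h; exists ('D_1 f x)%:C; exact: cder_real. Qed.
Lemma cdiff_id x : cdiff (fun y => y%:C) x.
Proof. by exists 1; exact: cder_id. Qed.
Lemma cdiff_comp E f x : derivable f x 1 -> cdiff E (f x) -> cdiff (fun y => E (f y)) x.
Proof. by move=> /derivableP h [l hl]; exists (('D_1 f x)%:C * l); exact: cder_comp. Qed.

Lemma rneg f : rintg leb f ->
  rintg leb (fun x => f (- x)) /\ \int[leb]_x f (- x) = \int[leb]_x f x.
Proof.
move=> hf; have mf := rintg_meas hf.
have mN : measurable_fun setT (-%R : measurableTypeR R -> measurableTypeR R).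
  by apply: continuous_measurable_fun; exact: opp_continuous.
have meq (h : R -> \bar R) : (\int[pushforward leb (-%R : _ -> measurableTypeR R)]_x h x = \int[leb]_x h x)%E.
  by apply: eq_measure_integral => A mA _; exact: lebesgue_measureN.
have hN : rintg leb (fun x => f (- x)).
  have /integrableP[mf' lf] := hf.
  apply/integrableP; split; first by apply/measurable_EFinP; exact: measurableT_comp mf mN.
  apply: le_lt_trans lf; rewrite le_eqVlt; apply/orP; left; apply/eqP.
  rewrite -(meq (fun x => `|(EFin \o f) x|%E)).
  rewrite (@ge0_integral_pushforward _ _ _ _ _ _ mN)//.
  exact: measurableT_comp mf'.
split=> //; rewrite /Rintegral -(meq (fun x => (f x)%:E)) (@integral_pushforward _ _ _ _ _ _ mN)//.
by apply/measurable_EFinP.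
Qed.

Lemma cneg E : cintg E -> cintg (fun x => E (- x)) /\ cint (fun x => E (- x)) = cint E.
Proof.
move=> [/rneg[hr er] /rneg[hi ei]]; split; first by split.
by apply: complex_ext; rewrite ?Re_cint ?Im_cint.
Qed.

Lemma csubst (F F' : R -> R) (G : R -> C) (D : set R) : measurable D -> open D ->
  (forall x : R, is_derive x 1 F (F' x)) -> continuous F' -> (forall x, 0 <= F' x) ->
  {homo F : x y / x < y} -> D = \bigcup_n `[F (- n%:R), F n%:R] ->
  (forall x, D x -> cdiff G x) ->
  cintg (fun x => (F' x)%:C * G (F x)) ->
  Cintegrable leb D G /\ Cintegral leb D G = cint (fun x => (F' x)%:C * G (F x)).
Proof.
move=> mD oD dF cF' F'0 iF DE dG [ir ii'].
have cr x : D x -> {for x, continuous (fun x => Re (G x))}.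
  by move=> /dG /cdiff_cont[].
have ci x : D x -> {for x, continuous (fun x => Im (G x))}.
  by move=> /dG /cdiff_cont[].
have mr : measurable_fun D (fun x => Re (G x)).
  by apply: open_continuous_measurable_fun => // x /set_mem; exact: cr.
have mi : measurable_fun D (fun x => Im (G x)).
  by apply: open_continuous_measurable_fun => // x /set_mem; exact: ci.
have er : (fun x => Re ((F' x)%:C * G (F x))) = (fun x => Re (G (F x)) * F' x).
  by apply/funext => x; rewrite cReMr mulrC.
have ei : (fun x => Im ((F' x)%:C * G (F x))) = (fun x => Im (G (F x)) * F' x).
  by apply/funext => x; rewrite cImMr mulrC.
have [|r1 r2] := rsubst mD mr dF cF' F'0 iF DE cr.
  by rewrite -er.
have [|i1 i2] := rsubst mD mi dF cF' F'0 iF DE ci.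
  by rewrite -ei.
split; first by split.
by apply: complex_ext; rewrite ?Re_cint ?Im_cint ?er ?ei /Cintegral /= ?r2 ?i2.
Qed.

Lemma csubst_exp (G : R -> C) : (forall x, 0 < x -> cdiff G x) ->
  cintg (fun x => (expR x)%:C * G (expR x)) ->
  Cintegrable leb `]0, +oo[ G /\
  Cintegral leb `]0, +oo[ G = cint (fun x => (expR x)%:C * G (expR x)).
Proof.
move=> dG iG; apply: (@csubst expR expR) => //.
- exact: continuous_expR.
- by move=> x y; rewrite ltr_expR.
- apply/seteqP; split => x /=; rewrite in_itv /=.
    rewrite andbT => x0; exists (Num.Def.archi_bound `|ln x|) => //=.
    rewrite in_itv /= -[x]lnK ?posrE// !ler_expR expRK -ler_norml ltW//.
    exact: archi_boundP.
  by move=> [n _] /=; rewrite in_itv /= andbT => /andP[+ _]; apply: lt_le_trans; exact: expR_gt0.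
- by move=> x /=; rewrite in_itv /= andbT; exact: dG.
Qed.

Lemma caff_pos (a b : R) E : 0 < a -> (forall x, cdiff E x) -> cintg E ->
  cintg (fun x => E (a * x + b)) /\ a%:C * cint (fun x => E (a * x + b)) = cint E.
Proof.
move=> a0 dE iE; have an : a != 0 by rewrite gt_eqF.
pose F x := a^-1 * (x - b).
have dF (x : R) : is_derive x 1 F a^-1.
  rewrite /F (_ : (fun x => _) = a^-1 \*: (id - cst b)); last by apply/funext.
  by apply: is_derive_eq; rewrite subr0 /GRing.scale /= mulr1.
have [||||||||h1 h2] := @csubst F (fun=> a^-1) (fun x => E (a * x + b)) setT.
- exact: measurableT.
- exact: openT.
- by move=> x; exact: cvg_cst.
- by move=> x; rewrite invr_ge0 ltW.
- by move=> x y xy; rewrite /F ltr_pM2l ?invr_gt0// ltrD2r.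
- apply/esym; rewrite -subTset => x _.
  exists (Num.Def.archi_bound `|a * x + b|) => //=; rewrite in_itv /= /F.
  have := archi_boundP (normr_ge0 (a * x + b)) => /ltW; rewrite ler_norml => /andP[u v].
  by rewrite !(mulrC a^-1) ler_pdivrMr// ler_pdivlMr// lerBlDr lerBrDr (mulrC x) u v.
- move=> x _; apply: cdiff_comp => //.
- under eq_fun do rewrite /F mulVKf// subrK; exact: cintgZ.
have e : (fun x => (a^-1)%:C * E (a * F x + b)) = (fun x => (a^-1)%:C * E x).
  by apply/funext => x; rewrite /F mulVKf// subrK.
by split => //; rewrite h2 e cintZ// mulrA -realCM mulfV// realC1 mul1r.
Qed.

Lemma caff (a b : R) E : a != 0 -> (forall x, cdiff E x) -> cintg E ->
  cintg (fun x => E (a * x + b)) /\ `|a|%:C * cint (fun x => E (a * x + b)) = cint E.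
Proof.
move=> a0 dE iE; have [ap|an|/eqP] := ltgtP a 0; last by rewrite (negPf a0).
- have na : 0 < - a by rewrite oppr_gt0.
  have [h1 h2] := caff_pos b na dE iE.
  have [k1 k2] := cneg h1.
  have e : (fun x => E (- a * - x + b)) = (fun x => E (a * x + b)).
    by apply/funext => x; rewrite mulrNN.
  by rewrite e in k1 k2; rewrite ltr0_norm// k2 h2.
- by rewrite gtr0_norm//; exact: caff_pos.
Qed.

Lemma exp_cauchy (d : R) : 0 < d ->
  exists2 K : R, 0 <= K & forall t : R, expR (- (d * `|t|)) <= K * (1 + t ^+ 2)^-1.
Proof.
move=> d0; pose K := 1 + 2 / d ^+ 2.
have K0 : 0 <= K by rewrite addr_ge0 ?divr_ge0 ?sqr_ge0.
exists K => // t; rewrite ler_pdivlMr; last by rewrite ltr_pwDl ?sqr_ge0.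
rewrite expRN mulrC ler_pdivrMr ?expR_gt0//.
have := @expR_ge1Dxn R (d * `|t|) 1 (mulr_ge0 (ltW d0) (normr_ge0 t)).
have -> : (2`!%:R : R) = 2 by rewrite fact_gt0 || rewrite factE.
move=> h; apply: le_trans (ler_wpM2l K0 h).
rewrite /K exprMn real_normK ?num_real// mulrDl mul1r lerD//.
  by rewrite lerDl mulr_ge0 ?sqr_ge0// mulr_ge0 ?sqr_ge0.
have -> : 2 / d ^+ 2 * (1 + d ^+ 2 * t ^+ 2 / 2) = 2 / d ^+ 2 + t ^+ 2.
  by field; rewrite gt_eqF.
by rewrite lerDr divr_ge0 ?sqr_ge0.
Qed.

Lemma exp2_cauchy (g : R -> R) (a b A : R) : 0 < a -> 0 < b ->
  (forall t, g t <= A * expR (a * t)) -> (forall t, g t <= A * expR (- (b * t))) ->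
  exists2 K : R, 0 <= K & forall t, g t <= K * (1 + t ^+ 2)^-1.
Proof.
move=> a0 b0 h1 h2; pose d := Num.min a b.
have d0 : 0 < d by rewrite lt_min a0.
have [K K0 hK] := exp_cauchy d0.
pose B := Num.max A 0; have B0 : 0 <= B by rewrite le_max lexx orbT.
have AB : A <= B by rewrite le_max lexx.
exists (B * K); first exact: mulr_ge0.
move=> t; rewrite -mulrA (le_trans _ (ler_wpM2l B0 (hK t)))//.
have [t0|t0] := leP 0 t.
- rewrite (le_trans (h2 t))// ger0_norm// (le_trans (ler_wpM2r (expR_ge0 _) AB))//.
  by rewrite ler_wpM2l// ler_expR lerN2 ler_wpM2r// ge_min lexx orbT.
- rewrite (le_trans (h1 t))// ltr0_norm// (le_trans (ler_wpM2r (expR_ge0 _) AB))//.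
  rewrite ler_wpM2l// ler_expR mulrN opprK.
  by rewrite ler_wnM2r// ?(ltW t0)// ge_min lexx.
Qed.

Lemma rintg_majorant (g : R -> R) K : measurable_fun setT g -> (forall t, 0 <= g t) ->
  (forall t, g t <= K * (1 + t ^+ 2)^-1) -> rintg leb g.
Proof.
move=> mg g0 gK; apply: rintg_le (rintgZ K (rintg_cauchy R)) => // t.
by rewrite ger0_norm.
Qed.

Lemma cintg_majorant (E : R -> C) K : cmeas E ->
  (forall t, nc (E t) <= K * (1 + t ^+ 2)^-1) -> cintg E.
Proof. by move=> mE EK; apply: cintg_dom (rintgZ K (rintg_cauchy R)). Qed.

Lemma cint_bnd (E : R -> C) K : cmeas E ->
  (forall t, nc (E t) <= K * (1 + t ^+ 2)^-1) -> nc (cint E) <= K * pi.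
Proof.
move=> mE EK; rewrite -int_cauchy -RintegralZl//; last exact: rintg_cauchy.
by apply: cint_norm_le => //; exact: rintgZ (rintg_cauchy R).
Qed.

Lemma cftc (E E1 : R -> C) (a_ b_ : nat -> R) (D : set R) : measurable D ->
  (forall t, cder E t (E1 t)) -> (forall t, cdiff E1 t) -> cintg E1 ->
  (forall n, a_ n < b_ n) ->
  (forall x, \forall n \near \oo, (a_ n <= x <= b_ n) = (x \in D)) ->
  nc (E (b_ n) - E (a_ n) - Cintegral leb D E1) @[n --> \oo] --> (0 : R).
Proof.
move=> mD dE dE1 iE1 ab aD.
have mE1 := cintg_meas iE1.
have restr (A : set R) : measurable A ->
  Cintegral leb A E1 = cint (fun x => (\1_A x)%:C * E1 x).
  move=> mA; rewrite /Cintegral; congr Complex; rewrite Rintegral_mkcond;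
    apply: eq_Rintegral => x _; rewrite ?cReMr ?cImMr patchE indicE;
    by case: ifP; rewrite ?mul1r ?mul0r.
have F2 n : E (b_ n) - E (a_ n) = cint (fun x => (\1_`[a_ n, b_ n] x)%:C * E1 x).
  rewrite -restr//; apply: complex_ext; csimp; rewrite /Cintegral /= /Rintegral.
  - rewrite (@continuous_FTC2 R (fun x => Re (E1 x)) (fun x => Re (E x)))//.
    + by apply: continuous_subspaceT => x; have [] := cdiff_cont (dE1 x).
    + by apply: derivable_LR => x; have [[]] := dE x.
    + by move=> x _; rewrite derive1E; have [[_ ->]] := dE x.
  - rewrite (@continuous_FTC2 R (fun x => Im (E1 x)) (fun x => Im (E x)))//.
    + by apply: continuous_subspaceT => x; have [] := cdiff_cont (dE1 x).
    + by apply: derivable_LR => x; have [_ []] := dE x.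
    + by move=> x _; rewrite derive1E; have [_ [_ ->]] := dE x.
rewrite restr//; under eq_fun do rewrite F2.
have ind_le (A : set R) x : nc ((\1_A x)%:C * E1 x) <= nc (E1 x).
  rewrite nc_realM indicE; case: (_ \in _); rewrite ?normr1 ?normr0 ?mul1r// mul0r nc_ge0//.
have mI (A : set R) : measurable A -> cmeas (fun x => (\1_A x)%:C * E1 x).
  by move=> mA; apply: cmeasM => //; apply: cmeas_real; exact: measurable_indic.
apply: (@cdct _ _ R leb (fun n x => (\1_`[a_ n, b_ n] x)%:C * E1 x) (fun x => (\1_D x)%:C * E1 x) (fun x => nc (E1 x))) => //.
- by move=> n; exact: mI.
- exact: mI.
- exact: cintg_nc.
- move=> x; apply: cvg_near_cst; near=> n.
  have : (a_ n <= x <= b_ n) = (x \in D) by near: n; exact: aD.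
  rewrite !indicE => <-.
  have -> : (x \in `[a_ n, b_ n]%classic) = (a_ n <= x <= b_ n).
    by apply/idP/idP => [/set_mem|h]; [|apply/mem_set]; rewrite /= in_itv.
  by rewrite subrr nc0.
Unshelve. all: by end_near. Qed.
End ComplexLine.

(** * Integration along vertical lines and Fourier inversion *)

Section Shift.
Context (R : realType).
Local Notation C := (Cplx R).
Local Notation leb := (@lebesgue_measure R).
Local Notation cintg := (Cintegrable leb setT).
Local Notation cint := (Cintegral leb setT).
Implicit Types (E : R -> C).

Lemma near_le_nat (x : R) : \forall n \near \oo, x <= n%:R.
Proof.
near=> n; apply: le_trans (ler_norm x) _; apply/ltW.
apply: lt_le_trans (archi_boundP (normr_ge0 x)) _; rewrite ler_nat.
by near: n; exact: nbhs_infty_ge.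
Unshelve. all: by end_near. Qed.

Lemma cauchy_cvg0 (f : nat -> R) K : (forall n, 0 <= f n) ->
  (forall n, f n <= K * (1 + n%:R ^+ 2)^-1) -> f n @[n --> \oo] --> (0 : R).
Proof.
move=> f0 fK; apply/cvgrPdist_le => e e0; near=> n.
rewrite sub0r normrN ger0_norm// (le_trans (fK n))// ler_pdivrMr ?ltr_pwDl ?sqr_ge0//.
rewrite mulrC -ler_pdivrMr// (@le_trans _ _ n%:R)//.
  by near: n; exact: near_le_nat.
set x : R := n%:R; have := sqr_ge0 (x - 1); nra.
Unshelve. all: by end_near. Qed.

Lemma nc_cvg_unique (u : nat -> C) (l k : C) :
  nc (u n - l) @[n --> \oo] --> (0 : R) -> nc (u n - k) @[n --> \oo] --> (0 : R) -> l = k.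
Proof.
move=> h1 h2; apply/eqP; rewrite -subr_eq0 -nc_eq0 eq_le nc_ge0 andbT.
apply/ler_addgt0Pl => e e0; rewrite addr0.
have e2 : 0 < e / 2 by rewrite divr_gt0.
have [n [a b]] : exists n, nc (u n - l) <= e / 2 /\ nc (u n - k) <= e / 2.
  near \oo => n; exists n; split.
  - have : `|0 - nc (u n - l)| <= e / 2 by near: n; move/cvgrPdist_le: h1; apply.
    by rewrite sub0r normrN ger0_norm// nc_ge0.
  - have : `|0 - nc (u n - k)| <= e / 2 by near: n; move/cvgrPdist_le: h2; apply.
    by rewrite sub0r normrN ger0_norm// nc_ge0.
rewrite (_ : l - k = (u n - k) - (u n - l)); last by ring.
by rewrite (le_trans (ncB _ _))// (splitr e) lerD.
Unshelve. all: by end_near. Qed.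

Lemma cauchy_anti (x y : R) : 0 <= x <= y -> (1 + y ^+ 2)^-1 <= (1 + x ^+ 2)^-1.
Proof.
move=> /andP[x0 xy]; rewrite lef_pV2 ?posrE ?ltr_pwDl ?sqr_ge0//.
by rewrite lerD2l lerXn2r ?nnegrE// (le_trans x0).
Qed.

Lemma majorant_ge0 (E : R -> C) K : (forall t, nc (E t) <= K * (1 + t ^+ 2)^-1) -> 0 <= K.
Proof.
by move=> EK; have := EK 0; rewrite expr0n addr0 invr1 mulr1; apply: le_trans; exact: nc_ge0.
Qed.

Lemma cint_deriv0 (E E1 : R -> C) K : (forall t, cder E t (E1 t)) ->
  (forall t, cdiff E1 t) -> cintg E1 ->
  (forall t, nc (E t) <= K * (1 + t ^+ 2)^-1) -> cint E1 = 0.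
Proof.
move=> dE dE1 iE1 EK; have K0 := majorant_ge0 EK.
pose a_ (n : nat) : R := - n.+1%:R; pose b_ (n : nat) : R := n.+1%:R.
have h : nc (E (b_ n) - E (a_ n) - Cintegral leb setT E1) @[n --> \oo] --> (0 : R).
  apply: cftc => //.
  - by move=> n; rewrite /a_ /b_ (@lt_trans _ _ 0)// oppr_lt0.
  - move=> x; near=> n; rewrite in_setT /a_ /b_ -ler_norml.
    rewrite (@le_trans _ _ n%:R) ?ler_nat//.
    by near: n; exact: near_le_nat.
apply: nc_cvg_unique h _.
apply: (@cauchy_cvg0 _ (K + K)) => n; first exact: nc_ge0.
rewrite subr0 (le_trans (ncB _ _))// mulrDl /b_ /a_ lerD// (le_trans (EK _))// ?sqrrN ler_wpM2l//.
all: by rewrite cauchy_anti// ler0n ler_nat /=.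
Unshelve. all: by end_near. Qed.

Lemma cint_deriv_half (E E1 : R -> C) K : (forall t, cder E t (E1 t)) ->
  (forall t, cdiff E1 t) -> cintg E1 ->
  (forall t, nc (E t) <= K * (1 + t ^+ 2)^-1) -> Cintegral leb `]-oo, 0[ E1 = E 0.
Proof.
move=> dE dE1 iE1 EK; have K0 := majorant_ge0 EK.
pose a_ (n : nat) : R := - n.+1%:R; pose b_ (n : nat) : R := 0.
have h : nc (E (b_ n) - E (a_ n) - Cintegral leb `]-oo, 0%R] E1) @[n --> \oo] --> (0 : R).
  apply: cftc => //.
  - by move=> n; rewrite /a_ oppr_lt0.
  - move=> x; near=> n.
    have -> : (x \in `]-oo, 0%R]%classic) = (x <= 0).
      by apply/idP/idP => [/set_mem|hx]; [|apply/mem_set]; rewrite /= in_itv.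
    rewrite /b_ andb_idl// => x0.
    rewrite /a_ lerNl (le_trans (ler_norm _))// normrN (@le_trans _ _ n%:R) ?ler_nat//.
    by near: n; exact: near_le_nat.
have -> : Cintegral leb `]-oo, 0[ E1 = Cintegral leb `]-oo, 0%R] E1.
  have [i1 i2] := iE1.
  by rewrite /Cintegral; congr Complex; apply: Rintegral_itv_bndo_bndc;
    [apply: integrableS i1|apply: integrableS i2].
apply: nc_cvg_unique h _.
apply: (@cauchy_cvg0 _ K) => n; first exact: nc_ge0.
rewrite /b_ /a_ addrAC subrr sub0r ncN (le_trans (EK _))// ler_wpM2l//.
by rewrite sqrrN cauchy_anti// ler0n ler_nat /=.
Unshelve. all: by end_near. Qed.

Lemma rderiv_under (f f' : R -> R -> R) (u v K p : R) : u < p < v ->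
  (forall q, u < q < v -> rintg leb (f q)) ->
  (forall q t, u < q < v -> is_derive q 1 (fun q => f q t) (f' q t)) ->
  (forall q t, u < q < v -> `|f' q t| <= K * (1 + t ^+ 2)^-1) ->
  is_derive p 1 (fun q => \int[leb]_t f q t) (\int[leb]_t f' p t).
Proof.
move=> hp c1 d c3.
have inI (q : R) : `]u, v[%classic q = (u < q < v) by rewrite /= in_itv.
have iG : rintg leb (fun t => K * (1 + t ^+ 2)^-1) by exact: rintgZ (rintg_cauchy R).
have K0 : 0 <= K.
  by have := c3 p 0 hp; rewrite expr0n addr0 invr1 mulr1; apply: le_trans.
have G0 t : 0 <= K * (1 + t ^+ 2)^-1 by rewrite mulr_ge0// invr_ge0 addr_ge0 ?sqr_ge0.
have Ia : `]u, v[%classic p by rewrite inI.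
have c1' q : `]u, v[%classic q -> leb.-integrable setT (EFin \o f q) by rewrite inI => /c1.
have c2' q t : `]u, v[%classic q -> setT t -> derivable (fun q => f q t) q 1.
  by rewrite inI => /(d q t)[].
have c3' q t : `]u, v[%classic q -> setT t -> `|partial1of2 f q t| <= K * (1 + t ^+ 2)^-1.
  by rewrite inI => hq _; rewrite partial1of2E; have [_ ->] := d q t hq; exact: c3.
split; first exact: (derivable_under_integral measurableT Ia c1' c2' G0 iG c3').
rewrite -derive1E (differentiation_under_integral measurableT Ia c1' c2' G0 iG c3').
apply: eq_Rintegral => t _.
by rewrite partial1of2E; have [_ ->] := d p t hp.
Qed.

Lemma cint_shift (E E1 : R -> R -> C) (kap : C) (u v K : R) :
  (forall p t, u < p < v -> cder (E p) t (E1 p t)) ->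
  (forall p t, u < p < v -> cdiff (E1 p) t) ->
  (forall p t, u < p < v -> cder (fun q => E q t) p (kap * E1 p t)) ->
  (forall p t, u < p < v -> nc (E p t) <= K * (1 + t ^+ 2)^-1) ->
  (forall p t, u < p < v -> nc (E1 p t) <= K * (1 + t ^+ 2)^-1) ->
  forall p1 p2, u < p1 < v -> u < p2 < v -> cint (E p1) = cint (E p2).
Proof.
move=> dt dE1 dp EK E1K.
have iE p : u < p < v -> cintg (E p).
  move=> hp; apply: cintg_majorant (fun t => EK p t hp).
  by apply: cdiff_meas => t; exists (E1 p t); exact: dt.
have iE1 p : u < p < v -> cintg (E1 p).
  move=> hp; apply: cintg_majorant (fun t => E1K p t hp).
  by apply: cdiff_meas => t; exact: dE1.
have z p : u < p < v -> cint (E1 p) = 0.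
  by move=> hp; apply: (@cint_deriv0 (E p) _ K) => [t|t||t]; [exact: dt|exact: dE1|exact: iE1|exact: EK].
have kE1K p t : u < p < v -> nc (kap * E1 p t) <= (nc kap * K) * (1 + t ^+ 2)^-1.
  by move=> hp; rewrite ncM -mulrA ler_wpM2l ?nc_ge0// E1K.
have dJ p : u < p < v -> cder (fun q => cint (E q)) p 0.
  move=> hp.
  have z1 : cint (fun t => kap * E1 p t) = 0 by rewrite cintZ ?z ?mulr0//; exact: iE1.
  rewrite -z1; split; rewrite ?Re_cint ?Im_cint.
  - apply: (@rderiv_under (fun q t => Re (E q t)) (fun q t => Re (kap * E1 q t)) u v (nc kap * K)) => //.
    + by move=> q /iE[].
    + by move=> q t /(dp q t)[].
    + by move=> q t hq; apply: le_trans (nc_Re _) (kE1K _ _ hq).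
  - apply: (@rderiv_under (fun q t => Im (E q t)) (fun q t => Im (kap * E1 q t)) u v (nc kap * K)) => //.
    + by move=> q /iE[].
    + by move=> q t /(dp q t)[].
    + by move=> q t hq; apply: le_trans (nc_Im _) (kE1K _ _ hq).
have W p1 p2 : p1 <= p2 -> u < p1 < v -> u < p2 < v -> cint (E p1) = cint (E p2).
  move=> p12 /andP[h1 _] /andP[_ h2].
  apply/esym/eqP; rewrite -subr_eq0 -nc_eq0 eq_le nc_ge0 andbT.
  rewrite -[leRHS](mul0r (p2 - p1)).
  apply: (@cMVT R (fun q => cint (E q)) (fun=> 0)) => // y /andP[y1 y2]; last by rewrite nc0.
  by apply: dJ; rewrite (lt_le_trans h1)// (le_lt_trans y2).
move=> p1 p2 h1 h2; case/orP: (le_total p1 p2) => h; first exact: W.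
by apply/esym; exact: W.
Qed.

End Shift.

Section FourierInversion.
Context (R : realType).
Local Notation C := (Cplx R).
Local Notation leb := (@lebesgue_measure R).
Local Notation cintg := (Cintegrable leb setT).
Local Notation cint := (Cintegral leb setT).

Lemma nc_cvg0 (u v : nat -> R) : (forall n, 0 <= u n) -> (forall n, u n <= v n) ->
  v n @[n --> \oo] --> (0 : R) -> u n @[n --> \oo] --> (0 : R).
Proof.
move=> u0 uv v0; apply: (@squeeze_cvgr _ _ _ _ (cst 0) v) => //; last exact: cvg_cst.
by apply: nearW => n; rewrite u0 uv.
Qed.

Lemma ccvg (f : R -> C) (x : R) (u : nat -> R) : cdiff f x ->
  u n @[n --> \oo] --> x -> nc (f (u n) - f x) @[n --> \oo] --> (0 : R).
Proof.
move=> /cdiff_cont[cr ci] ux.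
apply: (@nc_cvg0 _ (fun n => `|Re (f (u n)) - Re (f x)| + `|Im (f (u n)) - Im (f x)|)).
- by move=> n; exact: nc_ge0.
- by move=> n; rewrite (le_trans (nc_ReIm _))// !(cReD, cReN, cImD, cImN).
- rewrite -[X in _ --> X]addr0; apply: cvgD.
  + rewrite -(@normr0 _ R); apply: cvg_norm; rewrite -(subrr (Re (f x))).
    by apply: cvgB; [exact: (cvg_comp _ _ ux cr)|exact: cvg_cst].
  + rewrite -(@normr0 _ R); apply: cvg_norm; rewrite -(subrr (Im (f x))).
    by apply: cvgB; [exact: (cvg_comp _ _ ux ci)|exact: cvg_cst].
Qed.

Lemma cvg_invS : (n.+1%:R : R)^-1 @[n --> \oo] --> (0 : R).
Proof. exact: cvg_harmonic. Qed.

Lemma gauss_bnd (t : R) : expR (- t ^+ 2) <= 4 * (1 + t ^+ 2)^-1 ^+ 2.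
Proof.
have p : 0 < 1 + t ^+ 2 by rewrite ltr_pwDl ?sqr_ge0.
rewrite (_ : 4 * _ = ((1 + t ^+ 2) / 2)^-1 ^+ 2); last by field; rewrite gt_eqF.
rewrite (_ : - t ^+ 2 = - (t ^+ 2 / 2) + - (t ^+ 2 / 2)); last by field.
rewrite expRD -expr2 lerXn2r ?nnegrE ?expR_ge0 ?invr_ge0 ?divr_ge0 ?(ltW p)//.
rewrite expRN lef_pV2 ?posrE ?expR_gt0 ?divr_gt0//.
rewrite (le_trans _ (expR_ge1Dx _))//; have := sqr_ge0 t; lra.
Qed.

Lemma gauss_bnd1 (t : R) : expR (- t ^+ 2) <= 4 * (1 + t ^+ 2)^-1.
Proof.
have p : 0 < 1 + t ^+ 2 by rewrite ltr_pwDl ?sqr_ge0.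
rewrite (le_trans (gauss_bnd t))// ler_wpM2l// expr2 ler_piMl ?invr_ge0 ?(ltW p)//.
by rewrite invf_le1// lerDl sqr_ge0.
Qed.

Lemma cint_gauss_shift (p : R) :
  cint (fun t => cexp (- ((t%:C + ii * p%:C) * (t%:C + ii * p%:C)))) = (Num.sqrt pi)%:C.
Proof.
pose P : R := `|p| + 1.
have P0 : 0 <= P by rewrite addr_ge0.
pose g (p t : R) : C := t%:C + ii * p%:C.
pose E p t := cexp (- (g p t * g p t)).
pose E1 p t := - (g p t + g p t) * E p t.
have dgt q t : cder (g q) t 1.
  by rewrite -[X in cder _ _ X]addr0; apply: cderD (cder_id _) (cder_cst _ _).
have dgp q t : cder (fun q => g q t) q ii.
  rewrite -[X in cder _ _ X]add0r -[X in _ + X]mulr1.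
  by apply: cderD (cder_cst _ _) (cderZ _ (cder_id _)).
have ncE' q t : nc (E q t) = expR (q ^+ 2) * expR (- t ^+ 2).
  by rewrite /E nc_cexp -expRD /g; congr expR; csimp; ring.
pose K := expR (P ^+ 2) * (8 * (1 + P)).
have K0 : 0 <= K by rewrite mulr_ge0 ?expR_ge0 ?mulr_ge0 ?addr_ge0.
have Eb q t : - P < q < P -> nc (E q t) <= expR (P ^+ 2) * (4 * (1 + t ^+ 2)^-1 ^+ 2).
  move=> hq; rewrite ncE' ler_pM ?expR_ge0 ?gauss_bnd// ler_expR.
  rewrite -(real_normK (num_real q)) lerXn2r ?nnegrE//.
  by rewrite ltW// ltr_norml.
have i1 (t : R) : 0 <= (1 + t ^+ 2)^-1 <= 1.
  by rewrite invr_ge0 addr_ge0 ?sqr_ge0//= invf_le1 ?ltr_pwDl ?sqr_ge0// lerDl sqr_ge0.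
have Kge t : 0 <= expR (P ^+ 2) * (4 * (1 + t ^+ 2)^-1).
  by rewrite mulr_ge0 ?expR_ge0// mulr_ge0//; case/andP: (i1 t).
have -> : cint (fun t => cexp (- ((t%:C + ii * p%:C) * (t%:C + ii * p%:C)))) = cint (E p) by [].
rewrite (@cint_shift R E E1 ii (- P) P K _ _ _ _ _ p 0).
- transitivity (cint (fun t => (expR (- t ^+ 2))%:C)).
    congr cint; apply/funext => t; rewrite /E /g realC0 mulr0 addr0 -cexp_real realCN.
    by rewrite expr2 realCM.
  have e : (fun t : R => expR (- t ^+ 2)) = gauss_fun by [].
  rewrite /Cintegral /=; apply: complex_ext => /=; last by rewrite Rintegral_cst// mul0r.
  by rewrite /Rintegral integralT_gauss.
- move=> q t _; rewrite /E1 /E.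
  have -> : - (g q t + g q t) = - (1 * g q t + g q t * 1) by ring.
  by apply: cder_cexp; apply: cderN; apply: cderM.
- move=> q t _; apply: cdiffM; first by apply: cdiffN; apply: cdiffD; exists 1.
  by apply: cdiff_cexp; apply: cdiffN; apply: cdiffM; exists 1.
- move=> q t _; rewrite /E1 /E.
  rewrite (_ : ii * _ = - (ii * g q t + g q t * ii) * cexp (- (g q t * g q t))); last by ring.
  by apply: cder_cexp; apply: cderN; apply: cderM.
- move=> q t hq; rewrite (le_trans (Eb q t hq))// /K -!mulrA ler_wpM2l ?expR_ge0//.
  have /andP[a b] := i1 t; set i := (1 + t ^+ 2)^-1 in a b *.
  have : i ^+ 2 <= i by rewrite expr2 ler_piMl.
  move=> h; have h' : 0 <= P * i by rewrite mulr_ge0.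
  lra.
- move=> q t hq; rewrite /E1 ncM ncN (@le_trans _ _ ((2 * (`|t| + P)) * (expR (P ^+ 2) * (4 * (1 + t ^+ 2)^-1 ^+ 2))))//.
    rewrite ler_pM ?nc_ge0 ?Eb//.
    rewrite (le_trans (ncD _ _))// -mulr2n -[leLHS]mulr_natl ler_wpM2l//.
    rewrite (le_trans (ncD _ _))// nc_real lerD2l ncM nc_ii mul1r nc_real ltW//.
    by rewrite ltr_norml.
  have /andP[a b] := i1 t; set i := (1 + t ^+ 2)^-1 in a b *.
  have e : (1 + t ^+ 2) * i = 1 by rewrite /i mulfV// gt_eqF// ltr_pwDl ?sqr_ge0.
  have h : `|t| <= 1 + t ^+ 2.
    by rewrite -(real_normK (num_real t)); have := sqr_ge0 (`|t| - 1); nra.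
  have h2 : (`|t| + P) * i <= 1 + P.
    rewrite mulrDl lerD// ?ler_piMr// -e ler_wpM2r//.
  have -> : 2 * (`|t| + P) * (expR (P ^+ 2) * (4 * i ^+ 2)) =
    expR (P ^+ 2) * (8 * (((`|t| + P) * i) * i)) by ring.
  by rewrite /K -!mulrA !ler_wpM2l ?expR_ge0// mulrA ler_wpM2r.
- by rewrite /P; have := ler_norm p; have := ler_norm (- p); rewrite normrN => ? ?; lra.
- by rewrite /P; have := normr_ge0 p => ?; lra.
Qed.

Lemma cint_gauss (s : R) :
  cint (fun t => cexp (- (t ^+ 2)%:C) * cexp (ii * (t * s)%:C)) =
  (Num.sqrt pi * expR (- (s / 2) ^+ 2))%:C.
Proof.
have m : cintg (fun t : R => cexp (- (t ^+ 2)%:C) * cexp (ii * (t * s)%:C)).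
  apply: (@cintg_majorant R _ 4).
    apply: cdiff_meas => t; apply: cdiffM; apply: cdiff_cexp.
      by apply: cdiffN; apply: cdiff_real.
    by apply: cdiffM; [exact: cdiff_cst|apply: cdiff_real].
  move=> t; rewrite ncM !nc_cexp; csimp.
  by rewrite !mul0r mul1r !subr0 expR0 mulr1 gauss_bnd1.
have := cint_gauss_shift (- (s / 2)).
have -> : (fun t : R => cexp (- ((t%:C + ii * (- (s / 2))%:C) * (t%:C + ii * (- (s / 2))%:C)))) =
  (fun t => cexp (((s / 2) ^+ 2)%:C) * (cexp (- (t ^+ 2)%:C) * cexp (ii * (t * s)%:C))).
  apply/funext => t; rewrite -!cexpD; congr cexp.
  by apply: complex_ext; csimp; field.
rewrite cintZ// => H.
by rewrite realCM -H -cexp_real realCN cexpN mulrAC mulfV ?cexp_neq0// mul1r.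
Qed.

Lemma cint_gauss_scaled (e s : R) : 0 < e ->
  cint (fun t => cexp (- ((e * t) ^+ 2)%:C) * cexp (ii * (t * s)%:C)) =
  (e^-1 * (Num.sqrt pi * expR (- (s / e / 2) ^+ 2)))%:C.
Proof.
move=> e0; have en : e != 0 by rewrite gt_eqF.
pose E (t : R) := cexp (- (t ^+ 2)%:C) * cexp (ii * (t * (s / e))%:C).
have dE t : cdiff E t.
  apply: cdiffM; apply: cdiff_cexp.
    by apply: cdiffN; apply: cdiff_real.
  by apply: cdiffM; [exact: cdiff_cst|apply: cdiff_real].
have iE : cintg E.
  apply: (@cintg_majorant R _ 4); first exact: cdiff_meas.
  move=> t; rewrite ncM !nc_cexp; csimp.
  by rewrite !mul0r mul1r !subr0 expR0 mulr1 gauss_bnd1.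
have [_ h] := caff 0 en dE iE.
have H := cint_gauss (s / e); rewrite -/E -h in H; rewrite realCM -H.
rewrite gtr0_norm// mulrA -realCM mulVf// realC1 mul1r; congr cint.
apply/funext => t; rewrite /E addr0; congr (cexp _ * cexp (ii * _%:C)).
by field.
Qed.

Lemma fourier_inversion (f fh : R -> C) (K K' : R) : (forall x, cdiff f x) -> cmeas fh ->
  (forall x, nc (f x) <= K * (1 + x ^+ 2)^-1) ->
  (forall t, fh t = cint (fun x => f x * cexp (- (ii * (t * x)%:C)))) ->
  (forall t, nc (fh t) <= K' * (1 + t ^+ 2)^-1) ->
  forall x, (2 * pi)%:C * f x = cint (fun t => fh t * cexp (ii * (t * x)%:C)).
Proof.
move=> df mfh fK fhE fhK x.
have K0 := majorant_ge0 fK.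
have if_ : cintg f by exact: cintg_majorant (cdiff_meas df) fK.
pose e_ (n : nat) : R := n.+1%:R^-1.
have e0 n : 0 < e_ n by rewrite invr_gt0.
pose k n (t : R) := cexp (- ((e_ n * t) ^+ 2)%:C) * cexp (ii * (t * x)%:C).
have dk n t : cdiff (k n) t.
  apply: cdiffM; apply: cdiff_cexp.
    by apply: cdiffN; apply: cdiff_real.
  by apply: cdiffM; [exact: cdiff_cst|apply: cdiff_real].
have nck n t : nc (k n t) = expR (- (e_ n * t) ^+ 2).
  by rewrite ncM !nc_cexp; csimp; rewrite mul0r mul1r subr0 expR0 mulr1.
have ik n : cintg (k n).
  have [|||h _] := @caff R (e_ n) 0 (fun t => cexp (- (t ^+ 2)%:C) * cexp (ii * (t * (x / e_ n))%:C)).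
  - by rewrite gt_eqF.
  - move=> t; apply: cdiffM; apply: cdiff_cexp.
      by apply: cdiffN; apply: cdiff_real.
    by apply: cdiffM; [exact: cdiff_cst|apply: cdiff_real].
  - apply: (@cintg_majorant R _ 4).
      apply: cdiff_meas => t; apply: cdiffM; apply: cdiff_cexp.
        by apply: cdiffN; apply: cdiff_real.
      by apply: cdiffM; [exact: cdiff_cst|apply: cdiff_real].
    move=> t; rewrite ncM !nc_cexp; csimp.
    by rewrite !mul0r mul1r !subr0 expR0 mulr1 gauss_bnd1.
  rewrite (_ : k n = (fun t => cexp (- ((e_ n * t + 0) ^+ 2)%:C) * cexp (ii * ((e_ n * t + 0) * (x / e_ n))%:C)))//.
  apply/funext => t; rewrite /k addr0; congr (_ * cexp (ii * _%:C)).
  by field; rewrite gt_eqF.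
pose e (z : R * R) : C := cexp (- (ii * (z.2 * z.1)%:C)).
have me : cmeas e.
  apply: cmeas_cexp; apply: cmeasN; apply: cmeasM; first exact: cmeas_cst.
  by apply: cmeas_real; apply: measurable_funM; [exact: measurable_snd|exact: measurable_fst].
have e1 z : nc (e z) <= 1.
  by rewrite nc_cexp; csimp; rewrite mul0r mul1r subrr oppr0 expR0.
have F n : cint (fun s => f (2 * e_ n * s + x) * (2 * Num.sqrt pi * expR (- s ^+ 2))%:C) =
    cint (fun t => k n t * fh t).
  have [_ _] := cfubini_kernel if_ (ik n) me e1.
  rewrite (_ : (fun t => k n t * cint (fun y => f y * e (y, t))) = (fun t => k n t * fh t)); last first.
    by apply/funext => t; rewrite fhE.
  move=> <-.
  have en : e_ n != 0 by rewrite gt_eqF.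
  pose G y := f y * ((e_ n)^-1 * (Num.sqrt pi * expR (- ((x - y) / e_ n / 2) ^+ 2)))%:C.
  have -> : (fun y => f y * cint (fun t => k n t * e (y, t))) = G.
    apply/funext => y; rewrite /G -cint_gauss_scaled//; congr (_ * cint _).
    apply/funext => t; rewrite /k /e /= -mulrA -cexpD; congr (_ * cexp _).
    by apply: complex_ext; csimp; ring.
  have dG y : cdiff G y.
    apply: cdiffM => //; apply: cdiff_real.
    by apply: ex_derive.
  have iG : cintg G.
    rewrite (_ : G = (fun y => ((e_ n)^-1 * (Num.sqrt pi * expR (- ((x - y) / e_ n / 2) ^+ 2)))%:C * f y)); last first.
      by apply/funext => y; rewrite mulrC.
    apply: (@cintgMbnd _ _ _ _ _ _ (`|(e_ n)^-1 * Num.sqrt pi|)) => //.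
      by apply: cdiff_meas => y; apply: cdiff_real; apply: ex_derive.
    move=> y; rewrite nc_real mulrA normrM ler_piMr// ger0_norm ?expR_ge0//.
    by rewrite -expR0 ler_expR oppr_le0 sqr_ge0.
  have n2 : 2 * e_ n != 0 by rewrite mulf_neq0.
  have [h1 <-] := caff x n2 dG iG.
  rewrite -cintZ//; congr cint; apply/funext => s; rewrite /G mulrCA -realCM; congr (_ * _%:C).
  rewrite gtr0_norm ?mulr_gt0//.
  have -> : (x - (2 * e_ n * s + x)) / e_ n / 2 = - s by field.
  by rewrite sqrrN; field.
have L1 : nc (cint (fun t => k n t * fh t) - cint (fun t => fh t * cexp (ii * (t * x)%:C)))
    @[n --> \oo] --> (0 : R).
  apply: (@cdct _ _ R leb (fun n t => k n t * fh t) (fun t => fh t * cexp (ii * (t * x)%:C))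
    (fun t => K' * (1 + t ^+ 2)^-1)).
  - by move=> n; apply: cmeasM => //; exact: cdiff_meas.
  - apply: cmeasM => //; apply: cdiff_meas => t; apply: cdiff_cexp.
    by apply: cdiffM; [exact: cdiff_cst|apply: cdiff_real].
  - move=> n t; rewrite ncM nck (le_trans _ (fhK t))// ler_piMl ?nc_ge0//.
    by rewrite -expR0 ler_expR oppr_le0 sqr_ge0.
  - move=> t; rewrite ncM nc_cexp; csimp; rewrite mul0r mul1r subrr expR0 mulr1; exact: fhK.
  - exact: rintgZ (rintg_cauchy R).
  - move=> t.
    have h : nc (cexp (- ((e_ n * t) ^+ 2)%:C) - 1) @[n --> \oo] --> (0 : R).
      have := @ccvg (fun e => cexp (- ((e * t) ^+ 2)%:C)) 0 e_.
      rewrite mul0r expr0n realC0 oppr0 cexp0; apply; last exact: cvg_invS.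
      by apply: cdiff_cexp; apply: cdiffN; apply: cdiff_real.
    rewrite (_ : (fun n => _) = (fun n => nc (cexp (- ((e_ n * t) ^+ 2)%:C) - 1) * nc (fh t))).
      by rewrite -(mul0r (nc (fh t))); apply: cvgM => //; exact: cvg_cst.
    apply/funext => n; rewrite -ncM.
    rewrite [in LHS](_ : _ - _ = cexp (ii * (t * x)%:C) * ((cexp (- ((e_ n * t) ^+ 2)%:C) - 1) * fh t)).
      by rewrite ncM nc_cexp; csimp; rewrite mul0r mul1r subrr expR0 mul1r.
    by rewrite /k; ring.
apply/esym; apply: nc_cvg_unique L1 _.
under eq_fun do rewrite -F.
have -> : (2 * pi)%:C * f x = cint (fun s => f x * (2 * Num.sqrt pi * expR (- s ^+ 2))%:C).
  have ig : cintg (fun s : R => (expR (- s ^+ 2))%:C).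
    apply: (@cintg_majorant R _ 4); first by apply: cdiff_meas => s; apply: cdiff_real.
    by move=> s; rewrite nc_real ger0_norm ?expR_ge0// gauss_bnd1.
  transitivity (cint (fun s => (f x * (2 * Num.sqrt pi)%:C) * (expR (- s ^+ 2))%:C)).
    rewrite cintZ//.
    have -> : cint (fun s => (expR (- s ^+ 2))%:C) = (Num.sqrt pi)%:C.
      rewrite /Cintegral /=; apply: complex_ext => /=; last by rewrite Rintegral_cst// mul0r.
      by rewrite /Rintegral integralT_gauss.
    by rewrite -mulrA -realCM -mulrA -expr2 sqr_sqrtr ?pi_ge0// mulrC.
  by congr cint; apply/funext => s; rewrite -mulrA -realCM.
have hm : measurable_fun setT (fun s : R => 2 * Num.sqrt pi * expR (- s ^+ 2)).
  by apply: continuous_measurable_fun => s; apply: differentiable_continuous;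
    apply/derivable1_diffP; apply: ex_derive.
have h0 (s : R) : 0 <= 2 * Num.sqrt pi * expR (- s ^+ 2).
  by rewrite mulr_ge0 ?expR_ge0// mulr_ge0// sqrtr_ge0.
have fK' y : nc (f y) <= K.
  rewrite (le_trans (fK y))// ler_piMr// invf_le1 ?ltr_pwDl ?sqr_ge0//.
  by rewrite lerDl sqr_ge0.
apply: (@cdct _ _ R leb (fun n s => f (2 * e_ n * s + x) * (2 * Num.sqrt pi * expR (- s ^+ 2))%:C)
  (fun s => f x * (2 * Num.sqrt pi * expR (- s ^+ 2))%:C)
    (fun s => K * (2 * Num.sqrt pi * expR (- s ^+ 2)))).
- move=> n; apply: cmeasM; last exact: cmeas_real.
  by apply: cdiff_meas => s; apply: cdiff_comp.
- by apply: cmeasM; [exact: cmeas_cst|exact: cmeas_real].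
- by move=> n s; rewrite ncM nc_real (ger0_norm (h0 s)) ler_wpM2r.
- by move=> s; rewrite ncM nc_real (ger0_norm (h0 s)) ler_wpM2r.
- apply: rintgZ; apply: rintgZ.
  apply: (@rintg_majorant R _ 4) => [|s|s]; last exact: gauss_bnd1; last exact: expR_ge0.
  by apply: continuous_measurable_fun => s; apply: differentiable_continuous;
    apply/derivable1_diffP; apply: ex_derive.
- move=> s; under eq_fun do rewrite -mulrBl ncM.
  rewrite -(mul0r (nc (2 * Num.sqrt pi * expR (- s ^+ 2))%:C)); apply: cvgM; last exact: cvg_cst.
  apply: (@ccvg f x (fun n => 2 * e_ n * s + x)) => //.
  rewrite -[X in _ --> X]add0r; apply: cvgD; last exact: cvg_cst.
  rewrite -(mul0r s); apply: cvgM; last exact: cvg_cst.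
  rewrite -(mulr0 2); apply: cvgM; [exact: cvg_cst|exact: cvg_invS].
Qed.

End FourierInversion.

(** * The space S(R_+) *)

Section SpaceSTheory.
Context (R : realType).
Local Notation C := (Cplx R).
Implicit Types (f g : R -> C).

Definition Dfun f (x : R) : C :=
  derive1 (fun y => Re (f y)) x +i* derive1 (fun y => Im (f y)) x.

Lemma cder_near f g (x d : R) (l : C) : 0 < d ->
  (forall y, `|y - x| < d -> f y = g y) -> cder g x l -> cder f x l.
Proof.
move=> d0 fg /cder_epsP H; apply/cder_epsP => e /H[d' d'0 hd'].
exists (Num.min d d'); first by rewrite lt_min d0.
move=> h; rewrite lt_min => /andP[h1 h2].
rewrite !fg ?subrr ?normr0//; first exact: hd'.
by rewrite addrAC subrr add0r.
Qed.

Lemma S_cder f x : is_spaceS f -> cder f x (Dfun f x).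
Proof.
move=> [hr hi]; split; rewrite /Dfun /= derive1E.
- by apply/derivableP; exact: (is_spaceS_smooth hr (k := 0)).
- by apply/derivableP; exact: (is_spaceS_smooth hi (k := 0)).
Qed.

Lemma S_cdiff f x : is_spaceS f -> cdiff f x.
Proof. by move=> hf; exists (Dfun f x); exact: S_cder. Qed.

Lemma cder_D f x l : cder f x l -> Dfun f x = l.
Proof. by move=> [[_ a] [_ b]]; apply: complex_ext; rewrite /Dfun /= derive1E. Qed.

Lemma S_out f x : is_spaceS f -> x <= 0 -> f x = 0.
Proof.
move=> [hr hi]; rewrite le_eqVlt => /predU1P[->|x0]; apply: complex_ext.
- exact: (is_spaceS_flat hr 0).
- exact: (is_spaceS_flat hi 0).
- exact: (is_spaceS_out hr).
- exact: (is_spaceS_out hi).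
Qed.

Lemma S_real_D (f : R -> R) : is_spaceS_real f -> is_spaceS_real (derive1 f).
Proof.
move=> hf; split.
- move=> x x0; rewrite derive1E.
  have : is_derive x 1 f 0.
    apply/is_derive_epsP => e e0; exists (- x); first by rewrite oppr_gt0.
    move=> h hx; rewrite !(is_spaceS_out hf)// ?mulr0 ?subrr ?normr0 ?mulr_ge0 ?(ltW e0)//.
    by rewrite (le_lt_trans (lerD (lexx x) (ler_norm h)))// -ltrBrDl sub0r.
  by case=> _ ->.
- by move=> k x; rewrite -derive1Sn; exact: is_spaceS_smooth.
- by move=> k; rewrite -derive1Sn; exact: is_spaceS_flat.
- by move=> k N; rewrite -derive1Sn; exact: is_spaceS_decay.
Qed.

Lemma S_D f : is_spaceS f -> is_spaceS (Dfun f).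
Proof. by move=> [hr hi]; split; exact: S_real_D. Qed.

Lemma S_iterD n f : is_spaceS f -> is_spaceS (iter n Dfun f).
Proof. by move=> hf; elim: n => //= n IH; exact: S_D. Qed.

Lemma S_real_bnd (f : R -> R) N : is_spaceS_real f ->
  exists M : R, forall x, 0 < x -> x ^+ N * `|f x| <= M.
Proof.
move=> hf.
have h := is_spaceS_decay hf 0 N.
have /cvgrPdist_le/(_ 1 ltr01)[A [_ hA]] := h.
pose B := Num.max A 1.
have B0 : 0 <= B by rewrite le_max ler01 orbT.
have cf : {within `[0, B], continuous (fun x => x ^+ N * `|f x|)}.
  apply: continuous_subspaceT => x; apply: cvgM; first exact: exprn_continuous.
  apply: cvg_norm; apply: differentiable_continuous; apply/derivable1_diffP.
  exact: (is_spaceS_smooth hf (k := 0)).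
have [c _ hc] := EVT_max B0 cf.
exists (Num.max (c ^+ N * `|f c|) 1) => x x0; rewrite le_max.
have [xB|xB] := leP x B; first by rewrite hc// in_itv /= ltW.
have xA : A < x by rewrite (le_lt_trans _ xB)// le_max lexx.
have := hA _ xA; rewrite sub0r normrN normrM mulrC normrX (gtr0_norm x0) => ->.
by rewrite orbT.
Qed.

Lemma S_bnd f N : is_spaceS f -> exists M : R, forall x, 0 < x -> x ^+ N * nc (f x) <= M.
Proof.
move=> [/(S_real_bnd N)[M1 h1] /(S_real_bnd N)[M2 h2]]; exists (M1 + M2) => x x0.
have xN : 0 <= x ^+ N by rewrite exprn_ge0// ltW.
rewrite (le_trans (ler_wpM2l xN (nc_ReIm _)))// mulrDr lerD ?h1 ?h2//.
Qed.

Lemma S_flat_bound n f (B : R) : is_spaceS f ->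
  (forall x, 0 < x -> nc (iter n Dfun f x) <= B) ->
  forall x, 0 < x -> nc (f x) <= B * x ^+ n.
Proof.
elim: n f => [|n IH] f hf hB x x0; first by rewrite expr0 mulr1; exact: hB.
have B0 : 0 <= B by apply: le_trans (hB x x0); exact: nc_ge0.
have h y : 0 < y -> nc (Dfun f y) <= B * y ^+ n.
  by apply: IH => [|z z0]; [exact: S_D|rewrite -iterSr; exact: hB].
have := @cMVT R f (Dfun f) 0 x (B * x ^+ n) (ltW x0) (fun y _ => S_cder y hf).
rewrite (S_out hf (lexx 0)) !subr0 -mulrA -exprSr; apply => y /andP[y0 yx].
move: y0; rewrite le_eqVlt => /predU1P[<-|y0].
  by rewrite (S_out (S_D hf))// nc0 mulr_ge0// exprn_ge0// ltW.
by rewrite (le_trans (h y y0))// ler_wpM2l// lerXn2r// nnegrE ltW.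
Qed.

(* Weighted bounds are read in the logarithmic variable [t = ln x]. *)
Definition bd (r : R) f (B : R) := forall t : R, expR (r * t) * nc (f (expR t)) <= B.

Lemma bd_interp (n N : nat) (r : R) f B1 B2 : is_spaceS f ->
  (forall x, 0 < x -> nc (iter n Dfun f x) <= B1) ->
  (forall x, 0 < x -> x ^+ N * nc (f x) <= B2) ->
  - n%:R <= r <= N%:R -> bd r f (B1 + B2).
Proof.
move=> hf h1 h2 /andP[rn rN] t.
have e0 := expR_gt0 t.
have B10 : 0 <= B1 by apply: le_trans (h1 _ e0); exact: nc_ge0.
have B20 : 0 <= B2.
  by apply: le_trans (h2 _ e0); rewrite mulr_ge0 ?nc_ge0// exprn_ge0// ltW.
have [t0|t0] := leP 0 t.
- rewrite (@le_trans _ _ B2) ?lerDr// (le_trans _ (h2 _ e0))// ler_wpM2r ?nc_ge0//.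
  by rewrite -expRM_natl ler_expR ler_wpM2r.
- rewrite (@le_trans _ _ B1) ?lerDl//.
  have h := S_flat_bound hf h1 e0.
  rewrite (le_trans (ler_wpM2l (expR_ge0 _) h))// mulrCA ler_piMr//.
  rewrite -expRM_natl -expRD -[leRHS]expR0 ler_expR -mulrDl.
  by rewrite nmulr_lle0// -lerBlDr sub0r.
Qed.

Lemma S_bd (r : R) f : is_spaceS f -> exists B, bd r f B.
Proof.
move=> hf; pose n := Num.Def.archi_bound `|r|.
have [B1 h1] := S_bnd 0 (S_iterD n hf); have [B2 h2] := S_bnd n hf.
exists (B1 + B2); apply: (@bd_interp n n) => // [x x0|].
  by have := h1 x x0; rewrite expr0 mul1r.
by rewrite -ler_norml ltW// archi_boundP.
Qed.

Lemma bdP (r : R) f B x : bd r f B -> 0 < x -> expR (r * ln x) * nc (f x) <= B.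
Proof. by move=> h x0; have := h (ln x); rewrite lnK. Qed.

Lemma S_coind (P : (R -> C) -> Prop) :
  (forall f, P f -> [/\ forall x, x <= 0 -> f x = 0,
     forall N : nat, exists M : R, forall x, 0 < x -> x ^+ N * nc (f x) <= M &
     exists2 f', P f' & forall x, cder f x (f' x)]) ->
  forall f, P f -> is_spaceS f.
Proof.
move=> H f Pf.
have K k : exists2 g, P g & derive1n k (fun x => Re (f x)) = (fun x => Re (g x)) /\
    derive1n k (fun x => Im (f x)) = (fun x => Im (g x)).
  elim: k => [|k [g Pg [gr gi]]]; first by exists f.
  have [_ _ [g' Pg' dg]] := H g Pg; exists g' => //.
  by rewrite !derive1nS gr gi; split; apply/funext => x; rewrite derive1E;
    have [[_ a] [_ b]] := dg x.
have lim (u : R -> R) (g : R -> C) N : P g -> (forall x, `|u x| <= nc (g x)) ->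
    u x * x ^+ N @[x --> +oo] --> (0 : R).
  move=> Pg ug; have [_ /(_ N.+1)[M hM] _] := H g Pg.
  apply/cvgrPdist_le => e e0; near=> x.
  have x0 : 0 < x by near: x; exact: nbhs_pinfty_gt.
  rewrite sub0r normrN normrM normrX (gtr0_norm x0).
  rewrite -(@ler_pM2r _ x)//.
  have := hM x x0; rewrite exprSr => h.
  rewrite -mulrA mulrC (le_trans (ler_wpM2l _ (ug x)))// ?mulr_ge0 ?exprn_ge0 ?(ltW x0)//.
  rewrite (le_trans h)// mulrC -ler_pdivrMr//.
split; split.
- by move=> x x0; have [-> //] := H f Pf; exact: ltW.
- by move=> k x; have [g Pg [-> _]] := K k; have [_ _ [g' _ /(_ x)[[]]]] := H g Pg.
- by move=> k; have [g Pg [-> _]] := K k; have [-> //] := H g Pg.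
- move=> k N; have [g Pg [-> _]] := K k.
  by apply: (lim _ g) => // x; exact: nc_Re.
- by move=> x x0; have [-> //] := H f Pf; exact: ltW.
- by move=> k x; have [g Pg [_ ->]] := K k; have [_ _ [g' _ /(_ x)[_ []]]] := H g Pg.
- by move=> k; have [g Pg [_ ->]] := K k; have [-> //] := H g Pg.
- move=> k N; have [g Pg [_ ->]] := K k.
  by apply: (lim _ g) => // x; exact: nc_Im.
Unshelve. all: by end_near. Qed.

Definition Rfun (h : C) (al a : R) f (x : R) : C :=
  if 0 < x then cexp (h * (ln x)%:C) * f (expR (al * ln x + ln a)) else 0.

Lemma Rfun_exp h al a f t :
  Rfun h al a f (expR t) = cexp (h * t%:C) * f (expR (al * t + ln a)).
Proof. by rewrite /Rfun expR_gt0 expRK. Qed.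

Lemma Rfun_out h al a f x : x <= 0 -> Rfun h al a f x = 0.
Proof. by rewrite /Rfun leNgt => /negPf ->. Qed.

Lemma bd_Rfun h al a f (r B : R) : al != 0 -> bd ((r + Re h) / al) f B ->
  bd r (Rfun h al a f) (expR (- ((r + Re h) / al * ln a)) * B).
Proof.
move=> al0 hB t; rewrite Rfun_exp ncM nc_cexp mulrA -expRD mulrC cReM cReC cImC.
have := hB (al * t + ln a); set rho := (r + Re h) / al => H.
rewrite -(ler_pM2l (expR_gt0 (- (rho * ln a)))) mulrA -expRD in H.
apply: le_trans H; rewrite mulrC ler_wpM2r ?nc_ge0// ler_expR /rho le_eqVlt.
by apply/orP; left; apply/eqP; field.
Qed.

Lemma bd_pow (f : R -> C) B (N : nat) : bd N%:R f B -> forall x, 0 < x -> x ^+ N * nc (f x) <= B.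
Proof. by move=> h x x0; have := bdP h x0; rewrite expRM_natl lnK. Qed.

Lemma cder_Rfun h al a f x : al != 0 -> 0 < a -> is_spaceS f ->
  cder (Rfun h al a f) x
    (h * Rfun (h - 1) al a f x + al%:C * a%:C * Rfun (h + (al - 1)%:C) al a (Dfun f) x).
Proof.
move=> al0 a0 hf; have [x0|x0] := ltP 0 x; last first.
  rewrite !(Rfun_out _ _ _ _ x0) !mulr0 addr0.
  move: x0; rewrite le_eqVlt => /predU1P[->|x0]; last first.
    apply: (@cder_near _ (fun=> 0) _ (- x)); rewrite ?oppr_gt0//; last exact: cder_cst.
    move=> y hy; rewrite Rfun_out//; have := ler_norm (y - x); lra.
  have [B hB] := S_bd ((- 2%:R + Re h) / al) hf.
  have {}hB := bd_Rfun a al0 hB; set K := _ * B in hB.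
  have K0 : 0 <= K by apply: le_trans (hB 0); rewrite mulr_ge0 ?expR_ge0 ?nc_ge0.
  apply: (@cder_quad _ _ _ _ 1 K) => // y _.
  rewrite mulr0 subr0 add0r (Rfun_out _ _ _ _ (lexx 0)) subr0.
  have [y0|y0] := ltP 0 y; last by rewrite Rfun_out// nc0 mulr_ge0// sqr_ge0.
  rewrite gtr0_norm//; have := bdP hB y0.
  by rewrite mulNr expRN expRM_natl lnK// mulrC ler_pdivrMr// exprn_gt0.
pose g (y : R) := cexp (h * (ln y)%:C) * f (expR (al * ln y + ln a)).
apply: (@cder_near _ g _ x) => //.
  move=> y hy; rewrite /Rfun ifT//.
  by have := ler_norm (x - y); rewrite distrC => ?; lra.
have dl : is_derive x 1 (@ln R) x^-1 by exact: is_derive1_ln.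
have dll : is_derive x 1 (fun y => expR (al * ln y + ln a)) (al * x^-1 * expR (al * ln x + ln a)).
  rewrite (_ : (fun y => _) = expR \o (al \*: @ln R + cst (ln a))); last by apply/funext.
  by apply: is_derive_eq; rewrite /GRing.scale /=; ring.
apply: cder_eq.
  apply: cderM; first by apply: cder_cexp; apply: cderZ; apply: cder_real dl.
  by apply: cder_comp dll _; exact: S_cder.
have xC1 : (x^-1)%:C = cexp (- (ln x)%:C) :> C by rewrite -realCN cexp_real expRN lnK.
have eC : (expR (al * ln x + ln a))%:C = cexp (al%:C * (ln x)%:C) * a%:C :> C.
  by rewrite -cexp_real realCD cexpD realCM [cexp (ln a)%:C]cexp_real lnK.
rewrite /Rfun x0; congr (_ + _).
- rewrite mulrBl mul1r cexpD -xC1; ring.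
- rewrite mulrDl cexpD realCD realCN realC1 mulrBl mul1r cexpD -xC1 realCM realCM eC; ring.
Qed.

Inductive Rspan (al a : R) : (R -> C) -> Prop :=
| Rspan_base h f : is_spaceS f -> Rspan al a (Rfun h al a f)
| Rspan_add f g : Rspan al a f -> Rspan al a g -> Rspan al a (fun x => f x + g x)
| Rspan_scale (c : C) f : Rspan al a f -> Rspan al a (fun x => c * f x).

Lemma S_Rspan al a f : al != 0 -> 0 < a -> Rspan al a f -> is_spaceS f.
Proof.
move=> al0 a0 Pf; apply: (@S_coind (Rspan al a)) Pf => {}f; elim=> [h {}f hf|{}f g Pf [f1 f2 [f' Pf' df]] Pg [g1 g2 [g' Pg' dg]]|
  c {}f Pf [f1 f2 [f' Pf' df]]].
- split.
  + by move=> x; exact: Rfun_out.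
  + move=> N; have [B hB] := S_bd ((N%:R + Re h) / al) hf.
    by eexists; exact: (bd_pow (bd_Rfun a al0 hB)).
  + eexists; last by move=> x; apply: cder_Rfun.
    apply: Rspan_add; apply: Rspan_scale; apply: Rspan_base => //.
    exact: S_D.
- split.
  + by move=> x x0; rewrite f1// g1// addr0.
  + move=> N; have [M1 h1] := f2 N; have [M2 h2] := g2 N; exists (M1 + M2) => x x0.
    have xN : 0 <= x ^+ N by rewrite exprn_ge0// ltW.
    by rewrite (le_trans (ler_wpM2l xN (ncD _ _)))// mulrDr lerD ?h1 ?h2.
  + exists (fun x => f' x + g' x); first exact: Rspan_add.
    by move=> x; exact: cderD.
- split.
  + by move=> x x0; rewrite f1// mulr0.
  + move=> N; have [M1 h1] := f2 N; exists (nc c * M1) => x x0.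
    by rewrite ncM mulrCA ler_wpM2l ?nc_ge0 ?h1.
  + exists (fun x => c * f' x); first exact: Rspan_scale.
    by move=> x; exact: cderZ.
Qed.

End SpaceSTheory.

(** * The Laplace transform from S(R_+) to K *)

Section LaplaceS.
Context (R : realType).
Local Notation C := (Cplx R).
Local Notation leb := (@lebesgue_measure R).
Local Notation cintg := (Cintegrable leb setT).
Local Notation cint := (Cintegral leb setT).
Implicit Types (f g : R -> C) (z w : C).

Definition Lam f (z : C) : C := cint (fun x => f x * cexp (- (z * x%:C))).
Definition Xfun f (x : R) : C := x%:C * f x.

Lemma S_R h al a f : al != 0 -> 0 < a -> is_spaceS f -> is_spaceS (Rfun h al a f).
Proof. by move=> al0 a0 hf; apply: (S_Rspan al0 a0); exact: Rspan_base. Qed.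

Lemma S_scale (c : C) f : is_spaceS f -> is_spaceS (fun x => c * f x).
Proof.
move=> hf; apply: (S_Rspan (oner_neq0 R) ltr01 (f := fun x => c * f x)).
have {1}-> : f = Rfun 0 1 1 f.
  apply/funext => x; rewrite /Rfun; case: ltP => x0; last by rewrite (S_out hf).
  by rewrite mul0r cexp0 mul1r ln1 addr0 mul1r lnK.
by apply: Rspan_scale; exact: Rspan_base.
Qed.

Lemma XfunE f : is_spaceS f -> Xfun f = Rfun 1 1 1 f.
Proof.
move=> hf; apply/funext => x; rewrite /Rfun /Xfun; case: ltP => x0; last by rewrite (S_out hf)// mulr0.
by rewrite mul1r cexp_real lnK// ln1 addr0 mul1r lnK.
Qed.

Lemma S_X f : is_spaceS f -> is_spaceS (Xfun f).
Proof. by move=> hf; rewrite XfunE//; exact: S_R. Qed.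

Lemma S_meas f : is_spaceS f -> cmeas f.
Proof. by move=> hf; apply: cdiff_meas => x; exact: S_cdiff. Qed.

Lemma S_major f B0 B2 : is_spaceS f -> (forall x, 0 < x -> nc (f x) <= B0) ->
  (forall x, 0 < x -> x ^+ 2 * nc (f x) <= B2) ->
  forall x, nc (f x) <= (B0 + B2) * (1 + x ^+ 2)^-1.
Proof.
move=> hf h0 h2 x; have p : 0 < 1 + x ^+ 2 by rewrite ltr_pwDl ?sqr_ge0.
rewrite ler_pdivlMr//; have [x0|x0] := ltP 0 x.
  by rewrite mulrDr mulr1 (mulrC _ (x ^+ 2)) lerD ?h0 ?h2.
rewrite (S_out hf)// nc0 mul0r addr_ge0//.
  by apply: le_trans (h0 1 ltr01); exact: nc_ge0.
by apply: le_trans (h2 1 ltr01); rewrite mulr_ge0 ?nc_ge0// sqr_ge0.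
Qed.

Lemma S_majorant f : is_spaceS f -> exists K : R, forall x, nc (f x) <= K * (1 + x ^+ 2)^-1.
Proof.
move=> hf; have [B0 h0] := S_bnd 0 hf; have [B2 h2] := S_bnd 2 hf.
by exists (B0 + B2); apply: S_major => // x x0; have := h0 x x0; rewrite expr0 mul1r.
Qed.

Lemma S_int f : is_spaceS f -> cintg f.
Proof. by move=> hf; have [K hK] := S_majorant hf; exact: cintg_majorant (S_meas hf) hK. Qed.

Lemma Re_zx (z : C) (x : R) : 0 <= Re z -> 0 <= x -> Re (- (z * x%:C)) <= 0.
Proof. by move=> z0 x0; csimp; rewrite mulr0 subr0 oppr_le0 mulr_ge0. Qed.

Lemma Lam_le f (z : C) x : is_spaceS f -> 0 <= Re z ->
  nc (f x * cexp (- (z * x%:C))) <= nc (f x).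
Proof.
move=> hf z0; have [x0|x0] := ltP 0 x; last by rewrite (S_out hf)// mul0r.
by rewrite ncM ler_piMr ?nc_ge0// nc_cexp -expR0 ler_expR Re_zx// ltW.
Qed.

Lemma Lam_diff f (z : C) x : is_spaceS f -> cdiff (fun x => f x * cexp (- (z * x%:C))) x.
Proof.
move=> hf; apply: cdiffM; first exact: S_cdiff.
by apply: cdiff_cexp; apply: cdiffN; apply: cdiffM; [exact: cdiff_cst|exact: cdiff_id].
Qed.

Lemma Lam_meas f (z : C) : is_spaceS f -> cmeas (fun x => f x * cexp (- (z * x%:C))).
Proof. by move=> hf; apply: cdiff_meas => x; exact: Lam_diff. Qed.

Lemma Lam_int f (z : C) : is_spaceS f -> 0 <= Re z -> cintg (fun x => f x * cexp (- (z * x%:C))).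
Proof.
move=> hf z0; have [K hK] := S_majorant hf.
apply: cintg_majorant (Lam_meas z hf) _ => x.
by apply: le_trans (Lam_le x hf z0) _; exact: hK.
Qed.

Lemma Lam_bnd f K (z : C) : is_spaceS f -> (forall x, nc (f x) <= K * (1 + x ^+ 2)^-1) ->
  0 <= Re z -> nc (Lam f z) <= K * pi.
Proof.
move=> hf hK z0; apply: cint_bnd; first exact: Lam_meas.
by move=> x; apply: le_trans (Lam_le x hf z0) _; exact: hK.
Qed.

Lemma LamZ (c : C) f z : is_spaceS f -> 0 <= Re z -> Lam (fun x => c * f x) z = c * Lam f z.
Proof.
move=> hf z0; rewrite /Lam -cintZ; last exact: Lam_int.
by congr cint; apply/funext => x; rewrite mulrA.
Qed.

Lemma Lam_quad f : is_spaceS f -> exists M : R, forall z h : C, 0 <= Re z -> 0 <= Re (z + h) ->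
  nc (Lam f (z + h) - Lam f z - h * - Lam (Xfun f) z) <= M * nc h ^+ 2.
Proof.
move=> hf; have hX := S_X hf; have hXX := S_X hX.
have [M hM] := S_majorant hXX; exists (M * pi) => z h z0 zh0.
rewrite /Lam -cintB; [|exact: Lam_int|exact: Lam_int].
rewrite mulrN -mulNr -cintZ; last exact: Lam_int.
rewrite -cintB; last first.
- by apply: cintgZ; exact: Lam_int.
- by apply: cintgB; exact: Lam_int.
rewrite mulrAC; apply: cint_bnd.
  apply: cmeasB; first by apply: cmeasB; exact: Lam_meas.
  by apply: cmeasM; [exact: cmeas_cst|exact: Lam_meas].
move=> x; have [x0|x0] := ltP 0 x; last first.
  rewrite /Xfun !(S_out hf)// ?(mul0r, mulr0, subrr, nc0)//.
  apply: mulr_ge0; last by rewrite invr_ge0 addr_ge0 ?sqr_ge0.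
  by rewrite mulr_ge0 ?sqr_ge0//; exact: majorant_ge0 hM.
have := @cexp_quad R (- (z * x%:C)) (- (h * x%:C)).
rewrite -opprD -mulrDl !Re_zx ?(ltW x0)// => /(_ isT isT) H.
rewrite [X in nc X](_ : _ = f x * (cexp (- ((z + h) * x%:C)) - cexp (- (z * x%:C)) -
  - (h * x%:C) * cexp (- (z * x%:C)))); last by rewrite /Xfun; ring.
rewrite ncM (le_trans (ler_wpM2l (nc_ge0 _) H))//.
rewrite ncN ncM nc_real exprMn (gtr0_norm x0).
have := hM x; rewrite /Xfun !ncM nc_real (gtr0_norm x0) => H2.
rewrite [leLHS](_ : _ = nc h ^+ 2 * (x * (x * nc (f x)))); last by ring.
rewrite [leRHS](_ : _ = nc h ^+ 2 * (M * (1 + x ^+ 2)^-1)); last by ring.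
by rewrite ler_wpM2l// sqr_ge0.
Qed.

Lemma Lam_lip f : is_spaceS f -> exists M : R, forall z h : C, 0 <= Re z -> 0 <= Re (z + h) ->
  nc (Lam f (z + h) - Lam f z) <= M * nc h.
Proof.
move=> hf; have hX := S_X hf.
have [M hM] := S_majorant hX; exists (M * pi) => z h z0 zh0.
rewrite /Lam -cintB; [|exact: Lam_int|exact: Lam_int].
rewrite mulrAC; apply: cint_bnd.
  by apply: cmeasB; exact: Lam_meas.
move=> x; have [x0|x0] := ltP 0 x; last first.
  rewrite !(S_out hf)// ?(mul0r, mulr0, subrr, nc0)//.
  apply: mulr_ge0; last by rewrite invr_ge0 addr_ge0 ?sqr_ge0.
  by rewrite mulr_ge0 ?nc_ge0//; exact: majorant_ge0 hM.
have := @cexp_lip R (- (z * x%:C)) (- (h * x%:C)).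
rewrite -opprD -mulrDl !Re_zx ?(ltW x0)// => /(_ isT isT) H.
rewrite -mulrBr ncM (le_trans (ler_wpM2l (nc_ge0 _) H))//.
rewrite ncN ncM nc_real (gtr0_norm x0).
have := hM x; rewrite /Xfun !ncM nc_real (gtr0_norm x0) => H2.
rewrite [leLHS](_ : _ = nc h * (x * nc (f x))); last by ring.
rewrite [leRHS](_ : _ = nc h * (M * (1 + x ^+ 2)^-1)); last by ring.
by rewrite ler_wpM2l// nc_ge0.
Qed.

Lemma Re_ge_nc (z h : C) : nc h < Re z -> 0 <= Re (z + h).
Proof.
move=> hz; rewrite cReD; have := nc_Re h; rewrite ler_norml => /andP[a _]; lra.
Qed.

Lemma Lam_deriv f (z : C) : is_spaceS f -> 0 < Re z -> is_derive z 1 (Lam f) (- Lam (Xfun f) z).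
Proof.
move=> hf z0; have [M hM] := Lam_quad hf.
apply: (@is_deriveC_quad _ _ _ _ (Re z) M) => // h hz.
by apply: hM; [exact: ltW|exact: Re_ge_nc].
Qed.

Lemma Lam_D f (z : C) : is_spaceS f -> 0 <= Re z -> z * Lam f z = Lam (Dfun f) z.
Proof.
move=> hf z0; have hD := S_D hf.
apply/esym/eqP; rewrite -subr_eq0; apply/eqP.
rewrite /Lam -cintZ -?cintB; [|exact: Lam_int|exact: cintgZ (Lam_int _ _)|exact: Lam_int].
have [K hK] := S_majorant hf.
apply: (@cint_deriv0 R (fun x => f x * cexp (- (z * x%:C))) _ K).
- move=> x; apply: cder_eq.
    apply: cderM; first exact: S_cder.
    by apply: cder_cexp; apply: cderN; apply: cderZ; exact: cder_id.
  by rewrite /=; ring.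
- move=> x; apply: cdiffD; first exact: Lam_diff.
  by apply: cdiffN; apply: cdiffM; [exact: cdiff_cst|exact: Lam_diff].
- by apply: cintgB; [exact: Lam_int|apply: cintgZ; exact: Lam_int].
- by move=> x; apply: le_trans (Lam_le x hf z0) _; exact: hK.
Qed.

Definition LamK f (z : C) : C := if 0 <= Re z then Lam f z else 0.
Definition NX f (x : R) : C := - 1 * Xfun f x.

Lemma S_NX f : is_spaceS f -> is_spaceS (NX f).
Proof. by move=> hf; apply: S_scale; exact: S_X. Qed.

Lemma S_iterNX k f : is_spaceS f -> is_spaceS (iter k NX f).
Proof. by move=> hf; elim: k => //= k IH; exact: S_NX. Qed.

Lemma LamK_E f z : 0 <= Re z -> LamK f z = Lam f z.
Proof. by rewrite /LamK => ->. Qed.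

Lemma near_RHP (z : C) : 0 < Re z -> \forall w \near z, 0 < Re w.
Proof. by move=> z0; apply: open_nbhs_nbhs; split => //; exact: open_RHP. Qed.

Lemma LamK_derive1n k f z : is_spaceS f -> 0 < Re z ->
  derive1n k (LamK f) z = Lam (iter k NX f) z.
Proof.
move=> hf; elim: k z => [|k IH] z z0; first by rewrite /= LamK_E// ltW.
rewrite derive1nS derive1E.
have := @near_eq_derive _ _ _ (derive1n k (LamK f)) (Lam (iter k NX f)) z 1.
move=> ->; last by near=> w; apply: IH; near: w; exact: near_RHP.
have [_ ->] := Lam_deriv (S_iterNX k hf) z0.
by rewrite LamZ ?mulN1r//; [apply: S_X; exact: S_iterNX|exact: ltW].
Unshelve. all: by end_near. Qed.

Lemma LamK_derivable k f z : is_spaceS f -> 0 < Re z ->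
  derivable (derive1n k (LamK f)) z 1.
Proof.
move=> hf z0; apply: (@near_eq_derivable _ _ _ (Lam (iter k NX f))).
  by near=> w; rewrite LamK_derive1n//; near: w; exact: near_RHP.
by have [] := Lam_deriv (S_iterNX k hf) z0.
Unshelve. all: by end_near. Qed.

Lemma near_nc (z : C) (d : R) : 0 < d -> \forall w \near z, nc (z - w) < d.
Proof.
move=> d0; apply/nbhs_ballP; exists d%:C; first exact: posC.
by move=> w /=; rewrite -ball_normE /= normcE ltcR.
Qed.

Lemma Lam_cvg f z : is_spaceS f -> 0 <= Re z ->
  Lam f w @[w --> within cRHP (nbhs z)] --> Lam f z.
Proof.
move=> hf z0; have [M hM] := Lam_lip hf.
apply/cvgrPdist_le => /= e /posC_real[-> e0].
pose K := Num.max M 1; have K0 : 0 < K by rewrite lt_max ltr01 orbT.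
rewrite near_withinE; near=> w => w0.
have hw : nc (z - w) < Re e / K by near: w; apply: near_nc; exact: divr_gt0.
rewrite normcE lecR ncC (_ : Lam f w = Lam f (z + (w - z))); last by rewrite addrC subrK.
have zw : 0 <= Re (z + (w - z)) by rewrite addrC subrK.
rewrite (le_trans (hM z (w - z) z0 zw))//.
rewrite (@le_trans _ _ (K * nc (w - z)))// ?ler_wpM2r ?nc_ge0// ?le_max ?lexx//.
by rewrite mulrC -ler_pdivlMr// ncC ltW.
Unshelve. all: by end_near. Qed.

Lemma LamK_cvg k f z : is_spaceS f -> 0 <= Re z ->
  derive1n k (LamK f) w @[w --> within RHP (nbhs z)] --> Lam (iter k NX f) z.
Proof.
move=> hf z0.
apply: (@cvg_trans _ (Lam (iter k NX f) w @[w --> within RHP (nbhs z)])).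
  apply: near_eq_cvg; near=> w; rewrite LamK_derive1n//.
  by near: w; exact: withinT.
apply: cvg_trans (Lam_cvg (S_iterNX k hf) z0).
apply: cvg_app; apply: within_subset => w /=; exact: ltW.
Unshelve. all: by end_near. Qed.

Lemma LamK_derivK k f z : is_spaceS f -> 0 <= Re z -> derivK k (LamK f) z = Lam (iter k NX f) z.
Proof.
move=> hf z0; have FF := RHP_filter (z0 : cRHP z).
exact/cvg_lim/LamK_cvg.
Qed.

Lemma Lam_decay N f : is_spaceS f -> exists M : R, forall z, 0 <= Re z ->
  (1 + nc z) ^+ N * nc (Lam f z) <= M.
Proof.
elim: N f => [|N IH] f hf.
  have [K hK] := S_majorant hf; exists (K * pi) => z z0.
  by rewrite expr0 mul1r; exact: Lam_bnd.
have [M1 h1] := IH f hf; have [M2 h2] := IH _ (S_D hf).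
exists (M1 + M2) => z z0; rewrite exprSr -mulrA mulrDl mul1r -ncM Lam_D// mulrDr.
by rewrite lerD ?h1 ?h2.
Qed.

Lemma LamK_spaceK f : is_spaceS f -> is_spaceK (LamK f).
Proof.
move=> hf; split.
- by move=> z; rewrite /cRHP /= /LamK => /negP/negPf ->.
- by move=> k z; exact: LamK_derivable.
- by move=> k z z0; rewrite LamK_derivK//; exact: LamK_cvg.
- move=> k; apply: (@subspace_eq_continuous _ _ _ (Lam (iter k NX f))).
    by move=> z /set_mem z0; apply/esym; exact: LamK_derivK.
  apply/subspace_continuousP => z z0; apply: Lam_cvg => //; exact: S_iterNX.
- by move=> z z0; rewrite LamK_derivK// LamK_E.
- move=> k N; have [M hM] := Lam_decay N (S_iterNX k hf); exists M => z z0.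
  rewrite LamK_derivK// ler_pdivlMr ?exprn_gt0 ?ltr_wpDr ?nc_ge0//.
  by rewrite mulrC; exact: hM.
Qed.

End LaplaceS.

(** * The inverse Laplace transform *)

Section LineIntegrals.
Context (R : realType).
Local Notation C := (Cplx R).
Local Notation leb := (@lebesgue_measure R).
Local Notation cintg := (Cintegrable leb setT).
Local Notation cint := (Cintegral leb setT).
Implicit Types (G : C -> C) (z w : C).

Definition pt (p t : R) : C := p%:C + ii * t%:C.

Lemma Re_pt p t : Re (pt p t) = p. Proof. by rewrite /pt; csimp; ring. Qed.
Lemma Im_pt p t : Im (pt p t) = t. Proof. by rewrite /pt; csimp; ring. Qed.
Lemma ptE z : pt (Re z) (Im z) = z.
Proof. by apply: complex_ext; rewrite ?Re_pt ?Im_pt. Qed.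

Lemma cder_pt_t p t : cder (pt p) t ii.
Proof.
rewrite -[X in cder _ _ X]add0r -[X in _ + X]mulr1.
by apply: cderD (cder_cst _ _) (cderZ _ (cder_id _)).
Qed.
Lemma cder_pt_p p t : cder (pt ^~ t) p 1.
Proof. by rewrite -[X in cder _ _ X]addr0; apply: cderD (cder_id _) (cder_cst _ _). Qed.

Lemma nc_pt_ge p t : 1 + t ^+ 2 <= (1 + nc (pt p t)) ^+ 2.
Proof.
have := nc_Im (pt p t); rewrite Im_pt => h.
have h1 : t ^+ 2 <= nc (pt p t) ^+ 2.
  by rewrite -(real_normK (num_real t)) lerXn2r ?nnegrE ?nc_ge0.
by have := nc_ge0 (pt p t); nra.
Qed.

Lemma nc_cexp_pt p t x : nc (cexp (pt p t * x%:C)) = expR (p * x).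
Proof. by rewrite nc_cexp cReM Re_pt Im_pt /= mulr0 subr0. Qed.

Lemma nc_cexp_i (y : R) : nc (cexp (ii * y%:C)) = 1.
Proof. by rewrite nc_cexp; csimp; rewrite mul0r mul1r subrr expR0. Qed.

Lemma pt_bnd G (m : nat) K p t : 0 < p ->
  (forall z, 0 < Re z -> (1 + nc z) ^+ (m + 2) * nc (G z) <= K) ->
  (1 + p) ^+ m * nc (G (pt p t)) <= K * (1 + t ^+ 2)^-1.
Proof.
move=> p0 /(_ (pt p t)); rewrite Re_pt => /(_ p0) h.
rewrite ler_pdivlMr ?ltr_pwDl ?sqr_ge0//; apply: le_trans h.
rewrite mulrAC exprD ler_wpM2r ?nc_ge0// ler_pM ?nc_pt_ge//.
- by rewrite exprn_ge0// addr_ge0// ltW.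
- by rewrite addr_ge0// sqr_ge0.
- rewrite lerXn2r ?nnegrE ?addr_ge0 ?nc_ge0 ?(ltW p0)// lerD2l.
  by have := nc_Re (pt p t); rewrite Re_pt gtr0_norm.
Qed.

Lemma pt_bnd0 G K p t : 0 < p ->
  (forall z, 0 < Re z -> (1 + nc z) ^+ 2 * nc (G z) <= K) ->
  nc (G (pt p t)) <= K * (1 + t ^+ 2)^-1.
Proof. by move=> p0 /(@pt_bnd G 0 K p t p0); rewrite expr0 mul1r. Qed.

Definition hol G G' := forall z, 0 < Re z -> is_derive z 1 G (G' z).

Lemma hol_cder_t G G' p t : 0 < p -> hol G G' -> cder (fun t => G (pt p t)) t (ii * G' (pt p t)).
Proof.
by move=> p0 hG; apply: cder_chain (cder_pt_t p t); apply: hG; rewrite Re_pt.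
Qed.

Lemma hol_cdiff_t G G' p t : 0 < p -> hol G G' -> cdiff (fun t => G (pt p t)) t.
Proof. by move=> p0 hG; exists (ii * G' (pt p t)); exact: hol_cder_t. Qed.

Lemma cdiff_cexp_pt p x t : cdiff (fun t => cexp (pt p t * x%:C)) t.
Proof.
apply: cdiff_cexp; apply: cdiffM; last exact: cdiff_cst.
by exists ii; exact: cder_pt_t.
Qed.

Definition lint G p x := cint (fun t => G (pt p t) * cexp (pt p t * x%:C)).

Lemma lint_meas G G' p x : 0 < p -> hol G G' ->
  cmeas (fun t => G (pt p t) * cexp (pt p t * x%:C)).
Proof.
move=> p0 hG; apply: cdiff_meas => t; apply: cdiffM; last exact: cdiff_cexp_pt.
exact: hol_cdiff_t hG.
Qed.

Lemma lint_major G K p x t : 0 < p ->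
  (forall z, 0 < Re z -> (1 + nc z) ^+ 2 * nc (G z) <= K) ->
  nc (G (pt p t) * cexp (pt p t * x%:C)) <= (K * expR (p * x)) * (1 + t ^+ 2)^-1.
Proof.
move=> p0 hK; rewrite ncM nc_cexp_pt mulrAC ler_wpM2r ?expR_ge0//.
exact: pt_bnd0.
Qed.

Lemma lint_int G G' K p x : 0 < p -> hol G G' ->
  (forall z, 0 < Re z -> (1 + nc z) ^+ 2 * nc (G z) <= K) ->
  cintg (fun t => G (pt p t) * cexp (pt p t * x%:C)).
Proof.
move=> p0 hG hK; apply: cintg_majorant (lint_meas x p0 hG) _ => t.
exact: lint_major hK.
Qed.

Lemma lint_bnd G G' K p x : 0 < p -> hol G G' ->
  (forall z, 0 < Re z -> (1 + nc z) ^+ 2 * nc (G z) <= K) ->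
  nc (lint G p x) <= K * expR (p * x) * pi.
Proof.
move=> p0 hG hK; apply: cint_bnd (lint_meas x p0 hG) _ => t.
exact: lint_major hK.
Qed.

Lemma bndK_ge0 G (m : nat) K : (forall z, 0 < Re z -> (1 + nc z) ^+ m * nc (G z) <= K) -> 0 <= K.
Proof.
move=> /(_ 1 ltr01); apply: le_trans.
by rewrite mulr_ge0 ?nc_ge0// exprn_ge0// addr_ge0// nc_ge0.
Qed.

Lemma E1_cder G G' p x t : 0 < p -> hol G G' ->
  cder (fun t => G (pt p t) * cexp (pt p t * x%:C)) t
    (ii * ((G' (pt p t) + x%:C * G (pt p t)) * cexp (pt p t * x%:C))).
Proof.
move=> p0 hG; apply: cder_eq.
  apply: cderM; first exact: hol_cder_t hG.
  apply: cder_cexp; apply: cderM; [exact: cder_pt_t|exact: cder_cst].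
by rewrite /=; ring.
Qed.

Lemma E1_cdiff G G' G'' p x t : 0 < p -> hol G G' -> hol G' G'' ->
  cdiff (fun t => ii * ((G' (pt p t) + x%:C * G (pt p t)) * cexp (pt p t * x%:C))) t.
Proof.
move=> p0 hG hG'; apply: cdiffM; first exact: cdiff_cst.
apply: cdiffM; last exact: cdiff_cexp_pt.
apply: cdiffD; first exact: hol_cdiff_t hG'.
by apply: cdiffM; [exact: cdiff_cst|exact: hol_cdiff_t hG].
Qed.

Lemma E1_major G G' K K' p x t : 0 < p ->
  (forall z, 0 < Re z -> (1 + nc z) ^+ 2 * nc (G z) <= K) ->
  (forall z, 0 < Re z -> (1 + nc z) ^+ 2 * nc (G' z) <= K') ->
  nc (ii * ((G' (pt p t) + x%:C * G (pt p t)) * cexp (pt p t * x%:C))) <=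
  ((K' + `|x| * K) * expR (p * x)) * (1 + t ^+ 2)^-1.
Proof.
move=> p0 hK hK'; rewrite ncM nc_ii mul1r ncM nc_cexp_pt mulrAC ler_wpM2r ?expR_ge0//.
rewrite (le_trans (ncD _ _))// mulrDl lerD//; first exact: pt_bnd0.
by rewrite nc_realM -mulrA ler_wpM2l//; exact: pt_bnd0.
Qed.

Lemma lint_shift G G' G'' K K' p1 p2 x : 0 < p1 -> 0 < p2 -> hol G G' -> hol G' G'' ->
  (forall z, 0 < Re z -> (1 + nc z) ^+ 2 * nc (G z) <= K) ->
  (forall z, 0 < Re z -> (1 + nc z) ^+ 2 * nc (G' z) <= K') ->
  lint G p1 x = lint G p2 x.
Proof.
move=> p10 p20 hG hG' hK hK'.
pose v := p1 + p2 + 1.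
have K0 := bndK_ge0 hK; have K'0 := bndK_ge0 hK'.
pose M := (K + (K' + `|x| * K)) * expR (v * `|x|).
have ex p : 0 < p < v -> expR (p * x) <= expR (v * `|x|).
  move=> /andP[p0 pv]; rewrite ler_expR (le_trans (ler_norm _))// normrM (gtr0_norm p0).
  by rewrite ler_wpM2r// ltW.
have S0 : 0 <= K' + `|x| * K by rewrite addr_ge0// mulr_ge0.
have i0 t : 0 <= (1 + t ^+ 2)^-1 :> R by rewrite invr_ge0 addr_ge0 ?sqr_ge0.
apply: (@cint_shift R (fun p t => G (pt p t) * cexp (pt p t * x%:C))
  (fun p t => ii * ((G' (pt p t) + x%:C * G (pt p t)) * cexp (pt p t * x%:C))) (- ii) 0 v M).
- by move=> p t /andP[p0 _]; exact: E1_cder.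
- by move=> p t /andP[p0 _]; exact: E1_cdiff hG hG'.
- move=> p t /andP[p0 _]; apply: cder_eq.
    apply: cderM.
      by apply: cder_chain (cder_pt_p p t); apply: hG; rewrite Re_pt.
    by apply: cder_cexp; apply: cderM; [exact: cder_pt_p|exact: cder_cst].
  by rewrite /= mulNr (mulrA ii ii) mulii; ring.
- move=> p t hp; have p0 : 0 < p by case/andP: hp.
  rewrite (le_trans (lint_major x t p0 hK))// ler_wpM2r// ler_pM ?expR_ge0 ?ex//.
  by rewrite lerDl.
- move=> p t hp; have p0 : 0 < p by case/andP: hp.
  rewrite (le_trans (E1_major x t p0 hK hK'))// ler_wpM2r// ler_pM ?expR_ge0 ?ex//.
  by rewrite lerDr.
- by rewrite p10 /v; lra.
- by rewrite p20 /v; lra.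
Qed.

Lemma lint_parts G G' G'' K K' p x : 0 < p -> hol G G' -> hol G' G'' ->
  (forall z, 0 < Re z -> (1 + nc z) ^+ 2 * nc (G z) <= K) ->
  (forall z, 0 < Re z -> (1 + nc z) ^+ 2 * nc (G' z) <= K') ->
  x%:C * lint G p x = - lint G' p x.
Proof.
move=> p0 hG hG' hK hK'.
have iG := lint_int x p0 hG hK; have iG' := lint_int x p0 hG' hK'.
have : cint (fun t => ii * ((G' (pt p t) + x%:C * G (pt p t)) * cexp (pt p t * x%:C))) = 0.
  apply: (@cint_deriv0 R (fun t => G (pt p t) * cexp (pt p t * x%:C)) _ (K * expR (p * x))).
  - by move=> t; exact: E1_cder.
  - by move=> t; exact: E1_cdiff hG hG'.
  - apply: cintg_majorant; last by move=> t; exact: E1_major hK hK'.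
    by apply: cdiff_meas => t; exact: E1_cdiff hG hG'.
  - by move=> t; exact: lint_major hK.
rewrite (_ : (fun t => _) = (fun t => ii * (G' (pt p t) * cexp (pt p t * x%:C)) +
    ii * x%:C * (G (pt p t) * cexp (pt p t * x%:C)))); last by apply/funext => t; ring.
rewrite cintD ?cintZ//; [|exact: cintgZ|exact: cintgZ].
rewrite -!/(lint _ _ _) => H.
apply/eqP; rewrite -subr_eq0 opprK addrC; apply/eqP.
have i0 : (ii : C) != 0 by rewrite -nc_eq0 nc_ii oner_eq0.
by apply: (mulfI i0); rewrite mulr0 -H; ring.
Qed.

Lemma lint_out G G' G'' K K' p x : 0 < p -> hol G G' -> hol G' G'' ->
  (forall z, 0 < Re z -> (1 + nc z) ^+ 3 * nc (G z) <= K) ->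
  (forall z, 0 < Re z -> (1 + nc z) ^+ 2 * nc (G' z) <= K') ->
  x <= 0 -> lint G p x = 0.
Proof.
move=> p0 hG hG' hK hK' x0.
have K0 := bndK_ge0 hK.
have hK2 z : 0 < Re z -> (1 + nc z) ^+ 2 * nc (G z) <= K.
  move=> z0; apply: le_trans (hK z z0); rewrite ler_wpM2r ?nc_ge0//.
  by rewrite [leRHS]exprS ler_peMl ?exprn_ge0 ?addr_ge0 ?lerDl ?nc_ge0.
apply/eqP; rewrite -nc_eq0 eq_le nc_ge0 andbT; apply/ler_addgt0Pl => e e0; rewrite addr0.
pose q := K * pi / e.
have q0 : 0 <= q by rewrite divr_ge0 ?mulr_ge0 ?pi_ge0// ltW.
have q1 : 0 < q + 1 by rewrite ltr_wpDl.
rewrite (lint_shift x p0 q1 hG hG' hK2 hK').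
have b : nc (lint G (q + 1) x) <= (K / (1 + (q + 1))) * pi.
  apply: cint_bnd (lint_meas x q1 hG) _ => t.
  rewrite ncM nc_cexp_pt (@le_trans _ _ (nc (G (pt (q + 1) t))))//.
    by rewrite ler_piMr ?nc_ge0// -[leRHS]expR0 ler_expR mulr_ge0_le0// ltW.
  rewrite mulrAC ler_pdivlMr ?ltr_pwDl ?(ltW q1)// mulrC.
  have := @pt_bnd G 1 K (q + 1) t q1; rewrite expr1; apply.
  exact: hK.
rewrite (le_trans b)// mulrAC ler_pdivrMr ?ltr_pwDl ?(ltW q1)//.
rewrite -ler_pdivrMl// mulrC -/q; lra.
Qed.

Lemma fourier_cder (g : R -> C) K x : cmeas g ->
  (forall t, nc (g t) <= K * (1 + t ^+ 2)^-1) ->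
  (forall t, t ^+ 2 * nc (g t) <= K * (1 + t ^+ 2)^-1) ->
  cder (fun x => cint (fun t => g t * cexp (ii * (t * x)%:C))) x
    (cint (fun t => ii * t%:C * g t * cexp (ii * (t * x)%:C))).
Proof.
move=> mg gK gK2; have K0 := majorant_ge0 gK.
have mc (y : R) : cmeas (fun t : R => cexp (ii * (t * y)%:C)).
  by apply: cdiff_meas => t; apply: cdiff_cexp; apply: cdiffM; [exact: cdiff_cst|apply: cdiff_real].
have n1 (t y : R) : nc (cexp (ii * (t * y)%:C)) = 1.
  by rewrite nc_cexp; csimp; rewrite mul0r mul1r subrr expR0.
have ig y : cintg (fun t => g t * cexp (ii * (t * y)%:C)).
  by apply: cintg_majorant (cmeasM mg (mc y)) _ => t; rewrite ncM n1 mulr1.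
have itg y : cintg (fun t => ii * t%:C * g t * cexp (ii * (t * y)%:C)).
  apply: (@cintg_majorant R _ K).
    apply: cmeasM => //; apply: cmeasM => //; apply: cmeasM; first exact: cmeas_cst.
    by apply: cdiff_meas => t; exact: cdiff_id.
  move=> t; rewrite !ncM n1 nc_ii mul1r mulr1 nc_real.
  have [t1|t1] := leP `|t| 1; first by rewrite (le_trans _ (gK t))// ler_piMl ?nc_ge0.
  rewrite (le_trans _ (gK2 t))// ler_wpM2r ?nc_ge0// -(real_normK (num_real t)) expr2.
  by rewrite ler_peMl// ltW.
apply: (@cder_quad _ _ _ _ 1 (K * pi)) => // h _.
rewrite -cintB// -cintZ// -cintB//; last 2 first.
- by apply: cintgB.
- exact: cintgZ.
rewrite mulrAC; apply: cint_bnd.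
  apply: cmeasB; first by apply: cmeasB; exact: cmeasM.
  by apply: cmeasM; [exact: cmeas_cst|exact: cintg_meas (itg x)].
move=> t.
have := @cexp_quad R (ii * (t * x)%:C) (ii * (t * h)%:C).
rewrite -mulrDr -realCD -mulrDr; csimp; rewrite !mul0r !mul1r !subrr lexx => /(_ isT isT) H.
rewrite [X in nc X](_ : _ = g t * (cexp (ii * (t * (x + h))%:C) - cexp (ii * (t * x)%:C) -
   ii * (t * h)%:C * cexp (ii * (t * x)%:C))); last by rewrite realCM; ring.
rewrite ncM (le_trans (ler_wpM2l (nc_ge0 _) H))// ncM nc_ii mul1r nc_real normrM exprMn.
rewrite (real_normK (num_real t)).
rewrite [leLHS](_ : _ = `|h| ^+ 2 * (t ^+ 2 * nc (g t))); last by ring.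
rewrite [leRHS](_ : _ = `|h| ^+ 2 * (K * (1 + t ^+ 2)^-1)); last by ring.
by rewrite ler_wpM2l// sqr_ge0.
Qed.

Lemma lint_cder G G' K x : hol G G' ->
  (forall z, 0 < Re z -> (1 + nc z) ^+ 4 * nc (G z) <= K) ->
  cder (lint G 1) x (lint (fun z => z * G z) 1 x).
Proof.
move=> hG hK.
have hK2 z : 0 < Re z -> (1 + nc z) ^+ 2 * nc (G z) <= K.
  move=> z0; apply: le_trans (hK z z0); rewrite ler_wpM2r ?nc_ge0//.
  by rewrite ler_weXn2l// lerDl nc_ge0.
pose g t := G (pt 1 t).
have mg : cmeas g by apply: cdiff_meas => t; exact: hol_cdiff_t hG.
have b0 t : nc (g t) <= K * (1 + t ^+ 2)^-1 by exact: pt_bnd0.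
have b2 t : t ^+ 2 * nc (g t) <= K * (1 + t ^+ 2)^-1.
  have h1 z : 0 < Re z -> (1 + nc z) ^+ 2 * nc (z ^+ 2 * G z) <= K.
    move=> z0; apply: le_trans (hK z z0); rewrite ncM ncX mulrA ler_wpM2r ?nc_ge0//.
    rewrite [leRHS](exprD _ 2 2) ler_wpM2l ?sqr_ge0//.
    by rewrite lerXn2r ?nnegrE ?addr_ge0 ?nc_ge0// lerDr.
  apply: le_trans (@pt_bnd0 _ K 1 t ltr01 h1); rewrite ncM ncX ler_wpM2r ?nc_ge0//.
  have := nc_Im (pt 1 t); rewrite Im_pt => h.
  by rewrite -(real_normK (num_real t)) lerXn2r ?nnegrE ?nc_ge0.
have e y : lint G 1 y = cexp y%:C * cint (fun t => g t * cexp (ii * (t * y)%:C)).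
  rewrite -cintZ; last first.
    apply: (@cintg_majorant R _ K).
      apply: cmeasM => //; apply: cdiff_meas => t; apply: cdiff_cexp.
      by apply: cdiffM; [exact: cdiff_cst|apply: cdiff_real].
    by move=> t; rewrite ncM nc_cexp; csimp; rewrite mul0r mul1r subrr expR0 mulr1.
  congr cint; apply/funext => t; rewrite /g mulrCA -cexpD; congr (_ * cexp _).
  by rewrite /pt realCM; ring.
rewrite (_ : lint G 1 = fun y => cexp y%:C * cint (fun t => g t * cexp (ii * (t * y)%:C))); last exact/funext.
apply: cder_eq.
  apply: cderM; first by apply: cder_cexp; exact: cder_id.
  exact: (fourier_cder x mg b0 b2).
have ig1 : cintg (fun t => g t * cexp (ii * (t * x)%:C)).
  apply: (@cintg_majorant R _ K).
    apply: cmeasM => //; apply: cdiff_meas => t; apply: cdiff_cexp.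
    by apply: cdiffM; [exact: cdiff_cst|apply: cdiff_real].
  by move=> t; rewrite ncM nc_cexp; csimp; rewrite mul0r mul1r subrr expR0 mulr1.
have ig2 : cintg (fun t => ii * t%:C * g t * cexp (ii * (t * x)%:C)).
  apply: (@cintg_majorant R _ K).
    apply: cmeasM; last first.
      apply: cdiff_meas => t; apply: cdiff_cexp.
      by apply: cdiffM; [exact: cdiff_cst|apply: cdiff_real].
    apply: cmeasM => //; apply: cmeasM; first exact: cmeas_cst.
    by apply: cdiff_meas => t; exact: cdiff_id.
  move=> t; rewrite !ncM nc_cexp_i nc_ii mul1r mulr1 nc_real.
  have [t1|t1] := leP `|t| 1; first by rewrite (le_trans _ (b0 t))// ler_piMl ?nc_ge0.
  rewrite (le_trans _ (b2 t))// ler_wpM2r ?nc_ge0// -(real_normK (num_real t)) expr2.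
  by rewrite ler_peMl// ltW.
rewrite mul1r -mulrDr -cintD// -cintZ; last exact: cintgD.
congr cint; apply/funext => t; rewrite /g.
have -> : cexp (pt 1 t * x%:C) = cexp x%:C * cexp (ii * (t * x)%:C).
  by rewrite -cexpD; congr cexp; rewrite /pt realCM; ring.
by rewrite {3}/pt; ring.
Qed.

End LineIntegrals.

Section SpaceKTheory.
Context (R : realType).
Local Notation C := (Cplx R).
Local Notation leb := (@lebesgue_measure R).
Local Notation cintg := (Cintegrable leb setT).
Local Notation cint := (Cintegral leb setT).
Implicit Types (F G : C -> C) (z w : C).

Lemma spaceKP (F : spaceK R) : is_spaceK F.
Proof. by have := valP F; rewrite inE. Qed.

Lemma K_in F k z : is_spaceK F -> 0 < Re z -> derivK k F z = derive1n k F z.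
Proof.
move=> hF z0; have FF := RHP_filter (ltW z0 : cRHP z).
apply/cvg_lim => //; apply: cvg_within_filter.
apply: differentiable_continuous; apply/derivable1_diffP.
exact: is_spaceK_hol.
Qed.

Lemma K_hol F k : is_spaceK F -> hol (derivK k F) (derivK k.+1 F).
Proof.
move=> hF z z0.
have E : \forall w \near z, derivK k F w = derive1n k F w.
  by near=> w; apply: K_in => //; near: w; exact: near_RHP.
split.
  apply: (@near_eq_derivable _ _ _ (derive1n k F)); last exact: is_spaceK_hol.
  by apply: filterS E => w ->.
rewrite (K_in _ hF z0) derive1nS derive1E.
exact: (@near_eq_derive _ _ _ (derivK k F) (derive1n k F) z 1 E).
Unshelve. all: by end_near. Qed.

Lemma sem_ub F k N z : is_spaceK F -> 0 <= Re z ->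
  (1 + nc z) ^+ N * nc (derivK k F z) <= seminormK k N F.
Proof.
move=> hF z0; apply: sup_ubound; last by exists z.
have [M hM] := is_spaceK_decay hF k N; exists M => _ /= [w w0 <-].
have := hM w w0; rewrite ler_pdivlMr ?exprn_gt0 ?ltr_pwDl ?nc_ge0//.
by rewrite mulrC.
Qed.

Lemma sem_le F k N (B : R) : (forall z, 0 <= Re z -> (1 + nc z) ^+ N * nc (derivK k F z) <= B) ->
  seminormK k N F <= B.
Proof.
move=> hB; apply: sup_le_ub; last by move=> _ /= [w w0 <-]; exact: hB.
by exists ((1 + nc (0 : C)) ^+ N * nc (derivK k F 0)), 0 => //; rewrite /cRHP /=.
Qed.

Lemma sem_ge0 F k N : is_spaceK F -> 0 <= seminormK k N F.
Proof.
move=> hF; apply: le_trans (@sem_ub F k N 0 hF (lexx _)).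
by rewrite mulr_ge0 ?nc_ge0// exprn_ge0// addr_ge0// nc_ge0.
Qed.

Lemma holD G1 G2 G1' G2' : hol G1 G1' -> hol G2 G2' ->
  hol (fun z => G1 z + G2 z) (fun z => G1' z + G2' z).
Proof. by move=> h1 h2 z z0; have h := h1 z z0; have k := h2 z z0; exact: is_deriveD. Qed.

Lemma holM G1 G2 G1' G2' : hol G1 G1' -> hol G2 G2' ->
  hol (fun z => G1 z * G2 z) (fun z => G1' z * G2 z + G1 z * G2' z).
Proof.
move=> h1 h2 z z0; have h := h1 z z0; have k := h2 z z0.
rewrite (_ : (fun z => G1 z * G2 z) = G1 * G2); last by apply/funext.
by apply: is_derive_eq; rewrite /GRing.scale /=; ring.
Qed.

Lemma hol_cst (c : C) : hol (fun=> c) (fun=> 0).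
Proof. by move=> z _; exact: is_derive_cst. Qed.

Lemma hol_id : hol (fun z : C => z) (fun=> 1).
Proof. by move=> z _; exact: is_derive_id. Qed.

Lemma hol_eq G G1 G2 : G1 =1 G2 -> hol G G1 -> hol G G2.
Proof. by move=> /funext ->. Qed.

Lemma hol_exp j : hol (fun z : C => z ^+ j) (fun z => j%:R * z ^+ j.-1).
Proof.
elim: j => [|j IH].
  by apply: hol_eq (hol_cst 1) => z; rewrite mul0r.
rewrite (_ : (fun z : C => z ^+ j.+1) = (fun z => z * z ^+ j)); last by apply/funext => z; rewrite exprS.
apply: hol_eq (holM hol_id IH) => z /=; rewrite mul1r.
case: j {IH} => [|j] /=; first by rewrite !mul0r mulr0 addr0 mul1r.
by rewrite mulrCA -exprS -[in RHS]natr1 mulrDl mul1r addrC.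
Qed.

Definition GF F j k z : C := z ^+ j * derivK k F z.
Definition GF' F j k z : C := j%:R * GF F j.-1 k z + GF F j k.+1 z.

Lemma hol_GF F j k : is_spaceK F -> hol (GF F j k) (GF' F j k).
Proof.
move=> hF; apply: hol_eq (holM (hol_exp j) (K_hol k hF)) => z.
by rewrite /GF' /GF mulrA.
Qed.

Lemma hol_GF' F j k : is_spaceK F -> exists G, hol (GF' F j k) G.
Proof.
move=> hF; eexists; apply: holD; last exact: hol_GF.
by apply: holM; [exact: hol_cst|exact: hol_GF].
Qed.

Lemma GF_bnd F j k (m : nat) z : is_spaceK F -> 0 < Re z ->
  (1 + nc z) ^+ m * nc (GF F j k z) <= seminormK k (m + j) F.
Proof.
move=> hF z0; apply: le_trans (sem_ub k (m + j) hF (ltW z0)).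
rewrite ncM ncX exprD -!mulrA ler_wpM2l ?exprn_ge0 ?addr_ge0 ?nc_ge0//.
rewrite ler_wpM2r ?nc_ge0// lerXn2r ?nnegrE ?addr_ge0 ?nc_ge0// lerDr//.
Qed.

Lemma sem_mono F k N N' : is_spaceK F -> (N <= N')%N -> seminormK k N F <= seminormK k N' F.
Proof.
move=> hF NN; apply: sem_le => z z0; apply: le_trans (sem_ub k N' hF z0).
by rewrite ler_wpM2r ?nc_ge0// ler_weXn2l// lerDl nc_ge0.
Qed.

Lemma nc_nat (n : nat) : nc (n%:R : C) = n%:R.
Proof.
have -> : (n%:R : C) = (n%:R : R)%:C.
  elim: n => [//|n IH]; rewrite -natr1 IH -[in RHS]natr1 realCD //.
by rewrite nc_real ger0_norm.
Qed.

Lemma GF'_bnd F j k (m : nat) z : is_spaceK F -> 0 < Re z ->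
  (1 + nc z) ^+ m * nc (GF' F j k z) <= j%:R * seminormK k (m + j) F + seminormK k.+1 (m + j) F.
Proof.
move=> hF z0.
have p : 0 <= (1 + nc z) ^+ m by rewrite exprn_ge0 ?addr_ge0 ?nc_ge0.
rewrite (le_trans (ler_wpM2l p (ncD _ _)))// mulrDr lerD ?GF_bnd//.
rewrite ncM nc_nat mulrCA ler_wpM2l// (le_trans (GF_bnd _ _ _ hF z0))// sem_mono//.
by rewrite leq_add2l leq_pred.
Qed.

Definition phi F j k := lint (GF F j k) 1.

Lemma phi_cder F j k x : is_spaceK F -> cder (phi F j k) x (phi F j.+1 k x).
Proof.
move=> hF.
rewrite (_ : phi F j.+1 k = lint (fun z => z * GF F j k z) 1); last first.
  by congr (lint _ 1); apply/funext => z; rewrite /GF exprS mulrA.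
apply: lint_cder; first exact: hol_GF.
by move=> z z0; exact: GF_bnd.
Qed.

Lemma phi_X F j k x : is_spaceK F ->
  x%:C * phi F j k x = - (j%:R * phi F j.-1 k x + phi F j k.+1 x).
Proof.
move=> hF; have [G hG] := hol_GF' j k hF.
rewrite /phi (lint_parts x ltr01 (hol_GF j k hF) hG (K := seminormK k (2 + j) F)
  (K' := j%:R * seminormK k (2 + j) F + seminormK k.+1 (2 + j) F)); last 2 first.
- by move=> z z0; exact: GF_bnd.
- by move=> z z0; exact: GF'_bnd.
have i1 k' j' : cintg (fun t => GF F j' k' (pt 1 t) * cexp (pt 1 t * x%:C)).
  apply: lint_int (hol_GF j' k' hF) _ => //.
  by move=> z z0; exact: GF_bnd.
congr (- _); rewrite /lint -cintZ// -cintD//; last exact: cintgZ.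
by congr cint; apply/funext => t; rewrite /GF'; ring.
Qed.

Lemma phi_out F j k x : is_spaceK F -> x <= 0 -> phi F j k x = 0.
Proof.
move=> hF x0; have [G hG] := hol_GF' j k hF.
apply: lint_out (hol_GF j k hF) hG _ _ x0 => //.
- by move=> z z0; exact: GF_bnd.
- by move=> z z0; exact: GF'_bnd.
Qed.

Lemma phi_shift F j k p x : is_spaceK F -> 0 < p -> phi F j k x = lint (GF F j k) p x.
Proof.
move=> hF p0; have [G hG] := hol_GF' j k hF.
apply: lint_shift (hol_GF j k hF) hG _ _ => //.
- by move=> z z0; exact: GF_bnd.
- by move=> z z0; exact: GF'_bnd.
Qed.

Lemma phi_bnd F j k x : is_spaceK F -> 0 < x ->
  nc (phi F j k x) <= expR 1 * pi * seminormK k (2 + j) F.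
Proof.
move=> hF x0; have p0 : 0 < x^-1 by rewrite invr_gt0.
rewrite (phi_shift _ _ _ hF p0).
have hb z : 0 < Re z -> (1 + nc z) ^+ 2 * nc (GF F j k z) <= seminormK k (2 + j) F.
  by move=> z0; exact: GF_bnd.
have := lint_bnd x p0 (hol_GF j k hF) hb.
rewrite mulVf ?gt_eqF// => h; apply: le_trans h _.
by rewrite le_eqVlt; apply/orP; left; apply/eqP; ring.
Qed.

Definition sumsem (s : seq (nat * nat)) F := \sum_(i <- s) seminormK i.1 i.2 F.

Lemma sumsem_ge0 s F : is_spaceK F -> 0 <= sumsem s F.
Proof. by move=> hF; apply: sumr_ge0 => i _; exact: sem_ge0. Qed.

Lemma phi_ub N : forall j k, exists C0 s, 0 <= C0 /\ forall F, is_spaceK F ->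
  forall x, 0 < x -> x ^+ N * nc (phi F j k x) <= C0 * sumsem s F.
Proof.
elim: N => [|N IH] j k.
  exists (expR 1 * pi), [:: (k, (2 + j)%N)]; split; first by rewrite mulr_ge0 ?expR_ge0 ?pi_ge0.
  by move=> F hF x x0; rewrite expr0 mul1r /sumsem big_seq1; exact: phi_bnd.
have [C1 [s1 [C10 h1]]] := IH j.-1 k; have [C2 [s2 [C20 h2]]] := IH j k.+1.
exists (j%:R * C1 + C2), (s1 ++ s2); split; first by rewrite addr_ge0// mulr_ge0.
move=> F hF x x0; rewrite exprSr -mulrA -[x in x * nc _](gtr0_norm x0) -nc_realM phi_X// ncN.
have p : 0 <= x ^+ N by rewrite exprn_ge0// ltW.
rewrite (le_trans (ler_wpM2l p (ncD _ _)))// mulrDr mulrDl lerD//.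
- rewrite ncM nc_nat mulrCA -mulrA ler_wpM2l// (le_trans (h1 F hF x x0))// ler_wpM2l//.
  by rewrite /sumsem big_cat lerDl; exact: sumsem_ge0.
- rewrite (le_trans (h2 F hF x x0))// ler_wpM2l//.
  by rewrite /sumsem big_cat lerDr; exact: sumsem_ge0.
Qed.

Lemma S_phi F j k : is_spaceK F -> is_spaceS (phi F j k).
Proof.
move=> hF; apply: (@S_coind R (fun f => exists j, f = phi F j k)); last by exists j.
move=> _ [i ->]; split.
- by move=> x; exact: phi_out.
- by move=> N; have [C0 [s [_ h]]] := phi_ub N i k; exists (C0 * sumsem s F) => x; exact: h.
- by exists (phi F i.+1 k); [exists i.+1|move=> x; exact: phi_cder].
Qed.

Lemma D_phi F j k : is_spaceK F -> Dfun (phi F j k) = phi F j.+1 k.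
Proof. by move=> hF; apply/funext => x; apply: cder_D; exact: phi_cder. Qed.

Lemma iterD_phi F n j k : is_spaceK F -> iter n (@Dfun R) (phi F j k) = phi F (n + j) k.
Proof. by move=> hF; elim: n => //= n ->; exact: D_phi.
Qed.

Lemma phi_bd (r : R) j k : exists C0 s, 0 <= C0 /\ forall F, is_spaceK F ->
  bd r (phi F j k) (C0 * sumsem s F).
Proof.
pose n := Num.Def.archi_bound `|r|.
have [C1 [s1 [C10 h1]]] := phi_ub 0 (n + j) k; have [C2 [s2 [C20 h2]]] := phi_ub n j k.
exists (C1 + C2), (s1 ++ s2); split; first exact: addr_ge0.
move=> F hF t.
apply: (@le_trans _ _ (C1 * sumsem s1 F + C2 * sumsem s2 F)).
  apply: (@bd_interp _ n n) => [|x x0|x x0|]; first exact: S_phi.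
  - by rewrite iterD_phi//; have := h1 F hF x x0; rewrite expr0 mul1r.
  - exact: h2.
  - by rewrite -ler_norml ltW// archi_boundP.
rewrite mulrDl lerD// ler_wpM2l// /sumsem big_cat ?lerDl ?lerDr; exact: sumsem_ge0.
Qed.

(* Locked because comparing [Kinv F] with [Kinv G] by unfolding diverges. *)
Definition Kinv : (C -> C) -> R -> C :=
  locked (fun F x => ((2 * pi)^-1)%:C * phi F 0 0 x).

Lemma KinvE F : Kinv F = fun x => ((2 * pi)^-1)%:C * phi F 0 0 x.
Proof. by rewrite /Kinv -lock. Qed.

Lemma S_Kinv F : is_spaceK F -> is_spaceS (Kinv F).
Proof. by move=> hF; rewrite KinvE; apply: S_scale; exact: S_phi. Qed.

Lemma pi2_neq0 : (2 * pi)%:C != 0 :> C.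
Proof. by rewrite -nc_eq0 nc_real normr_eq0 mulf_neq0// gt_eqF// pi_gt0. Qed.

Lemma pi2V : ((2 * pi)^-1)%:C * (2 * pi)%:C = 1 :> C.
Proof. by rewrite -realCM mulVf// mulf_neq0// gt_eqF// pi_gt0. Qed.

Lemma LamK_major f : is_spaceS f -> exists K : R, forall p t, 0 <= p ->
  nc (Lam f (pt p t)) <= K * (1 + t ^+ 2)^-1.
Proof.
move=> hf; have [M hM] := Lam_decay 2 hf; exists M => p t p0.
have := hM (pt p t); rewrite Re_pt => /(_ p0) h.
rewrite ler_pdivlMr ?ltr_pwDl ?sqr_ge0// (le_trans _ h)// mulrC ler_wpM2r ?nc_ge0//.
exact: nc_pt_ge.
Qed.

Lemma Lam_cdiff_t f p t : is_spaceS f -> 0 <= p -> cder (fun t => Lam f (pt p t)) t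
   (- (ii : C) * Lam (Xfun f) (pt p t)).
Proof.
move=> hf p0; have [M hM] := Lam_quad hf.
apply: (@cder_quad _ _ _ _ 1 M) => // h _.
have e : pt p (t + h) = pt p t + ii * h%:C by rewrite /pt realCD; ring.
have := hM (pt p t) (ii * h%:C); rewrite -e !Re_pt => /(_ p0 p0).
rewrite ncM nc_ii mul1r nc_real.
by rewrite (_ : ii * h%:C * - _ = h%:C * (- (ii : C) * Lam (Xfun f) (pt p t))); last by ring.
Qed.

Lemma Lam_inv f p x : is_spaceS f -> 0 <= p ->
  (2 * pi)%:C * f x = cint (fun t => Lam f (pt p t) * cexp (pt p t * x%:C)).
Proof.
move=> hf p0; pose g y := f y * cexp (- (p%:C * y%:C)).
have [K hK] := S_majorant hf; have [K' hK'] := LamK_major hf.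
have m : cmeas (fun t => Lam f (pt p t)).
  by apply: cdiff_meas => t; exists (- (ii : C) * Lam (Xfun f) (pt p t)); exact: Lam_cdiff_t.
have := @fourier_inversion R g (fun t => Lam f (pt p t)) K K' _ m _ _ _ x.
rewrite /g => H.
have {}H : (2 * pi)%:C * (f x * cexp (- (p%:C * x%:C))) =
     cint (fun t => Lam f (pt p t) * cexp (ii * (t * x)%:C)).
  apply: H.
  - by move=> y; exact: Lam_diff.
  - by move=> y; apply: le_trans (@Lam_le _ _ p%:C y hf _) _ => //; exact: hK.
  - move=> t; rewrite /Lam; congr cint; apply/funext => y; rewrite -mulrA -cexpD; congr (_ * cexp _).
    by rewrite /pt realCM; ring.
  - by move=> t; exact: hK'.
have -> : (fun t => Lam f (pt p t) * cexp (pt p t * x%:C)) =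
  (fun t => cexp (p%:C * x%:C) * (Lam f (pt p t) * cexp (ii * (t * x)%:C))).
  apply/funext => t; rewrite mulrCA -cexpD; congr (_ * cexp _).
  by rewrite /pt realCM; ring.
rewrite cintZ; last first.
  apply: (@cintg_majorant R _ K').
    apply: cmeasM => //; apply: cdiff_meas => t; apply: cdiff_cexp.
    by apply: cdiffM; [exact: cdiff_cst|apply: cdiff_real].
  by move=> t; rewrite ncM nc_cexp_i mulr1; exact: hK'.
rewrite -H cexpN; field; exact: cexp_neq0.
Qed.

Lemma KinvK f : is_spaceS f -> Kinv (LamK f) = f.
Proof.
move=> hf; apply/funext => x; rewrite KinvE /phi /lint.
rewrite (_ : (fun t => _) = (fun t => Lam f (pt 1 t) * cexp (pt 1 t * x%:C))); last first.
  by apply/funext => t; rewrite /GF expr0 mul1r LamK_derivK// Re_pt.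
by rewrite -Lam_inv// mulrA pi2V mul1r.
Qed.

Lemma K_eq F G : is_spaceK F -> is_spaceK G -> (forall z, 0 < Re z -> F z = G z) -> F = G.
Proof.
move=> hF hG FG; apply/funext => z.
have [z0|z0] := leP 0 (Re z); last first.
  have nz : ~ cRHP z by rewrite /cRHP /= => h; move: (le_lt_trans h z0); rewrite ltxx.
  by rewrite (is_spaceK_out hF nz) (is_spaceK_out hG nz).
rewrite (is_spaceK_bdry hF z0) (is_spaceK_bdry hG z0).
have FF := RHP_filter (z0 : cRHP z).
apply/cvg_lim => //; apply: cvg_trans (is_spaceK_smooth hG (k := 0) z0).
apply: near_eq_cvg; near=> w; apply/esym; apply: FG.
by near: w; exact: withinT.
Unshelve. all: by end_near. Qed.

Lemma LamKK F : is_spaceK F -> LamK (Kinv F) = F.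
Proof.
move=> hF; have hS := S_Kinv hF.
apply: K_eq => //; first exact: LamK_spaceK.
move=> z z0; rewrite LamK_E ?ltW//.
have F0 w : 0 < Re w -> GF F 0 0 w = F w.
  by move=> w0; rewrite /GF expr0 mul1r -(is_spaceK_bdry hF (ltW w0 : cRHP w)).
set p := Re z in z0 *; set s := Im z.
have zE : z = pt p s by rewrite ptE.
have [K hK] := S_majorant hS.
pose fh (xi : R) : C := (2 * pi)%:C * (Kinv F (- xi) * cexp (- (p%:C * (- xi)%:C))).
have mfh : cmeas fh.
  apply: cdiff_meas => t; apply: cdiffM; first exact: cdiff_cst.
  by apply: (@cdiff_comp R (fun y => Kinv F y * cexp (- (p%:C * y%:C)))) => //; exact: Lam_diff.
have := @fourier_inversion R (fun t => GF F 0 0 (pt p t)) fh (seminormK 0 2 F) (2 * pi * K) _ mfh _ _ _ s.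
rewrite -zE F0// => H.
have pi2 : 0 <= 2 * pi :> R by rewrite mulr_ge0// pi_ge0.
have {}H : (2 * pi)%:C * F z = cint (fun t => fh t * cexp (ii * (t * s)%:C)).
  apply: H.
  - by move=> t; exact: hol_cdiff_t (hol_GF 0 0 hF).
  - by move=> t; apply: pt_bnd0 => // w w0; exact: (GF_bnd 0 0 2).
  - move=> t; rewrite /fh KinvE -mulrA !mulrA (mulrC (2 * pi)%:C) pi2V mul1r (phi_shift _ _ _ hF z0) /lint.
    rewrite mulrC -cintZ; last first.
      by apply: (lint_int _ z0 (hol_GF 0 0 hF)) => w w0; exact: (GF_bnd 0 0 2 hF w0).
    congr cint; apply/funext => x; rewrite mulrCA -cexpD; congr (_ * cexp _).
    by rewrite /pt realCM realCN; ring.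
  - move=> t; rewrite /fh ncM nc_real (ger0_norm pi2) -mulrA ler_wpM2l//.
    have := hK (- t); rewrite sqrrN; apply: le_trans.
    by apply: Lam_le => //; exact: ltW.
apply: (mulfI pi2_neq0); rewrite H.
pose g x := Kinv F x * cexp (- (z * x%:C)).
have [ig eg] := @cneg R g (Lam_int hS (ltW z0)).
rewrite -[Lam _ z]/(cint g) -eg -cintZ//.
congr cint; apply/funext => x; rewrite /g /fh -!mulrA -cexpD; congr (_ * (_ * cexp _)).
by rewrite zE /pt realCM realCN; ring.
Qed.

End SpaceKTheory.

(** * The operators on K *)

Section Operators.
Context (R : realType).
Local Notation C := (Cplx R).
Local Notation leb := (@lebesgue_measure R).
Local Notation cintg := (Cintegrable leb setT).
Local Notation cint := (Cintegral leb setT).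

Lemma spaceS_ext (f g : spaceS R) : f =1 g -> f = g.
Proof.
case: f g => f hf [g hg] /= /funext fg; subst g; congr SpaceS; exact: Prop_irrelevance.
Qed.

Lemma spaceK_ext (F G : spaceK R) : (forall z, F z = G z) -> F = G.
Proof. by move=> FG; apply: val_inj; apply/funext. Qed.

Lemma LamS_subproof (f : spaceS R) : LamK f \in @spaceK_pred R.
Proof. by rewrite inE; apply: LamK_spaceK; exact: spaceS_prop. Qed.
Definition LamS (f : spaceS R) : spaceK R := SpaceK (LamS_subproof f).
Definition KinvS (F : spaceK R) : spaceS R := SpaceS (S_Kinv (spaceKP F)).

Lemma LamSK (f : spaceS R) : KinvS (LamS f) = f.
Proof. by apply: spaceS_ext => x /=; rewrite KinvK//; exact: spaceS_prop. Qed.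
Lemma KinvSK (F : spaceK R) : LamS (KinvS F) = F.
Proof. by apply: spaceK_ext => z /=; rewrite LamKK//; exact: spaceKP. Qed.

Definition RS (c h : C) (al a : R) (f : spaceS R) : spaceS R :=
  match pselect (is_spaceS (fun x => c * Rfun h al a f x)) with
  | left p => SpaceS p
  | right _ => f
  end.

Lemma RSE c h al a (f : spaceS R) x : al != 0 -> 0 < a ->
  RS c h al a f x = c * Rfun h al a f x.
Proof.
move=> al0 a0; rewrite /RS; case: pselect => //= np; exfalso; apply: np.
by apply: S_scale; apply: S_R => //; exact: spaceS_prop.
Qed.

Lemma ln_affine (al a b : R) : 0 < a -> 0 < b ->
  ln (a * b `^ al) = ln a + al * ln b.
Proof. by move=> a0 b0; rewrite lnM ?posrE ?powR_gt0// ln_powR. Qed.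

Lemma RS_comp c1 c2 (g h : C) (al be a b : R) (f : spaceS R) :
  al != 0 -> be != 0 -> 0 < a -> 0 < b ->
  RS c1 g be b (RS c2 h al a f) =
  RS (c1 * c2 * cexp (h * (ln b)%:C)) (g + h * be%:C) (al * be) (a * b `^ al) f.
Proof.
move=> al0 be0 a0 b0; apply: spaceS_ext => x.
rewrite !RSE ?mulf_neq0 ?mulr_gt0 ?powR_gt0// /Rfun.
case: ltP => x0; last by rewrite !mulr0.
rewrite RSE// Rfun_exp ln_affine//.
rewrite (_ : al * (be * ln x + ln b) + ln a = al * be * ln x + (ln a + al * ln b)); last by ring.
rewrite realCD realCM mulrDl !mulrDr !cexpD !mulrA; ring.
Qed.

Lemma RS_id (f : spaceS R) : RS 1 0 1 1 f = f.
Proof.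
apply: spaceS_ext => x; rewrite RSE ?oner_eq0// /Rfun mul1r.
case: ltP => x0; last by rewrite (S_out (spaceS_prop f)).
by rewrite mul0r cexp0 mul1r ln1 addr0 mul1r lnK.
Qed.

Definition TK c h al a (F : spaceK R) : spaceK R := LamS (RS c h al a (KinvS F)).

Lemma TK_comp c1 c2 (g h : C) (al be a b : R) (F : spaceK R) :
  al != 0 -> be != 0 -> 0 < a -> 0 < b ->
  TK c1 g be b (TK c2 h al a F) =
  TK (c1 * c2 * cexp (h * (ln b)%:C)) (g + h * be%:C) (al * be) (a * b `^ al) F.
Proof. by move=> *; rewrite /TK LamSK RS_comp. Qed.

Lemma Kinv_lin (c : C) (F G : C -> C) x : is_spaceK F -> is_spaceK G ->
  Kinv (c *: F + G) x = c * Kinv F x + Kinv G x.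
Proof.
move=> hF hG; have hFG := is_spaceK_lin c hF hG.
have i1 H : is_spaceK H -> cintg (fun t => GF H 0 0 (pt 1 t) * cexp (pt 1 t * x%:C)).
  by move=> hH; apply: (lint_int _ ltr01 (hol_GF 0 0 hH)) => w w0; exact: (GF_bnd 0 0 2 hH w0).
rewrite !KinvE (_ : phi (c *: F + G) 0 0 x = c * phi F 0 0 x + phi G 0 0 x); first by rewrite mulrDr mulrCA.
rewrite /phi /lint -cintZ; last exact: i1.
rewrite -cintD; [|by apply: cintgZ; exact: i1|exact: i1].
congr cint; apply/funext => t; have zt : cRHP (pt 1 t) by change (0 <= Re (pt 1 t)); rewrite Re_pt.
rewrite /GF derivK_lin//.
by rewrite !expr0 !mul1r mulrDl mulrA.
Qed.

Lemma Lam_lin (c : C) (f g : R -> C) z : is_spaceS f -> is_spaceS g -> 0 <= Re z ->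
  Lam (fun x => c * f x + g x) z = c * Lam f z + Lam g z.
Proof.
move=> hf hg z0; rewrite /Lam -cintZ; last exact: Lam_int.
rewrite -cintD; last 2 first.
- by apply: cintgZ; exact: Lam_int.
- exact: Lam_int.
by congr cint; apply/funext => x; rewrite mulrDl mulrA.
Qed.

Lemma TK_val c h al a (F : spaceK R) z : al != 0 -> 0 < a -> 0 <= Re z ->
  TK c h al a F z = Lam (fun x => c * Rfun h al a (Kinv F) x) z.
Proof.
move=> al0 a0 z0; apply: (etrans (LamK_E _ z0)); congr Lam; apply/funext => x.
by rewrite RSE.
Qed.

Lemma S_cRfun c h al a (F : spaceK R) : al != 0 -> 0 < a ->
  is_spaceS (fun x => c * Rfun h al a (Kinv F) x).
Proof. by move=> al0 a0; apply: S_scale; apply: S_R => //; apply: S_Kinv; exact: spaceKP. Qed.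

Lemma spaceK_neg (H : spaceK R) z : Re z < 0 -> H z = 0.
Proof.
move=> z0; apply: (is_spaceK_out (spaceKP H)); rewrite /cRHP /= => h0.
by move: (le_lt_trans h0 z0); rewrite ltxx.
Qed.

Lemma TK_lin_eq c h al a (k : C) (F G H : spaceK R) z : al != 0 -> 0 < a ->
  (forall x, Kinv H x = k * Kinv F x + Kinv G x) ->
  TK c h al a H z = k * TK c h al a F z + TK c h al a G z.
Proof.
move=> al0 a0 E; have [z0|z0] := leP 0 (Re z); last first.
  by rewrite !(fun H => spaceK_neg H z0) mulr0 addr0.
rewrite (TK_val c h F al0 a0 z0) (TK_val c h G al0 a0 z0) (TK_val c h H al0 a0 z0).
apply: (etrans _ (Lam_lin k (S_cRfun c h F al0 a0) (S_cRfun c h G al0 a0) z0)).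
congr Lam; apply/funext => x; rewrite /Rfun; case: ltP => x0; last by rewrite !mulr0 addr0.
by rewrite E; ring.
Qed.

Lemma TK_lin c h al a : al != 0 -> 0 < a -> linear (TK c h al a).
Proof.
move=> al0 a0 k F G; apply: spaceK_ext => z; apply: TK_lin_eq => // x.
by apply: Kinv_lin; exact: spaceKP.
Qed.

Lemma TK_scale_eq (k c h : C) al a (F : spaceK R) z : al != 0 -> 0 < a ->
  k * TK c h al a F z = TK (k * c) h al a F z.
Proof.
move=> al0 a0; have [z0|z0] := leP 0 (Re z); last first.
  by rewrite !(fun H => spaceK_neg H z0) mulr0.
rewrite (TK_val c h F al0 a0 z0) (TK_val (k * c) h F al0 a0 z0).
apply: (etrans (esym (LamZ k (S_cRfun c h F al0 a0) z0))).
by congr Lam; apply/funext => x; rewrite mulrA.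
Qed.

Lemma TK_scale (k c h : C) al a F : al != 0 -> 0 < a -> k *: TK c h al a F = TK (k * c) h al a F.
Proof. by move=> al0 a0; apply: spaceK_ext => z; exact: TK_scale_eq. Qed.

Lemma seminormK_D (F G : C -> C) k N : is_spaceK F -> is_spaceK G ->
  seminormK k N (F + G) <= seminormK k N F + seminormK k N G.
Proof.
move=> hF hG; apply: sem_le => z z0.
have -> : F + G = 1 *: F + G by rewrite scale1r.
rewrite derivK_lin// scale1r.
have p : 0 <= (1 + nc z) ^+ N by rewrite exprn_ge0 ?addr_ge0 ?nc_ge0.
by rewrite (le_trans (ler_wpM2l p (ncD _ _)))// mulrDr lerD ?sem_ub.
Qed.

Lemma seminormK_0 k N : seminormK k N (0 : C -> C) = 0.
Proof.
have h0 := @is_spaceK0 R.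
apply: le_anti; rewrite sem_ge0// andbT; apply: sem_le => z z0.
have -> : (0 : C -> C) = (-1) *: 0 + 0 by rewrite scaler0 addr0.
have E := derivK_lin (-1) k h0 h0 (z0 : cRHP z).
by rewrite E scaleN1r addNr nc0 mulr0.
Qed.

Lemma spaceK_valD (F G : spaceK R) : spaceK_val (F + G) = spaceK_val F + spaceK_val G.
Proof. by []. Qed.
Lemma spaceK_valN (F : spaceK R) : spaceK_val (- F) = - spaceK_val F.
Proof. by []. Qed.
Lemma spaceK_valB (F G : spaceK R) : spaceK_val (F - G) = spaceK_val F - spaceK_val G.
Proof. by []. Qed.

Lemma near_ball_K (G : spaceK R) k N (e : R) : 0 < e ->
  \forall F \near G, seminormK k N (F - G) < e.
Proof.
move=> e0; exists [set F : spaceK R | seminormK k N (F - G) < e] ; split => //; last by rewrite /= subrr seminormK_0.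
pose i : nat * nat * spaceK R * R := (k, N, G, e).
exists [set [set F : spaceK R | seminormK k N (F - G) < e]]; last by rewrite bigcup_set1.
move=> A ->; exists (finmap.fset1 i); last by rewrite set_fset1 bigcap_set1.
by move=> j; rewrite finmap.in_fset1 => /eqP ->; apply/mem_set.
Qed.

Lemma near_sumsem (G : spaceK R) s (e : R) : 0 < e ->
  \forall F \near G, sumsem s (F - G) < e.
Proof.
elim: s e => [|[k N] s IH] e e0.
  by near=> F; rewrite /sumsem big_nil.
have e2 : 0 < e / 2 by rewrite divr_gt0.
near=> F; rewrite /sumsem big_cons /= (splitr e) ltrD//.
- by near: F; exact: near_ball_K.
- by near: F; exact: IH.
Unshelve. all: by end_near. Qed.

Lemma continuous_K (T : spaceK R -> spaceK R) : linear T ->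
  (forall k N, exists C0 s, 0 <= C0 /\ forall F, seminormK k N (T F) <= C0 * sumsem s F) ->
  continuous T.
Proof.
move=> lT bT F A [_ [[B sB <-] [D BD DF] sUBA]].
have DA : T @^-1` D `<=` T @^-1` A by move=> G DG; apply: sUBA; exists D.
change (nbhs F (T @^-1` A)); apply: (filterS DA).
have /sB [I sI IDeD] := BD; rewrite -IDeD; apply: (filter_bigI (F := nbhs F)) => -[[[k N] G0] e] hi.
have e0 : 0 < e by have := sI _ hi; move/set_mem.
have F0 : seminormK k N (T F - G0) < e by move: DF; rewrite -IDeD => /(_ _ hi).
have [C0 [s [C00 hs]]] := bT k N.
have C1 : 0 < C0 + 1 by rewrite ltr_wpDl.
have d0 : 0 < (e - seminormK k N (T F - G0)) / (C0 + 1) by rewrite divr_gt0// subr_gt0.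
near=> G; rewrite /=.
have E : spaceK_val (T G) - spaceK_val G0 = spaceK_val (T (G - F)) + spaceK_val (T F - G0).
  have := lT (-1) F G; rewrite !scaleN1r (addrC (- F)) => ->.
  by rewrite spaceK_valB spaceK_valD spaceK_valN addrA [in RHS](addrC (- spaceK_val (T F))) subrK.
rewrite E; apply: le_lt_trans (seminormK_D k N (spaceKP (T (G - F))) (spaceKP (T F - G0))) _.
rewrite -ltrBrDr spaceK_valB (le_lt_trans (hs _))//.
apply: (@le_lt_trans _ _ ((C0 + 1) * sumsem s (G - F))).
  by rewrite ler_wpM2r ?lerDl// sumsem_ge0//; exact: spaceKP.
rewrite mulrC -ltr_pdivlMr// spaceK_valB.
by near: G; exact: near_sumsem.
Unshelve. all: by end_near. Qed.

End Operators.

Section Continuity.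
Context (R : realType).
Local Notation C := (Cplx R).
Local Notation leb := (@lebesgue_measure R).

(* Families of functions of [S(R_+)] depending on an element of [K], which is
   stable under differentiation: the seminorm estimates below are uniform in
   that element. *)
Inductive Kspan (al a : R) : (spaceK R -> R -> C) -> Prop :=
| Kspan_base h j : Kspan al a (fun F => Rfun h al a (phi F j 0))
| Kspan_add f g : Kspan al a f -> Kspan al a g -> Kspan al a (fun F x => f F x + g F x)
| Kspan_scale (c : C) f : Kspan al a f -> Kspan al a (fun F x => c * f F x).

Lemma Kspan_Rspan al a f (F : spaceK R) : Kspan al a f -> Rspan al a (f F).
Proof.
elim=> [h j|f1 f2 _ h1 _ h2|c f1 _ h1].
- by apply: Rspan_base; apply: S_phi; exact: spaceKP.
- exact: Rspan_add.
- exact: Rspan_scale.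
Qed.

Lemma S_Kspan al a f (F : spaceK R) : al != 0 -> 0 < a -> Kspan al a f -> is_spaceS (f F).
Proof. by move=> al0 a0 /(Kspan_Rspan F)/(S_Rspan al0 a0). Qed.

Lemma Kspan_D al a f : al != 0 -> 0 < a -> Kspan al a f ->
  exists2 g, Kspan al a g & forall F x, cder (f F) x (g F x).
Proof.
move=> al0 a0; elim=> [h j|f1 f2 _ [g1 k1 d1] _ [g2 k2 d2]|c f1 _ [g1 k1 d1]].
- exists (fun F x => h * Rfun (h - 1) al a (phi F j 0) x +
    al%:C * a%:C * Rfun (h + (al - 1)%:C) al a (phi F j.+1 0) x).
    by apply: Kspan_add; apply: Kspan_scale; exact: Kspan_base.
  move=> F x; rewrite -D_phi; last exact: spaceKP.
  by apply: cder_Rfun => //; apply: S_phi; exact: spaceKP.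
- exists (fun F x => g1 F x + g2 F x); first exact: Kspan_add.
  by move=> F x; exact: cderD.
- exists (fun F x => c * g1 F x); first exact: Kspan_scale.
  by move=> F x; exact: cderZ.
Qed.

Lemma sumsem_cat C1 C2 s1 s2 (F : spaceK R) : 0 <= C1 -> 0 <= C2 ->
  C1 * sumsem s1 F + C2 * sumsem s2 F <= (C1 + C2) * sumsem (s1 ++ s2) F.
Proof.
move=> C10 C20; have p s : 0 <= sumsem s F := sumsem_ge0 s (spaceKP F).
have -> : sumsem (s1 ++ s2) F = sumsem s1 F + sumsem s2 F by rewrite /sumsem big_cat.
by rewrite mulrDl lerD// ler_wpM2l// ?lerDl ?lerDr.
Qed.

Lemma Kspan_bd al a f (r : R) : al != 0 -> Kspan al a f ->
  exists C0 s, 0 <= C0 /\ forall F : spaceK R, bd r (f F) (C0 * sumsem s F).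
Proof.
move=> al0; elim=> [h j|f1 f2 _ [C1 [s1 [C10 h1]]] _ [C2 [s2 [C20 h2]]]|c f1 _ [C1 [s1 [C10 h1]]]].
- have [C0 [s [C00 hC]]] := @phi_bd R ((r + Re h) / al) j 0.
  exists (expR (- ((r + Re h) / al * ln a)) * C0), s; split; first by rewrite mulr_ge0 ?expR_ge0.
  by move=> F; rewrite -[_ * sumsem _ _]mulrA; apply: bd_Rfun => //; apply: hC; exact: spaceKP.
- exists (C1 + C2), (s1 ++ s2); split; first exact: addr_ge0.
  move=> F t; apply: (@le_trans _ _ (C1 * sumsem s1 F + C2 * sumsem s2 F)).
    by rewrite (le_trans (ler_wpM2l (expR_ge0 _) (ncD _ _)))// mulrDr lerD ?h1 ?h2.
  exact: sumsem_cat.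
- exists (nc c * C1), s1; split; first by rewrite mulr_ge0 ?nc_ge0.
  by move=> F t; rewrite ncM mulrCA -mulrA ler_wpM2l ?nc_ge0 ?h1.
Qed.

Lemma Kspan_Lam al a N f : al != 0 -> 0 < a -> Kspan al a f ->
  exists C0 s, 0 <= C0 /\ forall (F : spaceK R) z, 0 <= Re z ->
    (1 + nc z) ^+ N * nc (Lam (f F) z) <= C0 * sumsem s F.
Proof.
move=> al0 a0; elim: N f => [|N IH] f Pf.
  have [C1 [s1 [C10 h1]]] := Kspan_bd 0%:R al0 Pf.
  have [C2 [s2 [C20 h2]]] := Kspan_bd 2%:R al0 Pf.
  exists ((C1 + C2) * pi), (s1 ++ s2); split.
    by apply: mulr_ge0; [exact: addr_ge0|exact: pi_ge0].
  move=> F z z0; rewrite expr0 mul1r.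
  have hf := S_Kspan F al0 a0 Pf.
  have b1 x : 0 < x -> nc (f F x) <= C1 * sumsem s1 F.
    by move=> x0; have := bd_pow (h1 F) x0; rewrite expr0 mul1r.
  apply: le_trans (Lam_bnd hf (S_major hf b1 (bd_pow (h2 F))) z0) _.
  rewrite mulrAC ler_wpM2r ?pi_ge0//.
  exact: sumsem_cat.
have [g Pg dg] := Kspan_D al0 a0 Pf.
have [C1 [s1 [C10 h1]]] := IH f Pf; have [C2 [s2 [C20 h2]]] := IH g Pg.
exists (C1 + C2), (s1 ++ s2); split; first exact: addr_ge0.
move=> F z z0; rewrite exprSr -mulrA mulrDl mul1r -ncM Lam_D//; last exact: S_Kspan al0 a0 Pf.
have -> : Dfun (f F) = g F by apply/funext => x; apply: cder_D; exact: dg.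
rewrite mulrDr; apply: le_trans (lerD (h1 F z z0) (h2 F z z0)) _.
have p := sumsem_ge0 _ (spaceKP F).
by rewrite mulrDl lerD// ler_wpM2l// /sumsem big_cat ?lerDl ?lerDr; exact: p.
Qed.

Lemma NX_Rfun (c h : C) al a f x : NX (fun x => c * Rfun h al a f x) x = - c * Rfun (h + 1) al a f x.
Proof.
rewrite /NX /Xfun /Rfun; case: ltP => x0; last by rewrite !mulr0.
by rewrite mulrDl cexpD mul1r cexp_real lnK//; ring.
Qed.

Lemma iterNX_Rfun k (c h : C) al a f :
  iter k (@NX R) (fun x => c * Rfun h al a f x) =
  (fun x => (- 1) ^+ k * c * Rfun (h + k%:R) al a f x).
Proof.
elim: k => [|k IH]; first by apply/funext => x; rewrite /= expr0 mul1r addr0.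
rewrite iterS IH; apply/funext => x; rewrite NX_Rfun -addrA natr1 exprS; ring.
Qed.

Lemma TK_continuous c h al a : al != 0 -> 0 < a -> continuous (TK c h al a : spaceK R -> spaceK R).
Proof.
move=> al0 a0; apply: continuous_K; first exact: TK_lin.
move=> k N.
pose f (F : spaceK R) x := (- 1) ^+ k * c * ((2 * pi)^-1)%:C * Rfun (h + k%:R) al a (phi F 0 0) x.
have Pf : Kspan al a f by apply: Kspan_scale; exact: Kspan_base.
have [C0 [s [C00 hs]]] := Kspan_Lam N al0 a0 Pf.
exists C0, s; split => // F; apply: sem_le => z z0.
have E : spaceK_val (TK c h al a F) = LamK (fun x => c * Rfun h al a (Kinv F) x).
  by apply/funext => w; rewrite /TK /=; congr LamK; apply/funext => x; exact: RSE.
rewrite E LamK_derivK//; last exact: S_cRfun.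
rewrite iterNX_Rfun.
have -> : (fun x => (-1) ^+ k * c * Rfun (h + k%:R) al a (Kinv F) x) = f F; last exact: hs.
apply/funext => x; rewrite /f KinvE /Rfun; case: ltP => x0; last by rewrite !mulr0.
by ring.
Qed.

End Continuity.

(** * The Gamma function and the Mellin-Barnes kernel *)

Section Mellin.
Context (R : realType).
Local Notation C := (Cplx R).
Local Notation leb := (@lebesgue_measure R).
Local Notation cintg := (Cintegrable leb setT).
Local Notation cint := (Cintegral leb setT).
Implicit Types (s w z : C).

Lemma gexp_cauchy (s k : R) : 0 < s -> 0 < k ->
  exists2 K : R, 0 <= K & forall t : R, expR (s * t - k * expR t) <= K * (1 + t ^+ 2)^-1.
Proof.
move=> s0 k0; pose q := (s + 1) / k; pose C0 := (s + 1) * (ln q - 1).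
have q0 : 0 < q by rewrite divr_gt0// addr_gt0.
apply: (@exp2_cauchy R _ s 1 (1 + expR C0)) => // t.
- apply: (@le_trans _ _ (expR (s * t))).
    by rewrite ler_expR gerBl mulr_ge0 ?expR_ge0// ltW.
  by rewrite ler_peMl ?expR_ge0// lerDl expR_ge0.
- apply: (@le_trans _ _ (expR C0 * expR (- (1 * t)))); last first.
    by rewrite ler_wpM2r ?expR_ge0// lerDr.
  rewrite -expRD ler_expR mul1r.
  have h := expR_ge1Dx (t - ln q); rewrite expRB lnK// in h.
  have h2 : (s + 1) * (1 + (t - ln q)) <= (s + 1) * (expR t / q).
    by rewrite ler_wpM2l// ltW// addr_gt0.
  have E : (s + 1) * (expR t / q) = k * expR t.
    by rewrite /q; field; rewrite !gt_eqF// addr_gt0.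
  by rewrite E in h2; rewrite /C0; lra.
Qed.

Definition mell s w (t : R) : C := cexp (s * t%:C - cexp (t%:C + w)).

Lemma nc_mell s w t :
  nc (mell s w t) = expR (Re s * t - expR (Re w) * cos (Im w) * expR t).
Proof.
rewrite nc_cexp cReD cReN cexpE cReM cReD cImD cReC cImC mulr0 subr0 add0r.
by congr (expR (_ - _)); rewrite expRD; ring.
Qed.

Lemma cder_mell s w t : cder (mell s w) t ((s - cexp (t%:C + w)) * mell s w t).
Proof.
apply: cder_cexp; apply: cderB.
  by rewrite -[X in cder _ _ X]mulr1; apply: cderZ; exact: cder_id.
rewrite -[X in cder _ _ X]mul1r; apply: cder_cexp.
by rewrite -[X in cder _ _ X]addr0; apply: cderD (cder_id _) (cder_cst _ _).
Qed.

Lemma mell_cauchy s w : 0 < Re s -> 0 < cos (Im w) ->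
  exists2 K : R, 0 <= K & forall t, nc (mell s w t) <= K * (1 + t ^+ 2)^-1.
Proof.
move=> s0 w0; have [K K0 hK] := gexp_cauchy s0 (mulr_gt0 (expR_gt0 (Re w)) w0).
by exists K => // t; rewrite nc_mell.
Qed.

Lemma mell_cdiff s w t : cdiff (mell s w) t.
Proof. by eexists; exact: cder_mell. Qed.

Lemma mell_int s w : 0 < Re s -> 0 < cos (Im w) -> cintg (mell s w).
Proof.
move=> s0 w0; have [K K0 hK] := mell_cauchy s0 w0.
by apply: cintg_majorant hK; apply: cdiff_meas => t; exact: mell_cdiff.
Qed.

Lemma cdiff_ln (x : R) : 0 < x -> cdiff (fun x => (ln x)%:C : C) x.
Proof. by move=> x0; exists (x^-1)%:C; apply: cder_real; exact: is_derive1_ln. Qed.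

Lemma CGamma_int s : 0 < Re s -> CGamma s = cint (mell s 0).
Proof.
move=> s0; rewrite /CGamma.
have E : (fun x => (expR x)%:C * cexp ((s - 1) * (ln (expR x))%:C - (expR x)%:C)) = mell s 0.
  by apply/funext => x; rewrite expRK -cexp_real -cexpD /mell addr0 cexp_real; congr cexp; ring.
have [||_ ->] := @csubst_exp R (fun t : R => cexp ((s - 1) * (ln t)%:C - t%:C)).
- move=> x x0; apply: cdiff_cexp; apply: cdiffD.
    by apply: cdiffM; [exact: cdiff_cst|exact: cdiff_ln].
  by apply: cdiffN; exact: cdiff_id.
- by rewrite E; apply: mell_int => //; rewrite cos0.
by rewrite E.
Qed.

(* Rotation of the ray of integration in Euler's integral. *)
Lemma mell_rot s (th : R) : 0 < Re s -> - (pi / 2) < th < pi / 2 ->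
  cint (fun t => cexp (s * pt t th - cexp (pt t th))) = CGamma s.
Proof.
move=> s0 /andP[h1 h2].
pose v := (Num.max `|th| 0 + pi / 2) / 2.
have pi20 : 0 < (pi : R) / 2 by rewrite divr_gt0 ?pi_gt0.
have thp : `|th| < pi / 2 by rewrite ltr_norml h1.
have thv : `|th| < v by rewrite /v (max_idPl (normr_ge0 _)); lra.
have v0 : 0 < v by rewrite (le_lt_trans _ thv).
have vp : v < pi / 2 by rewrite /v (max_idPl (normr_ge0 _)); lra.
pose k : R := cos v; have k0 : 0 < k by apply: cos_gt0_pihalf; rewrite vp (lt_trans _ v0)// oppr_lt0.
have kp p : - v < p < v -> k <= cos p.
  move=> hp; rewrite -(cos_norm p).
  have pv : `|p| <= v by rewrite ltW// ltr_norml.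
  have pi0 := pi_gt0 R; rewrite /k leNgt ltr_cos ?in_itv /= ?normr_ge0 ?(ltW v0) -?leNgt//=; lra.
pose E p t := cexp (s * pt t p - cexp (pt t p)).
pose E1 p t := (s - cexp (pt t p)) * E p t.
have dt p t : cder (E p) t (E1 p t).
  apply: cder_cexp; apply: cderB.
    by rewrite -[X in cder _ _ X]mulr1; apply: cderZ; exact: cder_pt_p.
  by rewrite -[X in cder _ _ X]mul1r; apply: cder_cexp; exact: cder_pt_p.
have dp p t : cder (fun q => E q t) p (ii * E1 p t).
  apply: cder_eq.
    apply: cder_cexp; apply: cderB; first by apply: cderZ; exact: cder_pt_t.
    by apply: cder_cexp; exact: cder_pt_t.
  by rewrite /E1 /E /=; ring.
pose A := expR (`|Im s| * v).
have nE p t : - v < p < v -> nc (E p t) <= A * expR (Re s * t - k * expR t).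
  move=> hp; rewrite nc_cexp cReD cReN cReM Re_cexp Re_pt Im_pt -expRD ler_expR.
  have q1 : k * expR t <= expR t * cos p by rewrite mulrC ler_wpM2l ?expR_ge0 ?kp.
  have q2 : - (Im s * p) <= `|Im s| * v.
    rewrite (le_trans (ler_norm _))// normrN normrM ler_wpM2l// ltW//.
    by rewrite ltr_norml.
  lra.
have [K1 K10 hK1] := gexp_cauchy s0 k0.
have s1 : 0 < Re s + 1 by rewrite addr_gt0.
have [K2 K20 hK2] := gexp_cauchy s1 k0.
have A0 : 0 <= A := expR_ge0 _.
pose K := A * (K1 + nc s * K1 + K2).
have c0 t : 0 <= (1 + t ^+ 2)^-1 :> R by rewrite invr_ge0 addr_ge0 ?sqr_ge0.
have n0 := nc_ge0 s.
have hE p t : - v < p < v -> nc (E p t) <= K * (1 + t ^+ 2)^-1.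
  move=> hp; rewrite (le_trans (nE p t hp))// /K -mulrA ler_wpM2l// (le_trans (hK1 t))//.
  by rewrite ler_wpM2r// -addrA lerDl addr_ge0// mulr_ge0.
have hE1 p t : - v < p < v -> nc (E1 p t) <= K * (1 + t ^+ 2)^-1.
  move=> hp; rewrite ncM.
  have h3 : nc (s - cexp (pt t p)) <= nc s + expR t.
    by rewrite (le_trans (ncB _ _))// nc_cexp Re_pt.
  have e0 := nc_ge0 (E p t); have e1 := expR_ge0 t.
  have n1 : 0 <= nc s + expR t by rewrite addr_ge0.
  rewrite (le_trans (ler_wpM2r e0 h3))// (le_trans (ler_wpM2l n1 (nE p t hp)))//.
  rewrite mulrCA /K -mulrA ler_wpM2l// mulrDl !mulrDl.
  have q2 : expR t * expR (Re s * t - k * expR t) <= K2 / (1 + t ^+ 2).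
    rewrite -expRD (_ : t + _ = (Re s + 1) * t - k * expR t); first exact: hK2.
    by ring.
  have q1 : nc s * expR (Re s * t - k * expR t) <= nc s * K1 / (1 + t ^+ 2).
    by rewrite -mulrA ler_wpM2l.
  have q3 : 0 <= K1 / (1 + t ^+ 2) by rewrite mulr_ge0.
  by lra.
have p0 : - v < 0 < v by rewrite v0 oppr_lt0 v0.
have pth : - v < th < v by rewrite -ltr_norml.
rewrite (@cint_shift R E E1 ii (- v) v K _ _ _ _ _ th 0)//.
- rewrite CGamma_int//; congr cint; apply/funext => t.
  by rewrite /E /mell /pt mulr0 addr0.
- move=> p t _; apply: cdiffM; last by eexists; exact: dt.
  by apply: cdiffD; [exact: cdiff_cst|apply: cdiffN; apply: cdiff_cexp; eexists; exact: cder_pt_p].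
Qed.

Lemma cint_translate (b : R) (E : R -> C) : (forall x, cdiff E x) -> cintg E ->
  cint (fun x => E (x + b)) = cint E.
Proof.
move=> dE iE; have [_] := caff_pos b ltr01 dE iE.
by under eq_fun do rewrite mul1r; rewrite mul1r.
Qed.

Lemma mellE s w : 0 < Re s -> - (pi / 2) < Im w < pi / 2 ->
  cint (mell s w) = CGamma s * cexp (- (s * w)).
Proof.
move=> s0 hw; have cw : 0 < cos (Im w) by exact: cos_gt0_pihalf.
have cw' : 0 < cos (Im (ii * (Im w)%:C)) by csimp; rewrite ?mul1r ?mul0r ?mulr0 ?addr0 ?add0r.
rewrite -(mell_rot s0 hw).
have E t : cexp (s * pt t (Im w) - cexp (pt t (Im w))) =
    cexp (s * (ii * (Im w)%:C)) * mell s (ii * (Im w)%:C) t.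
  by rewrite /mell -cexpD -/(pt t (Im w)); congr cexp; rewrite /pt; ring.
under eq_fun do rewrite E.
rewrite cintZ; last exact: mell_int.
rewrite -(@cint_translate (Re w) (mell s (ii * (Im w)%:C))); last 2 first.
- by move=> x; exact: mell_cdiff.
- exact: mell_int.
have E2 t : mell s w t = cexp (- (s * (Re w)%:C)) * mell s (ii * (Im w)%:C) (t + Re w).
  rewrite /mell -cexpD realCD -addrA -/(pt (Re w) (Im w)) ptE; congr cexp; ring.
rewrite (funext E2) cintZ; last first.
  have h := caff_pos (Re w) ltr01 (fun x => mell_cdiff s _ x) (mell_int s0 cw').
  by have := h.1; under eq_fun do rewrite mul1r.
rewrite [RHS]mulrAC -cexpD; congr (cexp _ * _).
rewrite [X in _ - s * X](_ : w = (Re w)%:C + ii * (Im w)%:C); first by ring.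
by rewrite -[LHS]ptE.
Qed.

End Mellin.

Lemma cmeas_integral d1 d2 (T1 : measurableType d1) (T2 : measurableType d2) (R : realType)
  (m1 : {sigma_finite_measure set T1 -> \bar R}) (m2 : {sigma_finite_measure set T2 -> \bar R})
  (v : T1 -> R) (k : T2 -> Cplx R) (e : T1 * T2 -> Cplx R) (B : R) :
  measurable_fun setT v -> (forall x, 0 < v x) -> rintg m1 (fun x => (v x)^-1) ->
  Cintegrable m2 setT k -> cmeas e ->
  (forall p, nc (e p) <= B) -> cmeas (fun x => Cintegral m2 setT (fun y => k y * e (x, y))).
Proof.
move=> mv v0 hn hk me eB.
have hn' : Cintegrable m1 setT (fun x => ((v x)^-1)%:C : Cplx R).
  apply: (cintg_dom _ _ hn); first by apply: cmeas_real; exact: rintg_meas hn.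
  by move=> x; rewrite nc_real gtr0_norm// invr_gt0.
have [h _ _] := cfubini_kernel hn' hk me eB.
have E x : Cintegral m2 setT (fun y => k y * e (x, y)) =
    (v x)%:C * (((v x)^-1)%:C * Cintegral m2 setT (fun y => k y * e (x, y))).
  by rewrite mulrA -realCM mulfV ?realC1 ?mul1r// gt_eqF.
by rewrite (funext E); apply: cmeasM; [exact: cmeas_real|exact: cintg_meas h].
Qed.

Section MellinBarnes.
Context (R : realType).
Local Notation C := (Cplx R).
Local Notation leb := (@lebesgue_measure R).
Local Notation cintg := (Cintegrable leb setT).
Local Notation cint := (Cintegral leb setT).
Implicit Types (s w z u : C).

Lemma Gamma_bnd (c th : R) : 0 < c -> 0 <= th < pi / 2 ->
  exists2 K : R, 0 <= K & forall s, Re s = c -> nc (CGamma s) <= K * expR (- (th * `|Im s|)).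
Proof.
move=> c0 /andP[th0 thp].
have cth : 0 < cos th by apply: cos_gt0_pihalf; rewrite thp andbT (lt_le_trans _ th0)// oppr_lt0 (le_lt_trans th0).
have [K K0 hK] := gexp_cauchy c0 cth.
exists (K * pi); first by rewrite mulr_ge0 ?pi_ge0.
move=> s sc; have s0 : 0 < Re s by rewrite sc.
pose y := if 0 <= Im s then th else - th.
have cy : cos y = cos th by rewrite /y; case: ifP; rewrite ?cosN.
have ys : Im s * y = th * `|Im s|.
  by rewrite /y; case: ifP => [h|/negbT]; [rewrite ger0_norm// mulrC|rewrite -ltNge => h; rewrite ltr0_norm//; ring].
pose w : C := ii * y%:C.
have Rw : Re w = 0 by rewrite /w; csimp; ring.
have Iw : Im w = y by rewrite /w; csimp; ring.
have hw : - (pi / 2) < Im w < pi / 2.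
  by rewrite Iw /y; case: ifP => _; apply/andP; split; lra.
have h : nc (cint (mell s w)) <= K * pi.
  apply: cint_bnd; first by apply: cdiff_meas => t; exact: mell_cdiff.
  by move=> t; rewrite nc_mell Rw expR0 mul1r Iw cy sc.
rewrite mellE// ncM nc_cexp cReN cReM Rw Iw mulr0 sub0r opprK ys in h.
by rewrite expRN ler_pdivlMr ?expR_gt0.
Qed.

Lemma cmeas_kernel (k : R -> C) (e : R * R -> C) (B : R) : cintg k -> cmeas e ->
  (forall p, nc (e p) <= B) -> cmeas (fun x => cint (fun y => k y * e (x, y))).
Proof.
apply: (cmeas_integral (m1 := leb) (v := fun x : R => 1 + x ^+ 2)); last exact: rintg_cauchy.
  by apply: measurable_funD => //; exact: measurable_funX.
by move=> x; rewrite ltr_pwDl// sqr_ge0.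
Qed.

Lemma cmeas_phase (al : R) : cmeas (fun p : R * R => cexp (ii * (al * (p.1 * p.2))%:C) : C).
Proof.
apply: cmeas_cexp; apply: cmeasM; first exact: cmeas_cst.
by apply: cmeas_real; apply: measurable_funM => //; exact: measurable_funM.
Qed.

Lemma Gamma_meas (c : R) : 0 < c -> cmeas (fun t => CGamma (c +i* t : C)).
Proof.
move=> c0; have E t : CGamma (c +i* t : C) =
    cint (fun y => mell (c%:C) 0 y * cexp (ii * (1 * (t * y))%:C)).
  rewrite CGamma_int//; congr cint; apply/funext => y.
  by rewrite /mell -cexpD mkCE !realCM; congr cexp; ring.
rewrite (funext E); apply: (@cmeas_kernel (mell c%:C 0) (fun p => cexp (ii * (1 * (p.1 * p.2))%:C)) 1).
- by apply: mell_int => //; rewrite cos0.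
- exact: cmeas_phase.
- by move=> p; rewrite nc_cexp_i.
Qed.

Lemma Gamma_meas_aff (be : C) (al c : R) : 0 < Re be - al * c ->
  cmeas (fun t : R => CGamma (be - al%:C * (c +i* t))).
Proof.
move=> h.
have E (t : R) : be - al%:C * (c +i* t) = (Re be - al * c) +i* (Im be - al * t) :> C.
  by apply: complex_ext; csimp.
rewrite (funext (fun t => congr1 _ (E t))).
apply: (@cmeas_comp _ _ _ _ R (fun t => CGamma ((Re be - al * c) +i* t)) (fun t => Im be - al * t)).
  by apply: measurable_funB => //; exact: measurable_funM.
exact: Gamma_meas.
Qed.

Lemma Gamma_mell_bnd (c : R) w : 0 < c -> - (pi / 2) < Im w < pi / 2 ->
  exists2 K : R, 0 <= K & forall t,
    nc (CGamma (c +i* t) * cexp (- ((c +i* t) * w))) <= K * (1 + t ^+ 2)^-1.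
Proof.
move=> c0; rewrite -ltr_norml => hw.
pose th := (`|Im w| + pi / 2) / 2.
have n0 := normr_ge0 (Im w).
have hth : 0 <= th < pi / 2 by rewrite /th; apply/andP; split; lra.
have d0 : 0 < th - `|Im w| by rewrite /th; lra.
clearbody th.
have [K1 K10 h1] := Gamma_bnd c0 hth; have [K2 K20 h2] := exp_cauchy d0.
exists (K1 * expR (- (c * Re w)) * K2); first by rewrite !mulr_ge0 ?expR_ge0.
move=> t; rewrite ncM nc_cexp.
have h := h1 (c +i* t) erefl.
rewrite (le_trans (ler_wpM2r (expR_ge0 _) h))//=.
rewrite -!(mulrA K1) ler_wpM2l// -[expR _ * K2 / _]mulrA (le_trans _ (ler_wpM2l (expR_ge0 _) (h2 t)))//.
rewrite -!expRD ler_expR; csimp.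
have : t * Im w <= `|t| * `|Im w| by rewrite -normrM ler_norm.
lra.
Qed.

Lemma Gamma_mell_meas (c : R) w : 0 < c ->
  cmeas (fun t => CGamma (c +i* t) * cexp (- ((c +i* t) * w))).
Proof.
move=> c0; apply: cmeasM; first exact: Gamma_meas.
apply: cmeas_cexp; apply: cmeasN; apply: cmeasM; last exact: cmeas_cst.
by apply: cmeas_mk.
Qed.

Lemma Gamma_mell_int (c : R) w : 0 < c -> - (pi / 2) < Im w < pi / 2 ->
  cintg (fun t => CGamma (c +i* t) * cexp (- ((c +i* t) * w))).
Proof.
move=> c0 hw; have [K K0 hK] := Gamma_mell_bnd c0 hw.
by apply: cintg_majorant hK; exact: Gamma_mell_meas.
Qed.

Lemma mellin_inversion (c : R) w : 0 < c -> - (pi / 2) < Im w < pi / 2 ->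
  cint (fun t => CGamma (c +i* t) * cexp (- ((c +i* t) * w))) =
  (2 * pi)%:C * cexp (- cexp w).
Proof.
move=> c0 hw; have cw : 0 < cos (Im w) by exact: cos_gt0_pihalf.
have [K K0 hK] := @mell_cauchy R c%:C w c0 cw.
have [K' K'0 hK'] := Gamma_mell_bnd c0 hw.
pose fh (t : R) := CGamma (c +i* - t) * cexp (- ((c +i* - t) * w)).
have mN : measurable_fun setT (fun t : R => - t) by exact: measurableT_comp.
have := @fourier_inversion R (mell c%:C w) fh K K' (mell_cdiff c%:C w)
  (cmeas_comp mN (Gamma_mell_meas w c0)) hK.
have -> : cexp (- cexp w) = mell c%:C w 0 by rewrite /mell mulr0 sub0r add0r.
move=> /(_ _ _ 0) ->.
- have h := Gamma_mell_int c0 hw; rewrite -(cneg h).2; congr cint; apply/funext => t.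
  by rewrite mulr0 mulr0 cexp0 mulr1.
- move=> t; rewrite /fh -mellE//; congr cint; apply/funext => y.
  by rewrite /mell -cexpD mkCE !realCM realCN; congr cexp; ring.
- by move=> t; rewrite -[t ^+ 2]sqrrN; exact: hK'.
Qed.

End MellinBarnes.

Section MellinBarnesKernel.
Context (R : realType).
Local Notation C := (Cplx R).
Local Notation leb := (@lebesgue_measure R).
Local Notation cintg := (Cintegrable leb setT).
Local Notation cint := (Cintegral leb setT).
Implicit Types (s w z u : C).

Definition LLfun (c al : R) be w z (t : R) : C :=
  CGamma (c +i* t) * CGamma (be - al%:C * (c +i* t)) *
  cexp (- ((c +i* t) * (w - al%:C * cln z))).

Definition LLdual (al : R) be w z (t : R) : C :=
  mell be (cln z) t * cexp (- cexp (w + (al * t)%:C)).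

Lemma LL_interior (c al : R) be w z : 0 < Re z -> 0 < c -> 0 < Re be - al * c -> 0 < Re be ->
  - (pi / 2) < Im w < pi / 2 ->
  cint (LLfun c al be w z) = (2 * pi)%:C * (cexp (be * cln z) * cint (LLdual al be w z)).
Proof.
move=> z0 c0 bc b0 hw; have hz := Im_cln z0; have cz : 0 < cos (Im (cln z)) by exact: cos_gt0_pihalf.
have cw : 0 <= cos (Im w) by apply/ltW/cos_gt0_pihalf.
pose b1 : C := be - (al * c)%:C.
have b10 : 0 < Re b1 by rewrite /b1; csimp.
pose n t := CGamma (c +i* t) * cexp (- ((c +i* t) * w)).
pose k := mell b1 (cln z).
pose e (p : R * R) : C := cexp (ii * (- al * (p.1 * p.2))%:C).
have hn : cintg n by exact: Gamma_mell_int.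
have hk : cintg k by exact: mell_int.
have eB p : nc (e p) <= 1 by rewrite nc_cexp_i.
have [h1 h2 h3] := cfubini_kernel (B := 1) hn hk (cmeas_phase (- al)) eB.
have E1 t : LLfun c al be w z t = cexp (be * cln z) * (n t * cint (fun y => k y * e (t, y))).
  have -> : cint (fun y => k y * e (t, y)) = cint (mell (be - al%:C * (c +i* t)) (cln z)).
    congr cint; apply/funext => y; rewrite /k /mell /e -cexpD mkCE !realCM realCN /b1 realCM /=.
    by congr cexp; ring.
  have r0 : 0 < Re (be - al%:C * (c +i* t)) by rewrite cReD cReN cReMr.
  rewrite (mellE r0 hz).
  rewrite /LLfun /n.
  have -> : cexp (- ((c +i* t) * (w - al%:C * cln z))) =
    cexp (be * cln z) * (cexp (- ((c +i* t) * w)) * cexp (- ((be - al%:C * (c +i* t)) * cln z))).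
    by rewrite -!cexpD; congr cexp; ring.
  by ring.
rewrite (funext E1) (cintZ _ h1) h3.
rewrite [RHS]mulrCA; congr (_ * _).
rewrite -cintZ; last first.
  rewrite /LLdual; under eq_fun do rewrite mulrC.
  apply: (@cintgMbnd _ _ _ _ _ _ 1); last exact: mell_int.
    apply: cmeas_cexp; apply: cmeasN; apply: cmeas_cexp; apply: cmeasD; first exact: cmeas_cst.
    by apply: cmeas_real; exact: measurable_funM.
  move=> t; rewrite nc_cexp cReN cexpE -expR0 ler_expR oppr_le0; csimp.
  by rewrite addr0 mulr_ge0 ?expR_ge0.
congr cint; apply/funext => y.
have -> : (fun x => n x * e (x, y)) =
  (fun x => cexp ((al * c * y)%:C) * (CGamma (c +i* x) * cexp (- ((c +i* x) * (w + (al * y)%:C))))).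
  apply/funext => x; rewrite /n /e /=.
  have -> : cexp (- ((c +i* x) * (w + (al * y)%:C))) =
    cexp (- (al * c * y)%:C) * (cexp (- ((c +i* x) * w)) * cexp (ii * (- al * (x * y))%:C)).
    by rewrite -!cexpD mkCE !realCM realCN; congr cexp; ring.
  have q : cexp (al * c * y)%:C * cexp (- (al * c * y)%:C) = 1 :> C by rewrite -cexpD subrr cexp0.
  by rewrite -[LHS]mul1r -q; ring.
have hwy : - (pi / 2) < Im (w + (al * y)%:C) < pi / 2 by csimp; rewrite addr0.
rewrite cintZ; last exact: Gamma_mell_int.
rewrite (mellin_inversion c0 hwy) /LLdual.
have -> : mell be (cln z) y = k y * cexp ((al * c * y)%:C).
  by rewrite /k /mell -cexpD /b1 !realCM; congr cexp; ring.
by ring.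
Qed.

Lemma LLdual_bnd (al : R) be w z : 0 <= cos (Im w) -> forall t,
  nc (LLdual al be w z t) <= nc (mell be (cln z) t).
Proof.
move=> cw t; rewrite ncM ler_piMr ?nc_ge0// nc_cexp cReN cexpE -expR0 ler_expR oppr_le0; csimp.
by rewrite addr0 mulr_ge0 ?expR_ge0.
Qed.

Lemma LLdual_meas (al : R) be w z : cmeas (LLdual al be w z).
Proof.
apply: cmeasM; first by apply: cdiff_meas => t; exact: mell_cdiff.
apply: cmeas_cexp; apply: cmeasN; apply: cmeas_cexp; apply: cmeasD; first exact: cmeas_cst.
by apply: cmeas_real; exact: measurable_funM.
Qed.

Lemma LLfun_meas (c al : R) be w z : 0 < c -> 0 < Re be - al * c -> cmeas (LLfun c al be w z).
Proof.
move=> c0 bc; apply: cmeasM; first by apply: cmeasM; [exact: Gamma_meas|exact: Gamma_meas_aff].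
apply: cmeas_cexp; apply: cmeasN; apply: cmeasM; last exact: cmeas_cst.
exact: cmeas_mk.
Qed.

Lemma LLfun_bnd (c al r : R) be z : al != 0 -> 0 < Re z -> 0 < c -> 0 < Re be - al * c ->
  exists2 K : R, 0 <= K & forall w t, Re w = r -> `|Im w| <= pi / 2 ->
    nc (LLfun c al be w z t) <= K * (1 + t ^+ 2)^-1.
Proof.
move=> al0 z0 c0 bc; have := Im_cln z0; rewrite -ltr_norml; set A := `|Im (cln z)| => hA.
have A0 : 0 <= A by exact: normr_ge0.
have pi0 := pi_gt0 R.
have na : 0 < `|al| by rewrite normr_gt0.
pose th2 := (A + pi / 2) / 2; pose d := `|al| * (th2 - A).
have hth2 : 0 <= th2 < pi / 2 by rewrite /th2; apply/andP; split; lra.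
have d0 : 0 < d by rewrite /d mulr_gt0// /th2; lra.
pose m := Num.min (d / 2) (pi / 4).
have m0 : 0 < m by rewrite lt_min divr_gt0//= divr_gt0.
have m1 : m <= d / 2 by rewrite ge_min lexx.
have m2 : m <= pi / 4 by rewrite ge_min lexx orbT.
pose th1 := pi / 2 - m.
have hth1 : 0 <= th1 < pi / 2 by rewrite /th1; apply/andP; split; lra.
have [K1 K10 h1] := Gamma_bnd c0 hth1; have [K2 K20 h2] := Gamma_bnd bc hth2.
have d2 : 0 < d / 2 by rewrite divr_gt0.
have [K3 K30 h3] := exp_cauchy d2.
pose L := th2 * `|Im be| - c * r + al * (c * Re (cln z)).
exists (K1 * K2 * expR L * K3); first by rewrite !mulr_ge0 ?expR_ge0.
move=> w t wr hw.
have e1 := h1 (c +i* t) erefl.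
have e2 : nc (CGamma (be - al%:C * (c +i* t))) <= K2 * expR (- (th2 * `|Im be - al * t|)).
  have -> : Im be - al * t = Im (be - al%:C * (c +i* t)) by csimp.
  by apply: h2; csimp.
rewrite /LLfun !ncM nc_cexp -[K1 * K2 * _ * _]mulrA -[K1 * K2 * _ / _]mulrA -[expR L * K3 / _]mulrA.
apply: (@le_trans _ _ (K1 * expR (- (th1 * `|t|)) * (K2 * expR (- (th2 * `|Im be - al * t|))) *
   expR (Re (- ((c +i* t) * (w - al%:C * cln z)))))).
  rewrite ler_wpM2r ?expR_ge0// ler_pM ?nc_ge0//.
rewrite mulrACA -[X in X <= _]mulrA ler_wpM2l ?mulr_ge0//.
apply: le_trans (ler_wpM2l (expR_ge0 L) (h3 t)).
rewrite -!expRD ler_expR cReN cReM cReD cReN cReMr cImD cImN cImMr /= wr -?Im_clnE -?Re_cln.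
have q1 : t * Im w <= `|t| * (pi / 2).
  by rewrite (le_trans (ler_norm _))// normrM ler_wpM2l.
have q2 : - (al * (t * Im (cln z))) <= `|al| * (`|t| * A).
  by rewrite (le_trans (ler_norm _))// normrN !normrM.
have q3 : `|al| * `|t| - `|Im be| <= `|Im be - al * t|.
  by rewrite -normrM distrC (le_trans _ (lerB_dist _ _)).
have q4 : th2 * (`|al| * `|t| - `|Im be|) <= th2 * `|Im be - al * t|.
  by apply: ler_wpM2l q3; case/andP: hth2.
have q5 : m * `|t| <= d / 2 * `|t| by rewrite ler_wpM2r.
have q6 : d * `|t| = th2 * `|al| * `|t| - `|al| * (`|t| * A) by rewrite /d; ring.
rewrite /th1 /L; clearbody th2 d m.
lra.
Qed.

Lemma LL_closed (c al : R) be w z : al != 0 -> 0 < Re z -> 0 < c -> 0 < Re be - al * c ->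
  0 < Re be -> - (pi / 2) <= Im w <= pi / 2 ->
  cint (LLfun c al be w z) = (2 * pi)%:C * (cexp (be * cln z) * cint (LLdual al be w z)).
Proof.
move=> al0 z0 c0 bc b0; rewrite -ler_norml => hw.
have pi0 := pi_gt0 R.
have cz : 0 < cos (Im (cln z)) by apply: cos_gt0_pihalf; exact: Im_cln.
pose W (x : R) : C := pt (Re w) (x * Im w).
have Wc x : cdiff W x.
  apply: cdiffD; first exact: cdiff_cst.
  apply: cdiffM; first exact: cdiff_cst.
  by apply: cdiff_real; apply: derivableM => //; exact: derivable_cst.
have W1 : W 1 = w by rewrite /W mul1r ptE.
pose x_ (n : nat) : R := 1 - n.+1%:R^-1.
have x1 : x_ n @[n --> \oo] --> (1 : R).
  by rewrite -[X in _ --> X]subr0; apply: cvgB; [exact: cvg_cst|exact: cvg_invS].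
have xb n : 0 <= x_ n < 1.
  by rewrite /x_ subr_ge0 invf_le1// ler1n /= ltrBlDr ltrDl invr_gt0.
have hW x : 0 <= x <= 1 -> `|Im (W x)| <= pi / 2.
  move=> /andP[xp xl]; rewrite /W Im_pt normrM ger0_norm// (le_trans _ hw)//.
  by rewrite ler_piMl.
have hWn n : - (pi / 2) < Im (W (x_ n)) < pi / 2.
  have /andP[xp xl] := xb n.
  rewrite -ltr_norml /W Im_pt normrM ger0_norm// (@le_lt_trans _ _ (x_ n * (pi / 2)))//.
    by rewrite ler_wpM2l.
  by rewrite gtr_pMl// divr_gt0.
have h0 : 0 <= (0 : R) <= 1 by rewrite lexx ler01.
have h1 : 0 <= (1 : R) <= 1 by rewrite lexx ler01.
have hx n : 0 <= x_ n <= 1 by have /andP[-> /ltW] := xb n.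
have [K K0 hK] := LLfun_bnd (Re w) al0 z0 c0 bc.
have cvL : nc (cint (LLfun c al be (W (x_ n)) z) - cint (LLfun c al be (W 1) z)) @[n --> \oo] --> (0 : R).
  apply: (@cdct _ _ R leb _ _ (fun t => K * (1 + t ^+ 2)^-1)).
  - by move=> n; exact: LLfun_meas.
  - exact: LLfun_meas.
  - by move=> n t; apply: hK; rewrite ?Re_pt//; exact: hW.
  - by move=> t; apply: hK; rewrite ?Re_pt//; exact: hW.
  - by apply: rintgZ; exact: rintg_cauchy.
  - move=> t; apply: (@ccvg R (fun x => LLfun c al be (W x) z t) 1 x_) x1.
    apply: cdiffM; first exact: cdiff_cst.
    apply: cdiff_cexp; apply: cdiffN; apply: cdiffM; first exact: cdiff_cst.
    by apply: cdiffD (Wc _) (cdiff_cst _ _).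
have [K' K'0 hK'] := @mell_cauchy R be (cln z) b0 cz.
have cW x : 0 <= x <= 1 -> 0 <= cos (Im (W x)).
  move=> hx'; have := hW x hx'; rewrite ler_norml => h.
  exact: cos_ge0_pihalf.
have cvD : nc (cint (LLdual al be (W (x_ n)) z) - cint (LLdual al be (W 1) z)) @[n --> \oo] --> (0 : R).
  apply: (@cdct _ _ R leb _ _ (fun t => K' * (1 + t ^+ 2)^-1)).
  - by move=> n; exact: LLdual_meas.
  - exact: LLdual_meas.
  - by move=> n t; apply: le_trans (hK' t); apply: LLdual_bnd; exact: cW.
  - by move=> t; apply: le_trans (hK' t); apply: LLdual_bnd; exact: cW.
  - by apply: rintgZ; exact: rintg_cauchy.
  - move=> t; apply: (@ccvg R (fun x => LLdual al be (W x) z t) 1 x_) x1.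
    apply: cdiffM; first exact: cdiff_cst.
    apply: cdiff_cexp; apply: cdiffN; apply: cdiff_cexp.
    by apply: cdiffD (Wc _) (cdiff_cst _ _).
rewrite -W1; apply: nc_cvg_unique cvL _.
set q := (2 * pi)%:C; set b := cexp (be * cln z).
apply: (@nc_cvg0 _ _ (fun n => nc (q * b) * nc (cint (LLdual al be (W (x_ n)) z) - cint (LLdual al be (W 1) z)))).
- by move=> n; exact: nc_ge0.
- by move=> n; rewrite LL_interior// -/q -/b -ncM mulrBr !mulrA.
- by rewrite -[X in _ --> X](mulr0 (nc (q * b))); apply: cvgM cvD; exact: cvg_cst.
Qed.

Lemma cexp_conj z : cexp (conjc z) = conjc (cexp z).
Proof. by apply: complex_ext; rewrite !cexpE !(cReJ, cImJ, cexpE) ?cosN ?sinN ?mulrN. Qed.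

Definition kz be z (t : R) : C := cexp (be * t%:C - z * (expR t)%:C).
Definition ray (al a t : R) : R := expR (al * t + ln a).

Lemma LL_val (c al a : R) be z u : al != 0 -> 0 < a -> 0 < Re z -> 0 <= Re u -> u != 0 ->
  0 < c -> 0 < Re be - al * c -> 0 < Re be ->
  LL c al be (log_arg al a z u) =
  cexp (be * cln z) * cint (fun t => kz be z t * cexp (- (conjc u * (ray al a t)%:C))).
Proof.
move=> al0 a0 z0 u0 un c0 bc b0.
have zn : z != 0 by apply: contraTneq z0 => ->; rewrite ltxx.
pose w : C := conjc (cln u) + (ln a)%:C.
have hw : - (pi / 2) <= Im w <= pi / 2.
  rewrite /w; csimp; rewrite addr0 lerN2 lerNl -?Im_clnE Im_clnE.
  have hi : -1 <= Im u / nc u <= 1.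
    have n0 : 0 < nc u by rewrite nc_gt0.
    have := nc_Im u; rewrite ler_norml => /andP[i1 i2].
    by rewrite ler_pdivrMr// ler_pdivlMr// mulN1r mul1r i1.
  by rewrite asin_lepi2// asin_geNpi2.
have := LL_closed al0 z0 c0 bc b0 hw.
rewrite /LL -/w => E; rewrite [X in _ * X](_ : _ = cint (LLfun c al be w z)); last by [].
rewrite E mulrA pi2V mul1r; congr (_ * cint _); apply/funext => t.
rewrite /LLdual /mell /kz; congr (cexp (_ - _) * cexp (- _)).
  by rewrite cexpD cexp_real cexp_cln ?(ltW z0)// mulrC.
by rewrite /w -addrA cexpD cexp_conj cexp_cln// -realCD cexp_real addrC.
Qed.

End MellinBarnesKernel.

(** * The kernel form of the operators *)

Section Restriction.
Context d (T : measurableType d) (R : realType) (m : {measure set T -> \bar R}).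
Local Notation C := (Cplx R).

Definition cut (D : set T) (f : T -> C) (x : T) : C := if x \in D then f x else 0.

Lemma Cintegral_cut D f : Cintegral m D f = Cintegral m setT (cut D f).
Proof.
apply: complex_ext; rewrite /Cintegral /= Rintegral_mkcond; apply: eq_Rintegral => x _;
  by rewrite patchE /cut; case: ifP.
Qed.

Lemma Cintegrable_cut D f : measurable D ->
  Cintegrable m D f <-> Cintegrable m setT (cut D f).
Proof.
move=> mD.
have Er : (fun x => (Re (f x))%:E) \_ D = (fun x => (Re (cut D f x))%:E).
  by apply/funext => x; rewrite patchE /cut; case: ifP.
have Ei : (fun x => (Im (f x))%:E) \_ D = (fun x => (Im (cut D f x))%:E).
  by apply/funext => x; rewrite patchE /cut; case: ifP.
have h1 := @integrable_mkcond _ _ _ m D (fun x => (Re (f x))%:E) mD; rewrite Er in h1.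
have h2 := @integrable_mkcond _ _ _ m D (fun x => (Im (f x))%:E) mD; rewrite Ei in h2.
by split=> -[a b]; split; [exact/h1|exact/h2|exact/h1|exact/h2].
Qed.

Lemma cmeas_cut D f : measurable D -> cmeas f -> cmeas (cut D f).
Proof.
move=> mD mf; have -> : cut D f = fun x => (\1_D x)%:C * f x.
  by apply/funext => x; rewrite /cut indicE; case: ifP; rewrite ?mul1r ?mul0r.
by apply: cmeasM mf; apply: cmeas_real; exact: measurable_indic.
Qed.

Lemma cutZ D (k : C) f : cut D (fun x => k * f x) = fun x => k * cut D f x.
Proof. by apply/funext => x; rewrite /cut; case: ifP => // _; rewrite mulr0. Qed.

Lemma cutB D f g : cut D (fun x => f x - g x) = fun x => cut D f x - cut D g x.
Proof. by apply/funext => x; rewrite /cut; case: ifP => // _; rewrite subr0. Qed.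

Lemma cut_eq D f g : (forall x, D x -> f x = g x) -> cut D f = cut D g.
Proof. by move=> fg; apply/funext => x; rewrite /cut; case: ifP => // /set_mem/fg. Qed.

Lemma cut_id D f : (forall x, ~ D x -> f x = 0) -> cut D f = f.
Proof.
move=> f0; apply/funext => x; rewrite /cut; case: ifPn => // h.
by rewrite f0// => /mem_set; exact/negP.
Qed.

End Restriction.

Section Tools.
Context (R : realType).
Local Notation C := (Cplx R).
Local Notation leb := (@lebesgue_measure R).
Local Notation cintg := (Cintegrable leb setT).
Local Notation cint := (Cintegral leb setT).
Implicit Types (s w z u : C).

Lemma cint_neq0 (f g : R -> C) : (forall t, t != 0 -> f t = g t) -> cintg g ->
  cintg f /\ cint f = cint g.
Proof.
move=> fg hg.
pose i : R -> C := fun t => (\1_(`[0, 0] : set R) t)%:C.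
have hi : cintg i.
  have h := integrable_indic_itv (0 : R) 0 true false.
  apply: (cintg_dom _ _ h) => [|t].
    by apply: cmeas_real; exact: measurable_indic.
  by rewrite nc_real ger0_norm// indicE.
have i0 : cint i = 0.
  have e0 : (\int[leb]_x (\1_(`[0, 0] : set R) x)%:E = 0)%E.
    apply: (etrans (integral_indic leb measurableT _)) => //.
    by rewrite setIT set_itv1; exact: lebesgue_measure_set1.
  apply: complex_ext; first exact: (congr1 fine e0).
  by rewrite Im_cint /= Rintegral_cst// mul0r.
have E : f = fun t => g t + (f 0 - g 0) * i t.
  apply/funext => t; rewrite /i indicE set_itv1.
  have [->|t0] := eqVneq t 0; first by rewrite mem_set// mulr1 addrC subrK.
  rewrite memNset; last by move=> /eqP; exact/negP.
  by rewrite mulr0 addr0 fg.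
rewrite E; split; first by apply: cintgD => //; exact: cintgZ.
by rewrite cintD ?cintZ ?i0 ?mulr0 ?addr0//; exact: cintgZ.
Qed.

Lemma CGamma_neq0 (x : R) : 0 < x -> CGamma (x%:C) != 0 :> C.
Proof.
move=> x0; rewrite CGamma_int//.
have hi : cintg (mell x%:C 0) by apply: mell_int => //; rewrite cos0.
suff : 0 < Re (cint (mell x%:C 0)) by apply: contraTneq => ->; rewrite ltxx.
rewrite Re_cint.
have E t : Re (mell x%:C 0 t) = expR (x * t - expR t).
  by rewrite /mell addr0 cexp_real -realCM -realCN -realCD cexp_real.
have h := integrable_indic_itv (0 : R) 1 true false.
have h2 : rintg leb (fun t => expR (- expR 1) * \1_`[0, 1] t) by exact: rintgZ.
apply: (@lt_le_trans _ _ (\int[leb]_t (expR (- expR 1) * \1_`[0, 1] t))).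
  rewrite RintegralZl// mulr_gt0 ?expR_gt0//.
  have e1 : (\int[leb]_x (\1_(`[0, 1] : set R) x)%:E = 1)%E.
    apply: (etrans (integral_indic leb measurableT _)) => //.
    by rewrite setIT; apply: (etrans (lebesgue_measure_itv _)); rewrite /= lte_fin ltr01 -EFinD subr0.
  by rewrite /Rintegral e1.
apply: le_Rintegral => //; first exact: hi.1.
move=> t _; rewrite E indicE; case: (boolP (t \in _)) => [|_]; last by rewrite mulr0 expR_ge0.
move=> /set_mem /=; rewrite in_itv /= => /andP[t0 t1].
rewrite mulr1 ler_expR; have : expR t <= expR 1 by rewrite ler_expR.
have : 0 <= x * t by rewrite mulr_ge0// ltW.
lra.
Qed.

Lemma S_log_int (f : R -> C) : is_spaceS f -> cintg (fun t => (expR t)%:C * f (expR t)).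
Proof.
move=> hf; have [B2 h2] := S_bd 2 hf; have [B0 h0] := S_bd 0 hf.
pose A := Num.max B0 B2.
have [K K0 hK] : exists2 K : R, 0 <= K & forall t, expR t * nc (f (expR t)) <= K * (1 + t ^+ 2)^-1.
  apply: (@exp2_cauchy R _ 1 1 A) => // t; rewrite mul1r.
    have := h0 t; rewrite mul0r expR0 mul1r => h.
    by rewrite mulrC ler_wpM2r ?expR_ge0// (le_trans h)// le_max lexx.
  have := h2 t => h; rewrite expRN ler_pdivlMr ?expR_gt0// mulrC mulrA -expRD.
  by rewrite -(mulr2n t) -mulr_natl (le_trans h)// le_max lexx orbT.
apply: cintg_majorant (K) _ _; last by move=> t; rewrite nc_realM gtr0_norm ?expR_gt0.
apply: cdiff_meas => t; apply: cdiffM; first by apply: cdiff_real.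
by apply: cdiff_comp; [|exact: S_cdiff].
Qed.

Lemma cint_log (f : R -> C) : is_spaceS f -> (forall x, cdiff f x) ->
  Cintegrable leb `]0, +oo[ f /\ cint f = cint (fun t => (expR t)%:C * f (expR t)).
Proof.
move=> hf df.
have [h1 h2] := csubst_exp (fun x _ => df x) (S_log_int hf).
split => //; rewrite -h2 [RHS]Cintegral_cut cut_id// => x nx.
by rewrite (S_out hf)// leNgt; apply/negP => x0; apply: nx; rewrite /= in_itv /= x0.
Qed.

Lemma S_add (f g : R -> C) : is_spaceS f -> is_spaceS g -> is_spaceS (fun x => f x + g x).
Proof.
move=> hf hg; apply: (@S_coind R (fun k => exists f1 f2,
  [/\ is_spaceS f1, is_spaceS f2 & k = fun x => f1 x + f2 x])); last by exists f, g.
move=> _ [f1 [f2 [hf1 hf2 ->]]]; split.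
- by move=> x x0; rewrite !(S_out _ x0)// addr0.
- move=> N; have [M1 k1] := S_bnd N hf1; have [M2 k2] := S_bnd N hf2.
  exists (M1 + M2) => x x0; have xN : 0 <= x ^+ N by rewrite exprn_ge0// ltW.
  by rewrite (le_trans (ler_wpM2l xN (ncD _ _)))// mulrDr lerD ?k1 ?k2.
- exists (fun x => Dfun f1 x + Dfun f2 x).
    by exists (Dfun f1), (Dfun f2); split => //; exact: S_D.
  by move=> x; apply: cderD; exact: S_cder.
Qed.

Lemma S_cexp (f : R -> C) z : is_spaceS f -> 0 <= Re z -> is_spaceS (fun x => f x * cexp (- (z * x%:C))).
Proof.
move=> hf z0.
apply: (@S_coind R (fun g => exists2 f, is_spaceS f & g = fun x => f x * cexp (- (z * x%:C)))); last by exists f.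
move=> _ [{}f {}hf ->]; split.
- by move=> x x0; rewrite (S_out hf)// mul0r.
- move=> N; have [M hM] := S_bnd N hf; exists M => x x0.
  apply: le_trans (hM x x0); rewrite ler_wpM2l ?exprn_ge0 ?(ltW x0)//.
  exact: Lam_le.
- exists (fun x => (Dfun f x + - z * f x) * cexp (- (z * x%:C))).
    exists (fun x => Dfun f x + - z * f x) => //.
    have h1 := S_D hf; have h2 := S_scale (- z) hf.
    exact: S_add.
  move=> x; apply: cder_eq.
    apply: cderM; first exact: S_cder.
    by apply: cder_cexp; apply: cderN; apply: cderZ; exact: cder_id.
  by rewrite /=; ring.
Qed.

Lemma Lam_log (f : R -> C) z : is_spaceS f -> 0 <= Re z ->
  Lam f z = cint (fun t => (expR t)%:C * (f (expR t) * cexp (- (z * (expR t)%:C)))).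
Proof.
move=> hf z0; have hg := S_cexp hf z0.
by have [_ <-] := cint_log hg (fun x => S_cdiff x hg).
Qed.

Lemma kzE be z : 0 < Re z -> kz be z = mell be (cln z).
Proof.
move=> z0; have zn : z != 0 by apply: contraTneq z0 => ->; rewrite ltxx.
by apply/funext => t; rewrite /kz /mell; congr (cexp (_ - _)); rewrite cexpD cexp_real cexp_cln ?(ltW z0)// mulrC.
Qed.

Lemma kz_int be z : 0 < Re be -> 0 < Re z -> cintg (kz be z).
Proof.
by move=> b0 z0; rewrite kzE//; apply: mell_int => //; apply: cos_gt0_pihalf; exact: Im_cln.
Qed.

Lemma kz_cdiff be z t : 0 < Re z -> cdiff (kz be z) t.
Proof. by move=> z0; rewrite kzE//; exact: mell_cdiff. Qed.

Definition Rt (mu : R) (h : C) (al a : R) : spaceK R -> spaceK R :=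
  TK (cexp ((1 - mu) * ln a)%:C) (h + ((mu - 1) * (1 - al))%:C) al a.

Definition Psi (mu : R) (F : C -> C) : R -> C := Rfun (1 - mu)%:C 1 1 (Kinv F).

Lemma Psi_exp mu F t : Psi mu F (expR t) = cexp ((1 - mu) * t)%:C * Kinv F (expR t).
Proof. by rewrite /Psi Rfun_exp mul1r ln1 addr0 realCM. Qed.

Lemma S_Psi mu (F : spaceK R) : is_spaceS (Psi mu F).
Proof. by apply: S_R; rewrite ?oner_neq0//; exact: S_Kinv (spaceKP F). Qed.

Lemma Rt_val mu h al a (F : spaceK R) z : al != 0 -> 0 < a -> 0 <= Re z ->
  Rt mu h al a F z = cint (fun t => kz (h + mu%:C) z t * Psi mu F (ray al a t)).
Proof.
move=> al0 a0 z0; rewrite /Rt TK_val// Lam_log//; last exact: S_cRfun.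
congr cint; apply/funext => t; rewrite Rfun_exp /ray Psi_exp /kz.
rewrite -cexp_real.
set A := Kinv F _.
transitivity (cexp (t%:C + ((1 - mu) * ln a)%:C + (h + ((mu - 1) * (1 - al))%:C) * t%:C +
   - (z * cexp t%:C)) * A).
  by rewrite !cexpD; ring.
transitivity (cexp ((h + mu%:C) * t%:C - z * cexp t%:C + ((1 - mu) * (al * t + ln a))%:C) * A); last first.
  by rewrite !cexpD; ring.
congr (cexp _ * A).
rewrite !(realCM, realCD, realCN, realC1); ring.
Qed.

End Tools.

Section HardyValue.
Context (R : realType).
Local Notation C := (Cplx R).
Local Notation leb := (@lebesgue_measure R).
Local Notation cintg := (Cintegrable leb setT).
Local Notation cint := (Cintegral leb setT).
Implicit Types (s w z u : C).

Lemma ray_meas (al a : R) : measurable_fun setT (ray al a).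
Proof.
apply: (measurableT_comp (@measurable_expR R)).
by apply: measurable_funD => //; exact: measurable_funM.
Qed.

Lemma ray_gt0 (al a t : R) : 0 < ray al a t.
Proof. exact: expR_gt0. Qed.

Lemma K_Lam (F : spaceK R) z : 0 <= Re z -> F z = Lam (Kinv F) z.
Proof. by move=> z0; rewrite -LamK_E// LamKK//; exact: spaceKP. Qed.

Lemma pt0E (t : R) : 0 +i* t = pt 0 t :> C.
Proof. by rewrite mkCE. Qed.

Lemma pt_mk (p t : R) : p +i* t = pt p t :> C.
Proof. by rewrite mkCE. Qed.

Lemma value_eq1 c h al a (F : spaceK R) z v : al != 0 -> 0 < a -> 0 < Re z -> 0 < c ->
  0 < Re h + 1 - al * c -> 0 < Re h + 1 ->
  Rtilde_value c 1 h al a F z v <-> v = Rt 1 h al a F z.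
Proof.
move=> al0 a0 z0 c0 bc b0; rewrite /Rtilde_value ltxx eqxx.
pose be := h + 1; have rb : Re be = Re h + 1 by rewrite /be cReD.
rewrite -rb in bc b0.
have hf := S_Kinv (spaceKP F).
pose n (t : R) := F (0 +i* t).
have nE : n = fun t => Lam (Kinv F) (pt 0 t).
  by apply/funext => t; rewrite /n pt0E K_Lam// Re_pt.
have hn : cintg n.
  have [K hK] := LamK_major hf; rewrite nE.
  apply: cintg_majorant (K) _ _; last by move=> t; exact: hK.
  by apply: cdiff_meas => t; eexists; exact: Lam_cdiff_t.
have hk := kz_int b0 z0.
pose e (p : R * R) : C := cexp (ii * (p.1 * ray al a p.2)%:C).
have me : cmeas e.
  apply: cmeas_cexp; apply: cmeasM; first exact: cmeas_cst.
  apply: cmeas_real; apply: measurable_funM => //.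
  exact: measurableT_comp (ray_meas al a) measurable_snd.
have eB p : nc (e p) <= 1 by rewrite nc_cexp_i.
have [h1 h2 h3] := cfubini_kernel hn hk me eB.
pose g (t : R) := LL c al (h + 1) (log_arg al a z (0 +i* t)) * F (0 +i* t).
have gE t : t != 0 -> g t = cexp (be * cln z) * (n t * cint (fun y => kz be z y * e (t, y))).
  move=> t0; have un : (0 +i* t : C) != 0 by rewrite -nc_eq0 nc_imag normr_eq0.
  have := LL_val al0 a0 z0 (lexx 0 : 0 <= Re (0 +i* t : C)) un c0 bc b0; rewrite /g /be => ->.
  rewrite -mulrA; congr (_ * _); rewrite mulrC; congr (_ * cint _).
  apply/funext => y; rewrite /e; congr (_ * cexp _).
  by apply: complex_ext; rewrite !ReImE /=; ring.
have [ig eg] := cint_neq0 gE (cintgZ _ h1).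
have key : ((2 * pi)^-1)%:C * cpow z (- 1 - h) * cint g = Rt 1 h al a F z.
  rewrite eg (cintZ _ h1) h3.
  apply: etrans _ (esym (Rt_val 1 h F al0 a0 (ltW z0))).
  rewrite -[h + _]/be.
  have E y : kz be z y * cint (fun x => n x * e (x, y)) =
      (2 * pi)%:C * (kz be z y * Psi 1 F (ray al a y)).
    rewrite mulrCA; congr (_ * _).
    rewrite {1}/ray Psi_exp subrr mul0r cexp0 mul1r -/(ray al a y) (Lam_inv _ hf (lexx 0)).
    congr cint; apply/funext => x; rewrite nE; congr (_ * cexp _).
    by rewrite /e /pt realC0 add0r realCM mulrA.
  have iP : cintg (fun y => kz be z y * Psi 1 F (ray al a y)).
    have -> : (fun y => kz be z y * Psi 1 F (ray al a y)) =
        (fun y => ((2 * pi)^-1)%:C * (kz be z y * cint (fun x => n x * e (x, y)))).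
      by apply/funext => y; rewrite E mulrA pi2V mul1r.
    exact: cintgZ.
  rewrite (funext E) (cintZ _ iP) /cpow -/be.
  set I := cint _; set P := (2 * pi)%:C; set P' := _%:C.
  have PP : P' * P = 1 := pi2V R.
  have be0 : - 1 - h + be = 0 by rewrite /be; ring.
  have ce : cexp ((- 1 - h) * cln z) * cexp (be * cln z) = 1.
    rewrite -cexpD -mulrDl be0 mul0r; exact: cexp0.
  move: ce; set X := cexp (_ * _); set Y := cexp (be * _); clearbody I P P' X Y => ce.
  by rewrite -[RHS]mul1r -PP -[RHS]mul1r -ce; ring.
by split => [[_ ->]//|->]; split.
Qed.

End HardyValue.

Section SigmaFiniteProduct.
Context d1 d2 (T1 : measurableType d1) (T2 : measurableType d2) (R : realType).
Context (m1 : {sigma_finite_measure set T1 -> \bar R}) (m2 : {sigma_finite_measure set T2 -> \bar R}).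

(* The library attaches the sigma-finite structure of [m1 \x m2] only to
   products of subprobabilities; this alias carries it in general. *)
Definition sfprod : set (T1 * T2) -> \bar R := (m1 \x m2)%E.
HB.instance Definition _ := Measure.on sfprod.

Lemma sfprod_sigma_finite : sigma_finite setT sfprod.
Proof.
have /sigma_finiteP[F [FT Fhomo Ffin]] := sigma_finiteT m1.
have /sigma_finiteP[G [GT Ghomo Gfin]] := sigma_finiteT m2.
exists (fun n => F n `*` G n).
  apply/seteqP; split => // -[x y] _.
  have [i _ Fx] : (\bigcup_n F n) x by rewrite -FT.
  have [j _ Gy] : (\bigcup_n G n) y by rewrite -GT.
  exists (maxn i j) => //; split => /=.
    exact: (subsetPset _ _ (Fhomo _ _ (leq_maxl i j))).
  exact: (subsetPset _ _ (Ghomo _ _ (leq_maxr i j))).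
move=> n; have [mF Fn] := Ffin n; have [mG Gn] := Gfin n.
split; first exact: measurableX.
by rewrite /sfprod product_measure1E// -ge0_fin_numE ?mule_ge0// fin_numM// ge0_fin_numE.
Qed.

HB.instance Definition _ := Measure_isSigmaFinite.Build _ _ _ sfprod sfprod_sigma_finite.

End SigmaFiniteProduct.

Section BergmanValue.
Context (R : realType).
Local Notation C := (Cplx R).
Local Notation leb := (@lebesgue_measure R).
Local Notation cintg := (Cintegrable leb setT).
Local Notation cint := (Cintegral leb setT).
Implicit Types (s w z u : C).

Lemma powR_expR (x r : R) : expR x `^ r = expR (r * x).
Proof. by rewrite /powR gt_eqF ?expR_gt0// expRK. Qed.

Lemma cdiff_powR (r x : R) : 0 < x -> cdiff (fun x : R => (x `^ r)%:C : C) x.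
Proof.
by move=> x0; apply: cdiff_real; apply: derivable_powR; rewrite in_itv /= x0.
Qed.

Lemma Gamma_scaled (s y : R) : 0 < s -> 0 < y ->
  let G (p : R) : C := (p `^ (s - 1))%:C * cexp (- (p * y)%:C) in
  Cintegrable leb `]0, +oo[ G /\
  Cintegral leb `]0, +oo[ G = CGamma s%:C * cexp (- (s * ln y)%:C).
Proof.
move=> s0 y0 G.
have E t : (expR t)%:C * G (expR t) = mell s%:C (ln y)%:C t.
  rewrite /G powR_expR -!cexp_real -!cexpD /mell -realCD cexp_real expRD lnK//.
  congr cexp; rewrite -!(realCN, realCD, realCM); congr (_%:C); ring.
have Iy : Im ((ln y)%:C : C) = 0 by [].
have hy : - (pi / 2) < Im ((ln y)%:C : C) < pi / 2.
  by rewrite Iy oppr_lt0 divr_gt0 ?pi_gt0.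
have [||h1 h2] := @csubst_exp R G.
- move=> x x0; apply: cdiffM; first exact: cdiff_powR.
  apply: cdiff_cexp; apply: cdiffN; apply: cdiff_real.
  by apply: derivableM => //; exact: derivable_cst.
- by rewrite (funext E); apply: mell_int => //; rewrite Iy cos0.
split => //; rewrite h2 (funext E) (mellE _ hy)//.
by rewrite realCM.
Qed.

Lemma derivable_expnV (f : R -> R) (x : R) (M : nat) : derivable f x 1 -> f x != 0 ->
  derivable (fun p : R => f p ^- M) x 1.
Proof.
move=> df f0.
have E : (fun p => f p ^- M) = (fun p => ((f ^+ M) p)^-1) by apply/funext => p; rewrite exprfctE.
rewrite E; apply: derivableV; first by rewrite exprfctE; exact: expf_neq0.
exact: derivableX.
Qed.

Lemma weight_int (s : R) (M : nat) : 0 < s -> s < M%:R ->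
  Cintegrable leb `]0, +oo[ (fun p : R => (p `^ (s - 1) * (1 + p) ^- M)%:C : C).
Proof.
move=> s0 sM.
have sub (x : R) : 0 < x -> cdiff (fun p : R => (p `^ (s - 1) * (1 + p) ^- M)%:C : C) x.
  move=> x0; have E : (fun p : R => (p `^ (s - 1) * (1 + p) ^- M)%:C : C) =
      (fun p : R => (p `^ (s - 1))%:C * ((1 + p) ^- M)%:C).
    by apply/funext => p; rewrite realCM.
  rewrite E; apply: cdiffM; first exact: cdiff_powR.
  apply: cdiff_real; apply: derivable_expnV; last by rewrite gt_eqF// addr_gt0.
  by apply: derivableD; [exact: derivable_cst|exact: derivable_id].
suff iG : cintg (fun t => (expR t)%:C * (expR t `^ (s - 1) * (1 + expR t) ^- M)%:C).
  exact: (csubst_exp sub iG).1.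
have E t : (expR t)%:C * (expR t `^ (s - 1) * (1 + expR t) ^- M)%:C =
    (expR (s * t) * (1 + expR t) ^- M)%:C :> C.
  by rewrite -realCM mulrA powR_expR -expRD; congr (expR _ * _)%:C; ring.
rewrite (funext E).
have p0 (t : R) : 0 < 1 + expR t by rewrite addr_gt0 ?expR_gt0.
have [K K0 hK] : exists2 K : R, 0 <= K &
    forall t, expR (s * t) * (1 + expR t) ^- M <= K * (1 + t ^+ 2)^-1.
  apply: (@exp2_cauchy R _ s (M%:R - s) 1) => //; first by rewrite subr_gt0.
  - move=> t; rewrite mul1r ler_piMr ?expR_ge0// invf_le1 ?exprn_gt0//.
    by rewrite exprn_ege1// lerDl expR_ge0.
  - move=> t; rewrite mul1r ler_pdivrMr ?exprn_gt0//.
    rewrite (@le_trans _ _ (expR (- ((M%:R - s) * t)) * expR t ^+ M))//.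
      by rewrite -expRM_natl -expRD ler_expR; lra.
    rewrite ler_wpM2l ?expR_ge0// lerXn2r ?nnegrE ?expR_ge0 ?(ltW (p0 t))//.
    by rewrite lerDr.
apply: cintg_majorant (K) _ _; last first.
  by move=> t; rewrite nc_real ger0_norm// mulr_ge0 ?expR_ge0// invr_ge0 exprn_ge0// ltW.
apply: cdiff_meas => t; apply: cdiff_real; apply: derivableM.
  by apply: ex_derive.
apply: derivable_expnV; last by rewrite gt_eqF.
by apply: derivableD; [exact: derivable_cst|exact: derivable_expR].
Qed.

Definition plane : set (R * R) := [set q | 0 < q.1].

Local Notation leb2 := (sfprod leb leb).

Lemma plane_meas : measurable plane.
Proof.
have -> : plane = fst @^-1` (`]0, +oo[ : set R).
  by apply/seteqP; split => q; rewrite /plane /= in_itv /= andbT.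
rewrite -[X in measurable X]setTI; exact: (measurable_fst measurableT).
Qed.

Lemma Lam_inv_int (f : R -> C) (p x : R) : is_spaceS f -> 0 <= p ->
  cintg (fun t => Lam f (pt p t) * cexp (pt p t * x%:C)).
Proof.
move=> hf p0; have [K hK] := LamK_major hf.
apply: (@cintg_majorant R _ (K * expR (p * x))).
  apply: cdiff_meas => t; apply: cdiffM; last exact: cdiff_cexp_pt.
  by eexists; exact: Lam_cdiff_t.
by move=> t; rewrite ncM nc_cexp_pt mulrAC ler_wpM2r ?expR_ge0// hK.
Qed.

Lemma Lam_plane_meas (f : R -> C) : is_spaceS f ->
  cmeas (cut plane (fun q => Lam f (pt q.1 q.2))).
Proof.
move=> hf.
pose e (p : R * R * R) : C := cexp (- (pt (Num.max p.1.1 0) p.1.2 * (Num.max p.2 0)%:C)).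
have -> : cut plane (fun q => Lam f (pt q.1 q.2)) =
    cut plane (fun q => cint (fun x => f x * e (q, x))).
  apply: cut_eq => q q0; rewrite /Lam; congr cint; apply/funext => x.
  have [x0|x0] := leP x 0; first by rewrite (S_out hf x0) !mul0r.
  by rewrite /e /= (max_idPl (ltW x0)) (max_idPl (ltW q0)).
apply: cmeas_cut; first exact: plane_meas.
have m1 : measurable_fun setT (fun x : R => 1 + x ^+ 2).
  by apply: measurable_funD => //; exact: measurable_funX.
have hc : cintg (fun x : R => ((1 + x ^+ 2)^-1)%:C).
  apply: (cintg_dom _ _ (rintg_cauchy R)); first by apply: cmeas_real; exact: rintg_meas (rintg_cauchy R).
  by move=> x; rewrite nc_real ger0_norm// invr_ge0 addr_ge0 ?sqr_ge0.
have c1 : cmeas (fun _ : R * R => 1 : C) by exact: cmeas_cst.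
have b1 (q : R * R) : nc (1 : C) <= 1 by rewrite nc1.
have [[hi _] _ _ _ _] := @cprod_kernel _ _ _ _ R leb leb _ _ (fun=> 1) 1 hc hc c1 b1.
apply: (@cmeas_integral _ _ _ _ R leb2 leb
  (fun q : R * R => (1 + q.1 ^+ 2) * (1 + q.2 ^+ 2)) f e 1).
- apply: measurable_funM.
    exact: (measurableT_comp m1 measurable_fst).
  exact: (measurableT_comp m1 measurable_snd).
- by move=> q; rewrite mulr_gt0 ?ltr_pwDl ?sqr_ge0.
- rewrite /rintg; move: hi; congr (_.-integrable _ _); apply/funext => q /=.
  by rewrite !(mul0r, mulr0, subr0, mulr1) invfM.
- exact: S_int.
- apply: cmeas_cexp; apply: cmeasN; apply: cmeasM.
    have -> : (fun p : R * R * R => pt (Num.max p.1.1 0) p.1.2) =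
      (fun p : R * R * R => (Num.max p.1.1 0) +i* p.1.2 : C).
      by apply/funext => p; rewrite pt_mk.
    apply: cmeas_mk; last exact: measurableT_comp measurable_snd measurable_fst.
    apply: measurable_maxr => //.
    exact: measurableT_comp measurable_fst measurable_fst.
  by apply: cmeas_real; apply: measurable_maxr => //; exact: measurable_snd.
- move=> p; rewrite nc_cexp cReN cReM Re_pt cReC cImC mulr0 subr0 -expR0 ler_expR oppr_le0.
  by rewrite mulr_ge0// le_max lexx orbT.
Qed.

End BergmanValue.

Section BergmanValue2.
Context (R : realType).
Local Notation C := (Cplx R).
Local Notation leb := (@lebesgue_measure R).
Local Notation leb2 := (sfprod leb leb).
Local Notation cintg := (Cintegrable leb setT).
Local Notation cint := (Cintegral leb setT).
Implicit Types (w z u : C).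

Definition berg (s : R) (f : R -> C) : R * R -> C :=
  cut (@plane R) (fun q => Lam f (pt q.1 q.2) * (q.1 `^ (s - 1))%:C).

Definition berg_exp (y : R) (q : R * R) : C :=
  cexp (- (conjc (pt (Num.max q.1 0) q.2) * y%:C)).

Lemma berg_exp_bnd y q : 0 < y -> nc (berg_exp y q) <= 1.
Proof.
move=> y0; rewrite nc_cexp cReN cReM cReJ Re_pt cReC cImC mulr0 subr0 -expR0 ler_expR oppr_le0.
by rewrite mulr_ge0 ?(ltW y0)// le_max lexx orbT.
Qed.

Lemma berg_exp_meas : cmeas (fun p : R * R * R => berg_exp (expR p.2) p.1).
Proof.
apply: cmeas_cexp; apply: cmeasN; apply: cmeasM.
  have -> : (fun p : R * R * R => conjc (pt (Num.max p.1.1 0) p.1.2)) =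
    (fun p : R * R * R => conjc ((Num.max p.1.1 0) +i* p.1.2 : C)).
    by apply/funext => p; rewrite pt_mk.
  apply: cmeas_conj; apply: cmeas_mk; last exact: measurableT_comp measurable_snd measurable_fst.
  apply: measurable_maxr => //.
  exact: measurableT_comp measurable_fst measurable_fst.
apply: cmeas_real; exact: measurableT_comp (@measurable_expR R) measurable_snd.
Qed.

Lemma berg_exp_meas1 y : cmeas (berg_exp y).
Proof.
apply: cmeas_cexp; apply: cmeasN; apply: cmeasM; last exact: cmeas_cst.
have -> : (fun p : R * R => conjc (pt (Num.max p.1 0) p.2)) =
  (fun p : R * R => conjc ((Num.max p.1 0) +i* p.2 : C)).
  by apply/funext => p; rewrite pt_mk.
apply: cmeas_conj; apply: cmeas_mk; last exact: measurable_snd.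
by apply: measurable_maxr => //; exact: measurable_fst.
Qed.

Lemma berg_pair (s : R) (f : R -> C) : 0 < s -> is_spaceS f ->
  Cintegrable leb2 setT (berg s f) /\
  forall y, 0 < y -> Cintegral leb2 setT (fun q => berg s f q * berg_exp y q) =
    (2 * pi)%:C * f y * (CGamma s%:C * cexp (- (s * ln (2 * y))%:C)).
Proof.
move=> s0 hf; pose M := Num.Def.archi_bound s.
have sM : s < M%:R by exact: archi_boundP (ltW s0).
pose n1 := cut (`]0, +oo[ : set R) (fun p : R => (p `^ (s - 1) * (1 + p) ^- M)%:C : C).
pose k1 (t : R) : C := ((1 + t ^+ 2)^-1)%:C.
pose e1 := cut (@plane R) (fun q => ((1 + q.1) ^+ M * (1 + q.2 ^+ 2))%:C * Lam f (pt q.1 q.2)).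
have hn1 : cintg n1.
  by apply/(Cintegrable_cut leb (fun p : R => (p `^ (s - 1) * (1 + p) ^- M)%:C : C) (measurable_itv _)); exact: weight_int.
have hk1 : cintg k1.
  apply: (cintg_dom _ _ (rintg_cauchy R)); first by apply: cmeas_real; exact: rintg_meas (rintg_cauchy R).
  by move=> x; rewrite nc_real ger0_norm// invr_ge0 addr_ge0 ?sqr_ge0.
have q0 (t : R) : 0 < 1 + t ^+ 2 by rewrite ltr_pwDl ?sqr_ge0.
have inP (p : R) : (p \in (`]0, +oo[ : set R)) = (0 < p).
  by apply/idP/idP => [/set_mem|h]; [|apply/mem_set]; rewrite /= in_itv /= andbT.
have inQ (q : R * R) : (q \in @plane R) = (0 < q.1).
  by apply/idP/idP => [/set_mem|h]; [|apply/mem_set].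
have NE q : berg s f q = n1 q.1 * (k1 q.2 * e1 q).
  rewrite /berg /n1 /e1 /cut inP inQ; case: ltP => p0; last by rewrite mul0r.
  have k : (q.1 `^ (s - 1) * (1 + q.1) ^- M)%:C *
      (((1 + q.2 ^+ 2)^-1)%:C * ((1 + q.1) ^+ M * (1 + q.2 ^+ 2))%:C) = (q.1 `^ (s - 1))%:C :> C.
    have P0 : (1 + q.1) ^+ M != 0 by rewrite expf_neq0// gt_eqF// addr_gt0.
    have Q0 : 1 + q.2 ^+ 2 != 0 by rewrite gt_eqF.
    rewrite -!realCM; congr (_%:C); move: P0 Q0.
    set P := _ ^+ M; set Q := 1 + _; clearbody P Q => P0 Q0.
    by field; rewrite P0 Q0.
  by rewrite /k1 -k; ring.
have me1 : cmeas e1.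
  have -> : e1 = fun q => ((1 + q.1) ^+ M * (1 + q.2 ^+ 2))%:C * cut (@plane R) (fun q => Lam f (pt q.1 q.2)) q.
    by apply/funext => q; rewrite /e1 /cut; case: ifP => // _; rewrite mulr0.
  apply: cmeasM; last exact: Lam_plane_meas.
  apply: cmeas_real; apply: measurable_funM.
    by apply: measurable_funX; apply: measurable_funD => //; exact: measurable_fst.
  by apply: measurable_funD => //; apply: measurable_funX; exact: measurable_snd.
have [K hK] := Lam_decay (M + 2) hf.
have e1B q : nc (e1 q) <= `|K|.
  rewrite /e1 /cut inQ; case: ltP => p0; last by rewrite nc0.
  have h := @pt_bnd R (Lam f) M K q.1 q.2 p0 (fun z rz => hK z (ltW rz)).
  have p1 : 0 <= (1 + q.1) ^+ M by rewrite exprn_ge0// addr_ge0// ltW.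
  rewrite nc_realM ger0_norm; last by rewrite mulr_ge0 ?(ltW (q0 _)).
  rewrite mulrAC -ler_pdivlMr// (le_trans h)// ler_wpM2r ?ler_norm//.
  by rewrite invr_ge0 ltW.
split.
  have [hi _ _ _ _] := @cprod_kernel _ _ _ _ R leb leb n1 k1 e1 _ hn1 hk1 me1 e1B.
  by rewrite (funext NE).
move=> y y0; pose e2 q := e1 q * berg_exp y q.
have me2 : cmeas e2 by apply: cmeasM me1 _; exact: berg_exp_meas1.
have e2B q : nc (e2 q) <= `|K|.
  by rewrite ncM -[leRHS]mulr1 ler_pM ?nc_ge0 ?berg_exp_bnd.
have [_ _ _ hI _] := @cprod_kernel _ _ _ _ R leb leb n1 k1 e2 _ hn1 hk1 me2 e2B.
have E q : berg s f q * berg_exp y q = n1 q.1 * (k1 q.2 * e2 q).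
  by rewrite NE /e2; ring.
rewrite (funext E); apply: (etrans (esym hI)).
pose G (p : R) : C := (p `^ (s - 1))%:C * cexp (- (p * (2 * y))%:C).
have y20 : 0 < 2 * y by rewrite mulr_gt0.
have [iG IG] := Gamma_scaled s0 y20.
have E3 p : n1 p * cint (fun t => k1 t * e2 (p, t)) =
    (2 * pi)%:C * f y * cut (`]0, +oo[ : set R) G p.
  rewrite /n1 /cut inP; case: ltP => p0; last by rewrite mul0r mulr0.
  have -> : (fun t => k1 t * e2 (p, t)) =
     (fun t => ((1 + p) ^+ M)%:C * cexp (- (p * (2 * y))%:C) * (Lam f (pt p t) * cexp (pt p t * y%:C))).
    apply/funext => t; rewrite /k1 /e2 /e1 /cut inQ /= p0.
    have -> : berg_exp y (p, t) = cexp (- (p * (2 * y))%:C) * cexp (pt p t * y%:C).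
      rewrite /berg_exp /= (max_idPl (ltW p0)) -cexpD; congr cexp.
      by apply: complex_ext; rewrite !ReImE ?Re_pt ?Im_pt /=; ring.
    have k : ((1 + t ^+ 2)^-1)%:C * ((1 + p) ^+ M * (1 + t ^+ 2))%:C = ((1 + p) ^+ M)%:C :> C.
      by rewrite -realCM; congr (_%:C); field; rewrite gt_eqF.
    by rewrite -k; ring.
  rewrite (cintZ _ (Lam_inv_int y hf (ltW p0))).
  rewrite -(Lam_inv _ hf (ltW p0)) /G.
  have k : (p `^ (s - 1) * (1 + p) ^- M)%:C * ((1 + p) ^+ M)%:C = (p `^ (s - 1))%:C :> C.
    by rewrite -realCM mulfVK// expf_neq0// gt_eqF// addr_gt0.
  by rewrite -k; ring.
rewrite (funext E3) cintZ -?Cintegral_cut ?IG//.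
by apply/(Cintegrable_cut leb G (measurable_itv _)).
Qed.

End BergmanValue2.

Section BergmanValue3.
Context (R : realType).
Local Notation C := (Cplx R).
Local Notation leb := (@lebesgue_measure R).
Local Notation leb2 := (sfprod leb leb).
Local Notation cintg := (Cintegrable leb setT).
Local Notation cint := (Cintegral leb setT).
Implicit Types (w z u : C).

Lemma value_eq_gt1 c mu h al a (F : spaceK R) z v : 1 < mu -> al != 0 -> 0 < a -> 0 < Re z -> 0 < c ->
  0 < Re h + mu - al * c -> 0 < Re h + mu ->
  Rtilde_value c mu h al a F z v <-> v = Rt mu h al a F z.
Proof.
move=> mu1 al0 a0 rz c0 bc b0; rewrite /Rtilde_value mu1.
pose be := h + mu%:C; have rb : Re be = Re h + mu by rewrite /be cReD.
rewrite -rb in bc b0.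
pose s := mu - 1; have s0 : 0 < s by rewrite subr_gt0.
have hf := S_Kinv (spaceKP F); set f := Kinv F in hf.
have [hN pN] := berg_pair s0 hf.
have hk := kz_int b0 rz.
pose e (p : R * R * R) := berg_exp (ray al a p.2) p.1.
have me : cmeas e.
  have mq : measurable_fun setT (fun p : R * R * R => (p.1, al * p.2 + ln a)).
    apply: measurable_fun_pair; first exact: measurable_fst.
    apply: measurable_funD => //; apply: measurable_funM => //; exact: measurable_snd.
  exact: (cmeas_comp mq (berg_exp_meas R)).
have eB p : nc (e p) <= 1 by apply: berg_exp_bnd; exact: ray_gt0.
have [h1 h2 h3] := @cfubini_kernel _ _ _ _ R leb2 leb _ _ e 1 hN hk me eB.
set g := (X in Cintegrable _ _ X).
set D := [set p : R * R | 0 < p.1].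
have gE : cut D g = fun q => cexp (be * cln z) *
    (berg s f q * cint (fun y => kz be z y * e (q, y))).
  apply/funext => q; rewrite /berg /cut; case: ifPn => qD; last by rewrite mul0r mulr0.
  have q0 : 0 < q.1 by move: qD => /set_mem.
  have un : q.1 +i* q.2 != 0 :> C by apply: contraTneq q0 => -[-> _]; rewrite ltxx.
  have := LL_val al0 a0 rz (ltW q0 : 0 <= Re (q.1 +i* q.2 : C)) un c0 bc b0.
  rewrite /g /be => ->.
  rewrite pt_mk -(K_Lam F); last by rewrite Re_pt ltW.
  rewrite Re_pt (_ : mu - 2 = s - 1); last by rewrite /s; ring.
  have -> : (fun t => kz (h + mu%:C) z t * cexp (- (conjc (pt q.1 q.2) * (ray al a t)%:C))) =
      (fun t => kz (h + mu%:C) z t * e (q, t)).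
    by apply/funext => t; rewrite /e /berg_exp /= (max_idPl (ltW q0)).
  by rewrite -!mulrA; congr (_ * _); rewrite [LHS]mulrC mulrA.
have mD : measurable D by exact: plane_meas.
have ig : Cintegrable (leb \x leb)%E D g.
  have i' : Cintegrable leb2 setT (cut D g) by rewrite gE; exact: (cintgZ (m := leb2) _ h1).
  by apply/(Cintegrable_cut (leb \x leb)%E g mD); exact: i'.
have Ig : Cintegral (leb \x leb)%E D g = cexp (be * cln z) *
    cint (fun y => kz be z y * Cintegral leb2 setT (fun q => berg s f q * e (q, y))).
  have e' : Cintegral leb2 setT (cut D g) = cexp (be * cln z) *
      Cintegral leb2 setT (fun q => berg s f q * cint (fun y => kz be z y * e (q, y))).
    by rewrite gE; apply: (cintZ (m := leb2) _ h1).
  by apply: (etrans (Cintegral_cut (leb \x leb)%E D g)); apply: (etrans e'); rewrite h3.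
pose W : C := (2 * pi)%:C * CGamma s%:C * cexp (- (s * ln 2)%:C).
have E y : kz be z y * Cintegral leb2 setT (fun q => berg s f q * e (q, y)) =
    W * (kz be z y * Psi mu F (ray al a y)).
  rewrite /e /= pN ?ray_gt0// {3}/ray Psi_exp -/(ray al a y) -/f.
  have lr : ln (ray al a y) = al * y + ln a by exact: expRK.
  rewrite lnM ?posrE ?ray_gt0// lr.
  have -> : - (s * (ln 2 + (al * y + ln a)))%:C =
      - (s * ln 2)%:C + - (s * (al * y + ln a))%:C :> C by rewrite mulrDr realCD opprD.
  rewrite cexpD /W.
  have -> : (1 - mu) * (al * y + ln a) = - (s * (al * y + ln a)) by rewrite /s; ring.
  rewrite realCN; set X := cexp (- (s * (_ + _))%:C); set Y := cexp (- (s * ln 2)%:C).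
  set Z := f _; set P := (2 * pi)%:C; set G := CGamma _; set k := kz _ _ _.
  by clearbody X Y Z P G k; ring.
have W0 : W != 0.
  by rewrite /W !mulf_neq0 ?pi2_neq0 ?CGamma_neq0 ?cexp_neq0.
have iP : cintg (fun y => kz be z y * Psi mu F (ray al a y)).
  have -> : (fun y => kz be z y * Psi mu F (ray al a y)) =
      (fun y => W^-1 * (kz be z y * Cintegral leb2 setT (fun q => berg s f q * e (q, y)))).
    by apply/funext => y; rewrite E mulKf.
  exact: cintgZ.
have key : (2 `^ (mu - 2) / pi)%:C * (CGamma (mu - 1)%:C)^-1 * cpow z (- mu%:C - h) *
    Cintegral (leb \x leb)%E D g = Rt mu h al a F z.
  rewrite Ig (funext E) (cintZ _ iP).
  apply: etrans _ (esym (Rt_val mu h F al0 a0 (ltW rz))).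
  rewrite -[h + _]/be /cpow -/s.
  have be0 : - mu%:C - h + be = 0 by rewrite /be; ring.
  have ce : cexp ((- mu%:C - h) * cln z) * cexp (be * cln z) = 1.
    rewrite -cexpD -mulrDl be0 mul0r; exact: cexp0.
  have G0 : CGamma s%:C != 0 := CGamma_neq0 s0.
  have cc : (2 `^ (mu - 2) / pi)%:C * ((2 * pi)%:C * cexp (- (s * ln 2)%:C)) = 1 :> C.
    have -> : - (s * ln 2)%:C = (- (s * ln 2))%:C :> C by rewrite realCN.
    rewrite cexp_real -!realCM /powR ifF ?gt_eqF//.
    have -> : (mu - 2) * ln 2 = s * ln 2 - ln 2 by rewrite /s; ring.
    rewrite expRB lnK ?posrE// expRN.
    have e0 : expR (s * ln 2) != 0 by rewrite gt_eqF ?expR_gt0.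
    have p0 : pi != 0 :> R by rewrite gt_eqF ?pi_gt0.
    rewrite -realC1; congr (_%:C); move: e0 p0; set E0 := expR _; set P0 := pi.
    by clearbody E0 P0 => e0 p0; field; rewrite e0 p0.
  rewrite /W; move: ce cc G0; set X := cexp (_ * _); set Y := cexp (be * _).
  set A := (_ / _)%:C; set P := (2 * pi)%:C; set T := cexp (- _); set G := CGamma _; set I := cint _.
  clearbody X Y A P T G I => ce cc G0.
  rewrite [RHS](_ : _ = (X * Y) * (A * (P * T)) * (G^-1 * G) * I); first by ring.
  by rewrite ce cc mulVf// !mul1r.
by split => [[_ ->]//|->]; split.
Qed.

End BergmanValue3.

Section LaplaceValue.
Context (R : realType).
Local Notation C := (Cplx R).
Local Notation leb := (@lebesgue_measure R).
Local Notation cintg := (Cintegrable leb setT).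
Local Notation cint := (Cintegral leb setT).
Local Notation D := (`]0, +oo[ : set R).

Lemma in_halfline (p : R) : (p \in D) = (0 < p).
Proof. by apply/idP/idP => [/set_mem|h]; [|apply/mem_set]; rewrite /= in_itv /= andbT. Qed.

(* An integrable function is determined, as a functional on [S(R_+)], by its
   Laplace transform on the open half-plane: pair it with the inversion formula
   for [f], damped by [exp (- x / (n + 1))]. *)
Lemma laplace_pair0 (d : R -> C) (f : R -> C) : cintg (cut D d) -> is_spaceS f ->
  (forall w : C, 0 < Re w -> Cintegral leb D (fun y => d y * cexp (- (w * y%:C))) = 0) ->
  cint (fun y => cut D d y * f y) = 0.
Proof.
move=> hd hf d0.
pose n t := Lam f (pt 0 t).
have hn : cintg n.
  have [K hK] := LamK_major hf.
  apply: (@cintg_majorant R _ K); last by move=> t; exact: hK.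
  by apply: cdiff_meas => t; eexists; exact: Lam_cdiff_t.
pose e_ (ep : R) (p : R * R) : C := cexp (- (pt ep (- p.1) * (Num.max p.2 0)%:C)).
have me ep : cmeas (e_ ep).
  apply: cmeas_cexp; apply: cmeasN; apply: cmeasM.
    have -> : (fun p : R * R => pt ep (- p.1)) = (fun p : R * R => ep +i* (- p.1) : C).
      by apply/funext => p; rewrite pt_mk.
    apply: cmeas_mk => //; apply: measurableT_comp => //.
  by apply: cmeas_real; apply: measurable_maxr => //; exact: measurable_snd.
have eB ep p : 0 <= ep -> nc (e_ ep p) <= 1.
  move=> ep0; rewrite nc_cexp cReN cReM Re_pt cReC cImC mulr0 subr0 -expR0 ler_expR oppr_le0.
  by rewrite mulr_ge0// le_max lexx orbT.
have step ep : 0 < ep ->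
    cint (fun y => (2 * pi)%:C * (cut D d y * f y * cexp (- (ep * Num.max y 0)%:C))) = 0.
  move=> ep0.
  have [h1 h2 h3] := cfubini_kernel hn hd (me ep) (fun p => eB ep p (ltW ep0)).
  have E1 y : cut D d y * cint (fun t => n t * e_ ep (t, y)) =
      (2 * pi)%:C * (cut D d y * f y * cexp (- (ep * Num.max y 0)%:C)).
    rewrite /cut in_halfline; case: ltP => y0; last by rewrite !mul0r mulr0.
    have -> : (fun t => n t * e_ ep (t, y)) =
        (fun t => cexp (- (ep * y)%:C) * (Lam f (pt 0 t) * cexp (pt 0 t * y%:C))).
      apply/funext => t; rewrite mulrCA -cexpD /n /e_ /= (max_idPl (ltW y0)).
      congr (_ * cexp _); rewrite /pt realC0 realCN realCM; ring.
    rewrite (cintZ _ (Lam_inv_int y hf (lexx 0))) -(Lam_inv _ hf (lexx 0)); ring.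
  rewrite -(funext E1) -h3.
  have E2 t : n t * cint (fun y => cut D d y * e_ ep (t, y)) = 0.
    have -> : (fun y => cut D d y * e_ ep (t, y)) = cut D (fun y => d y * cexp (- (pt ep (- t) * y%:C))).
      apply/funext => y; rewrite /cut in_halfline; case: ltP => y0; last by rewrite mul0r.
      by rewrite /e_ /= (max_idPl (ltW y0)).
    have wt : 0 < Re (pt ep (- t)) by rewrite Re_pt.
    rewrite -Cintegral_cut (d0 _ wt); exact: mulr0.
  by rewrite (funext E2) cint0.
have [B hB] := S_bnd 0 hf.
have fB y : nc (f y) <= `|B|.
  have [y0|y0] := ltP 0 y; last by rewrite (S_out hf y0) nc0.
  by have := hB y y0; rewrite expr0 mul1r => h; rewrite (le_trans h)// ler_norm.
pose q (x y : R) := (2 * pi)%:C * (cut D d y * f y * cexp (- (x * Num.max y 0)%:C)).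
have mcut : cmeas (fun y => cut D d y * f y).
  by apply: cmeasM; [exact: cintg_meas hd|exact: S_meas].
have mq x : cmeas (q x).
  apply: cmeasM; first exact: cmeas_cst.
  apply: cmeasM => //; apply: cmeas_cexp; apply: cmeasN; apply: cmeas_real.
  by apply: measurable_funM => //; exact: measurable_maxr.
have qB x y : 0 <= x -> nc (q x y) <= nc (2 * pi)%:C * `|B| * nc (cut D d y).
  move=> x0; rewrite /q ncM -[leRHS]mulrA ler_wpM2l ?nc_ge0// !ncM.
  have e1 : nc (cexp (- (x * Num.max y 0)%:C)) <= 1.
    by rewrite nc_cexp cReN cReC -expR0 ler_expR oppr_le0 mulr_ge0// le_max lexx orbT.
  rewrite (@le_trans _ _ (nc (cut D d y) * `|B| * 1))//; last by rewrite mulr1 mulrC.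
  by rewrite ler_pM ?mulr_ge0 ?nc_ge0// ler_wpM2l ?nc_ge0.
pose G y := nc (2 * pi)%:C * `|B| * nc (cut D d y).
have iG : rintg leb G := rintgZ (nc (2 * pi)%:C * `|B|) (cintg_nc hd).
have cv : nc (cint (q (n0.+1%:R)^-1) - cint (q 0)) @[n0 --> \oo] --> (0 : R).
  apply: (@cdct _ _ R leb (fun n0 : nat => q (n0.+1%:R)^-1) (q 0) G).
  - by move=> n0; exact: mq.
  - exact: mq.
  - by move=> n0 y; apply: qB; rewrite invr_ge0.
  - by move=> y; exact: qB.
  - exact: iG.
  - move=> y; apply: (@ccvg R (fun x => q x y) 0 (fun n0 : nat => n0.+1%:R^-1)); last exact: cvg_invS.
    apply: cdiffM; first exact: cdiff_cst.
    apply: cdiffM; first exact: cdiff_cst.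
    apply: cdiff_cexp; apply: cdiffN; apply: cdiff_real.
    by apply: derivableM; [exact: derivable_id|exact: derivable_cst].
have q00 : cint (q 0) = 0.
  apply/esym; apply: nc_cvg_unique cv.
  have st n0 : cint (q (n0.+1%:R)^-1) = 0 by apply: step; rewrite invr_gt0.
  under eq_fun do rewrite st subrr nc0; exact: cvg_cst.
have E : (fun y => cut D d y * f y) = (fun y => ((2 * pi)^-1)%:C * q 0 y).
  by apply/funext => y; rewrite /q mul0r realC0 oppr0 cexp0 mulr1 mulrA pi2V mul1r.
rewrite E cintZ ?q00 ?mulr0//.
by apply: (@cintg_dom _ _ R leb (q 0) G _ _ iG) => [|y]; [exact: mq|exact: qB].
Qed.

End LaplaceValue.

Section LaplaceValue2.
Context (R : realType).
Local Notation C := (Cplx R).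
Local Notation leb := (@lebesgue_measure R).
Local Notation cintg := (Cintegrable leb setT).
Local Notation cint := (Cintegral leb setT).
Local Notation D := (`]0, +oo[ : set R).

Lemma Rfun1 (r : R) (f : R -> C) x : 0 < x -> Rfun r%:C 1 1 f x = (x `^ r)%:C * f x.
Proof.
move=> x0; rewrite /Rfun x0 mul1r ln1 addr0 lnK// -realCM cexp_real.
by rewrite /powR gt_eqF.
Qed.

Definition Lpre (mu : R) (f : R -> C) (x : R) : C :=
  (CGamma mu%:C)^-1 * Rfun (mu - 1)%:C 1 1 f x.

Lemma S_Lpre mu (f : R -> C) : is_spaceS f -> is_spaceS (Lpre mu f).
Proof. by move=> hf; apply: S_scale; apply: S_R; rewrite ?oner_neq0. Qed.

Lemma Laplace_Lam mu (f : R -> C) (w : C) : is_spaceS f -> 0 <= Re w ->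
  Laplace mu f w = Lam (Lpre mu f) w.
Proof.
move=> hf w0; have hS : is_spaceS (Rfun (mu - 1)%:C 1 1 f) by apply: S_R; rewrite ?oner_neq0.
rewrite /Laplace /Lpre (LamZ _ hS w0); congr (_ * _).
rewrite Cintegral_cut; congr cint; apply/funext => x.
rewrite /cut in_halfline; case: ltP => x0; last by rewrite (Rfun_out _ _ _ _ x0) mul0r.
by rewrite Rfun1//; ring.
Qed.

Definition mdens (mu : R) (be : C) (al a : R) (z : C) (y : R) : C :=
  (`|al|^-1 * y `^ (- mu))%:C * kz be z (al^-1 * ln y - al^-1 * ln a).

Lemma mdens_push (mu : R) (be : C) (al a : R) (z : C) (H : R -> C) (B : R) :
  al != 0 -> 0 < Re be -> 0 < Re z -> (forall x, 0 < x -> cdiff H x) ->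
  (forall x, 0 < x -> nc (H x) <= B) ->
  let G y := H y * mdens mu be al a z y * (y `^ (mu - 1))%:C in
  Cintegrable leb D G /\ Cintegral leb D G = cint (fun t => kz be z t * H (ray al a t)).
Proof.
move=> al0 b0 z0 dH HB G.
pose E t := kz be z t * H (ray al a t).
have dray t : derivable (ray al a) t 1.
  have -> : ray al a = expR \o (al \*: (@id R) + cst (ln a)).
    by apply/funext.
  by apply: ex_derive.
have dHr t : cdiff (fun t => H (ray al a t)) t.
  by apply: cdiff_comp; [exact: dray|apply: dH; exact: ray_gt0].
have dE t : cdiff E t by apply: cdiffM; [exact: kz_cdiff|exact: dHr].
have iE : cintg E.
  have -> : E = fun t => H (ray al a t) * kz be z t by apply/funext => t; rewrite mulrC.
  apply: (@cintgMbnd _ _ _ leb (fun t => H (ray al a t)) (kz be z) B).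
  - by apply: cdiff_meas.
  - by move=> t; apply: HB; exact: ray_gt0.
  - exact: kz_int.
have ali0 : al^-1 != 0 by rewrite invr_eq0.
have [h1 h2] := caff (- (al^-1 * ln a)) ali0 dE iE.
have EG t : (expR t)%:C * G (expR t) = `|al^-1|%:C * E (al^-1 * t + - (al^-1 * ln a)).
  rewrite /G /mdens expRK /E /ray.
  have -> : al * (al^-1 * t + - (al^-1 * ln a)) + ln a = t by field.
  have k : (expR t)%:C * ((`|al|^-1 * expR t `^ (- mu))%:C * (expR t `^ (mu - 1))%:C) = `|al^-1|%:C :> C.
    rewrite -!realCM !powR_expR normfV; congr (_%:C).
    have e : expR t * (expR (- mu * t) * expR ((mu - 1) * t)) = 1.
      by rewrite -!expRD -[RHS]expR0; congr expR; ring.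
    rewrite [LHS](_ : _ = `|al|^-1 * (expR t * (expR (- mu * t) * expR ((mu - 1) * t)))); last by ring.
    by rewrite e mulr1.
  by rewrite -k; ring.
have iEG : cintg (fun t => (expR t)%:C * G (expR t)).
  by rewrite (funext EG); exact: cintgZ.
have dG x : 0 < x -> cdiff G x.
  move=> x0; apply: cdiffM; last exact: cdiff_powR.
  apply: cdiffM; first exact: dH.
  apply: cdiffM.
    have -> : (fun y : R => (`|al|^-1 * y `^ (- mu))%:C : C) = (fun y => (`|al|^-1)%:C * (y `^ (- mu))%:C).
      by apply/funext => y; rewrite realCM.
    by apply: cdiffM; [exact: cdiff_cst|exact: cdiff_powR].
  apply: (@cdiff_comp _ (kz be z) (fun y => al^-1 * ln y - al^-1 * ln a)); last exact: kz_cdiff.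
  have dl : derivable (@ln R) x 1 by have [] := is_derive1_ln x0.
  by apply: derivableB; [apply: derivableM => //; exact: derivable_cst|exact: derivable_cst].
have [i1 i2] := csubst_exp dG iEG.
split => //; rewrite i2 (funext EG) cintZ// h2//.
Qed.

Lemma nc_cexp_le1 (u : C) x : 0 <= Re u -> 0 <= x -> nc (cexp (- (u * x%:C))) <= 1.
Proof. by move=> u0 x0; rewrite nc_cexp -expR0 ler_expR Re_zx. Qed.

Lemma value_eq_lt1 c mu h al a (F : spaceK R) (z v : C) : 0 < mu -> mu < 1 ->
  al != 0 -> 0 < a -> 0 < Re z -> 0 < c ->
  0 < Re h + mu - al * c -> 0 < Re h + mu ->
  Rtilde_value c mu h al a F z v <-> v = Rt mu h al a F z.
Proof.
move=> mu0 mu1 al0 a0 rz c0 bc b0.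
rewrite /Rtilde_value ltNge (ltW mu1) /= lt_eqF//.
pose be := h + mu%:C; have rb : Re be = Re h + mu by rewrite /be cReD.
rewrite -rb in bc b0.
have hf := S_Kinv (spaceKP F).
pose G0 := CGamma mu%:C; have G00 : G0 != 0 := CGamma_neq0 mu0.
have hP := S_Psi mu F.
pose f0 := SpaceS (S_scale G0 hP).
have f0E : Lpre mu f0 = Kinv F.
  apply/funext => x; rewrite /Lpre; have [x0|x0] := ltP 0 x; last first.
    by rewrite (Rfun_out _ _ _ _ x0) (S_out hf x0) mulr0.
  rewrite Rfun1//= /Psi Rfun1//.
  have k : (x `^ (mu - 1))%:C * (x `^ (1 - mu))%:C = 1 :> C.
    rewrite -realCM -powRD; last by rewrite (gt_eqF x0) implybT.
    by rewrite (_ : mu - 1 + (1 - mu) = 0) ?powRr0//; ring.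
  rewrite -/G0; rewrite [LHS](_ : _ = (G0^-1 * G0) * (((x `^ (mu - 1))%:C * (x `^ (1 - mu))%:C) * Kinv F x)); last by ring.
  by rewrite k mulVf// !mul1r.
have MK (u : C) : 0 < Re u -> Mker c mu h al a z u =
    G0^-1 * cint (fun t => kz be z t * cexp (- (conjc u * (ray al a t)%:C))).
  move=> u0; have un : u != 0 by apply: contraTneq u0 => ->; rewrite ltxx.
  have := LL_val al0 a0 rz (ltW u0) un c0 bc b0; rewrite /Mker /be => ->.
  rewrite -/G0 -mulrA; congr (_ * _); rewrite mulrA /cpow -cexpD -mulrDl.
  have -> : - mu%:C - h + (h + mu%:C) = 0 by ring.
  rewrite mul0r cexp0; exact: mul1r.
pose m0 := mdens mu be al a z.
have [B hB] := S_bnd 0 hP.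
have PB x : 0 < x -> nc (Psi mu F x) <= B by move=> x0; have := hB x x0; rewrite expr0 mul1r.
have [j1 J1] := mdens_push mu a al0 b0 rz (fun x _ => S_cdiff x hP) PB.
have key : (CGamma mu%:C)^-1 * Cintegral leb D (fun y => f0 y * m0 y * (y `^ (mu - 1))%:C) =
    Rt mu h al a F z.
  have E : (fun y => f0 y * m0 y * (y `^ (mu - 1))%:C) =
      (fun y => G0 * (Psi mu F y * mdens mu be al a z y * (y `^ (mu - 1))%:C)).
    by apply/funext => y; rewrite /= -/G0 /m0; ring.
  rewrite E Cintegral_cut cutZ cintZ; last by apply/(Cintegrable_cut leb _ (measurable_itv _)).
  rewrite -Cintegral_cut J1 mulrA mulVf// mul1r.
  exact: (esym (Rt_val mu h F al0 a0 (ltW rz))).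
have one1 (x : R) : 0 < x -> nc (1 : C) <= 1 by rewrite nc1.
have [j0 _] := mdens_push mu a al0 b0 rz (fun x _ => cdiff_cst 1 x) one1.
have im0 : Cintegrable leb D (fun y => m0 y * (y `^ (mu - 1))%:C).
  have -> : (fun y => m0 y * (y `^ (mu - 1))%:C) = (fun y => 1 * m0 y * (y `^ (mu - 1))%:C).
    by apply/funext => y; rewrite mul1r.
  exact: j0.
have pushE (w : C) : 0 < Re w ->
    Cintegrable leb D (fun y => m0 y * cexp (- (w * y%:C)) * (y `^ (mu - 1))%:C) /\
    Cintegral leb D (fun y => m0 y * cexp (- (w * y%:C)) * (y `^ (mu - 1))%:C) =
    cint (fun t => kz be z t * cexp (- (w * (ray al a t)%:C))).
  move=> w0.
  have dc x : 0 < x -> cdiff (fun x => cexp (- (w * x%:C))) x.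
    move=> _; apply: cdiff_cexp; apply: cdiffN; apply: cdiffM; [exact: cdiff_cst|exact: cdiff_id].
  have bc' x : 0 < x -> nc (cexp (- (w * x%:C))) <= 1.
    by move=> x0; apply: nc_cexp_le1; exact: ltW.
  have := mdens_push mu a al0 b0 rz dc bc'; rewrite /= -/m0.
  by have -> : (fun y => cexp (- (w * y%:C)) * m0 y * (y `^ (mu - 1))%:C) =
    (fun y => m0 y * cexp (- (w * y%:C)) * (y `^ (mu - 1))%:C)
    by apply/funext => y; rewrite (mulrC _ (m0 y)).
have Fw w : RHP w -> F w = Laplace mu f0 w.
  move=> w0; rewrite Laplace_Lam ?f0E ?(ltW w0)//; last exact: spaceS_prop.
  by rewrite K_Lam// ltW.
have Mm0 u : RHP u -> Mker c mu h al a z u = Laplace mu m0 (conjc u).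
  move=> u0; rewrite MK//; have u0' : 0 < Re (conjc u) by rewrite cReJ.
  by rewrite /Laplace (pushE _ u0').2.
split; last by move=> ->; exists f0, m0; split.
move=> [f [m [hF im hM ->]]].
have hfS := spaceS_prop f.
have KF : spaceK_val F = LamK (Lpre mu f).
  apply: K_eq; [exact: spaceKP|by apply: LamK_spaceK; exact: S_Lpre|].
  by move=> w w0; rewrite LamK_E ?ltW// hF// Laplace_Lam ?ltW.
have LL0 : Lpre mu f = Lpre mu f0 by rewrite f0E KF KinvK//; exact: S_Lpre.
have ff x : 0 < x -> f x = f0 x.
  move=> x0; have := congr1 (fun g => g x) LL0; rewrite /Lpre !Rfun1//.
  move=> /(mulfI _) e1; have {}e1 := e1 (invr_neq0 G00); apply: mulfI e1.
  by rewrite -nc_eq0 nc_real normr_eq0 gt_eqF// powR_gt0.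
apply: etrans _ key; congr (_ * _).
pose d y := m y * (y `^ (mu - 1))%:C - m0 y * (y `^ (mu - 1))%:C.
have icut g : Cintegrable leb D g -> cintg (cut D g).
  by move=> ig; apply/(Cintegrable_cut leb g (measurable_itv _)).
have hd : cintg (cut D d) by rewrite cutB; apply: cintgB; exact: icut.
have hd0 (w : C) : 0 < Re w -> Cintegral leb D (fun y => d y * cexp (- (w * y%:C))) = 0.
  move=> w0; have wJ : RHP (conjc w) by rewrite /RHP /= cReJ.
  have e1 := hM _ wJ; have e2 := Mm0 _ wJ; rewrite conjcK in e1 e2.
  have : Laplace mu m w = Laplace mu m0 w by rewrite -e1 -e2.
  rewrite /Laplace => /(mulfI (invr_neq0 G00)) e3.
  have i1 : Cintegrable leb D (fun y => m y * cexp (- (w * y%:C)) * (y `^ (mu - 1))%:C).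
    have cE : cut D (fun y => m y * cexp (- (w * y%:C)) * (y `^ (mu - 1))%:C) =
       (fun y => cexp (- (w * (Num.max y 0)%:C)) * cut D (fun y => m y * (y `^ (mu - 1))%:C) y).
      apply/funext => y; rewrite /cut in_halfline; case: ltP => y0; last by rewrite mulr0.
      by ring.
    suff i' : cintg (cut D (fun y => m y * cexp (- (w * y%:C)) * (y `^ (mu - 1))%:C)).
      by apply/(Cintegrable_cut leb _ (measurable_itv _)); exact: i'.
    rewrite cE.
    apply: (@cintgMbnd _ _ _ leb (fun y => cexp (- (w * (Num.max y 0)%:C))) _ 1); last exact: icut.
      apply: cmeas_cexp; apply: cmeasN; apply: cmeasM; first exact: cmeas_cst.
      by apply: cmeas_real; exact: measurable_maxr.
    by move=> y; apply: nc_cexp_le1; [exact: ltW|rewrite le_max lexx orbT].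
  have i2 := (pushE w w0).1.
  have -> : (fun y => d y * cexp (- (w * y%:C))) =
     (fun y => m y * cexp (- (w * y%:C)) * (y `^ (mu - 1))%:C - m0 y * cexp (- (w * y%:C)) * (y `^ (mu - 1))%:C).
    by apply/funext => y; rewrite /d; ring.
  rewrite Cintegral_cut cutB cintB; [|exact: icut|exact: icut].
  apply/eqP; rewrite subr_eq0; apply/eqP.
  exact: (etrans (esym (Cintegral_cut leb D _)) (etrans e3 (Cintegral_cut leb D _))).
have := laplace_pair0 hd (spaceS_prop f0) hd0.
have -> : (fun y => cut D d y * f0 y) =
   (fun y => cut D (fun y => f y * m y * (y `^ (mu - 1))%:C) y - cut D (fun y => f0 y * m0 y * (y `^ (mu - 1))%:C) y).
  apply/funext => y; rewrite /cut in_halfline; case: ltP => y0; last by rewrite mul0r subr0.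
  by rewrite ff// /d; ring.
have [BS hBS] := S_bnd 0 (spaceS_prop f0).
have ifn n : Cintegrable leb D (fun y => n y * (y `^ (mu - 1))%:C) ->
    cintg (cut D (fun y => f0 y * n y * (y `^ (mu - 1))%:C)).
  move=> hn.
  have -> : cut D (fun y => f0 y * n y * (y `^ (mu - 1))%:C) =
    (fun y => f0 y * cut D (fun y => n y * (y `^ (mu - 1))%:C) y).
    by apply/funext => y; rewrite /cut; case: ifP => _; rewrite ?mulr0 ?mulrA.
  apply: (@cintgMbnd _ _ _ leb f0 _ `|BS|); last exact: icut.
    exact: S_meas (spaceS_prop f0).
  move=> y; have [y0|y0] := ltP 0 y; last by rewrite (S_out (spaceS_prop f0) y0) nc0.
  by have := hBS y y0; rewrite expr0 mul1r => hh; rewrite (le_trans hh)// ler_norm.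
have Ef : cut D (fun y => f y * m y * (y `^ (mu - 1))%:C) = cut D (fun y => f0 y * m y * (y `^ (mu - 1))%:C).
  by apply: cut_eq => y; rewrite /= in_itv /= andbT => y0; rewrite ff.
rewrite Ef cintB; [|exact: ifn|exact: ifn].
move/eqP; rewrite subr_eq0 => /eqP e4.
apply: (etrans (Cintegral_cut leb D _)); apply: (etrans _ (esym (Cintegral_cut leb D _))).
by apply: (etrans _ e4); rewrite -Ef.
Qed.

End LaplaceValue2.

(** * Characterization of the operators *)

Section Primitive.
Context (R : realType).
Local Notation C := (Cplx R).
Local Notation leb := (@lebesgue_measure R).
Local Notation cintg := (Cintegrable leb setT).
Local Notation cint := (Cintegral leb setT).

Lemma cauchy_translate (b t : R) :
  (1 + (b + t) ^+ 2)^-1 <= 2 * (1 + b ^+ 2) * (1 + t ^+ 2)^-1.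
Proof.
have p1 : 0 < 1 + (b + t) ^+ 2 by rewrite ltr_pwDl ?sqr_ge0.
have p2 : 0 < 1 + t ^+ 2 by rewrite ltr_pwDl ?sqr_ge0.
rewrite ler_pdivlMr// mulrC ler_pdivrMr//.
have q1 := sqr_ge0 (b + t); have q2 := sqr_ge0 b.
have q3 := mulr_ge0 q1 q2.
have q4 := sqr_ge0 (2 * b + t).
have : t ^+ 2 <= 2 * (b + t) ^+ 2 + 2 * b ^+ 2.
  rewrite -subr_ge0 [leRHS](_ : _ = (2 * b + t) ^+ 2); last by ring.
  exact: sqr_ge0.
move: q1 q2 q3; set x := (b + t) ^+ 2; set y := b ^+ 2; set w := t ^+ 2.
move=> q1 q2 q3 q5; rewrite (_ : 2 * (1 + y) * (1 + x) = 2 + 2 * x + 2 * y + 2 * (x * y)); first by lra.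
by ring.
Qed.

Lemma LamK_line_major (f : R -> C) (z : C) : is_spaceS f -> 0 <= Re z ->
  exists K : R, forall t, nc (Lam f (pt (Re z) (Im z + t))) <= K * (1 + t ^+ 2)^-1.
Proof.
move=> hf z0; have [K hK] := LamK_major hf.
have K0 : 0 <= K by exact: majorant_ge0 (fun t => hK (Re z) t z0).
exists (K * (2 * (1 + Im z ^+ 2))) => t.
by rewrite (le_trans (hK _ _ z0))// -mulrA ler_wpM2l// cauchy_translate.
Qed.

Lemma Iop_Lam (f : R -> C) (z : C) : is_spaceS f -> 0 <= Re z ->
  Iop (LamK (Xfun f)) z = - Lam f z.
Proof.
move=> hf z0; have hX := S_X hf; have hXX := S_X hX.
pose L (g : R -> C) t := Lam g (pt (Re z) (Im z + t)).
have dL g : is_spaceS g -> forall t, cder (L g) t (- (ii : C) * L (Xfun g) t).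
  move=> hg t; rewrite /L.
  have dt : is_derive t 1 (fun t => Im z + t) (1 : R).
    rewrite (_ : (fun t => _) = cst (Im z) + id); last by apply/funext.
    by apply: is_derive_eq; rewrite add0r.
  apply: cder_eq.
    exact: (cder_comp dt (Lam_cdiff_t (Im z + t) hg z0)).
  by rewrite realC1 mul1r.
have iL g : is_spaceS g -> cintg (L g).
  move=> hg; have [K hK] := LamK_line_major hg z0.
  by apply: (@cintg_majorant R _ K) => //; apply: cdiff_meas => t; eexists; exact: dL.
have [K hK] := LamK_line_major hf z0.
have E1 := @cint_deriv_half R (L f) (fun t => - (ii : C) * L (Xfun f) t) K (dL f hf).
have dE1 t : cdiff (fun t => - (ii : C) * L (Xfun f) t) t.
  by apply: cdiffM; [exact: cdiff_cst|eexists; exact: dL].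
have {}E1 := E1 dE1 (cintgZ _ (iL _ hX)) hK.
pose D : set R := `]-oo, 0[; have mD : measurable D by exact: measurable_itv.
have lE t : LamK (Xfun f) (z + (0 +i* t)) = L (Xfun f) t.
  have -> : z + (0 +i* t) = pt (Re z) (Im z + t).
    by apply: complex_ext; rewrite ?Re_pt ?Im_pt; csimp; rewrite ?addr0.
  by rewrite LamK_E// Re_pt.
rewrite /Iop (funext lE) -/ii.
have icut : cintg (cut D (L (Xfun f))).
  have -> : cut D (L (Xfun f)) = fun t => (\1_D t)%:C * L (Xfun f) t.
    by apply/funext => x; rewrite /cut indicE; case: ifP; rewrite ?mul1r ?mul0r.
  apply: (@cintgMbnd _ _ _ leb (fun t => (\1_D t)%:C) _ 1); last exact: iL.
    by apply: cmeas_real; exact: (measurable_indic mD).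
  by move=> t; rewrite nc_real indicE; case: (_ \in _); rewrite ?normr1 ?normr0.
have E2 : Cintegral leb D (fun t => - (ii : C) * L (Xfun f) t) = - ii * Cintegral leb D (L (Xfun f)).
  apply: (etrans (Cintegral_cut leb D _)).
  rewrite cutZ (cintZ _ icut); congr (_ * _).
  exact: (esym (Cintegral_cut leb D _)).
rewrite E2 in E1.
have -> : Lam f z = L f 0 by rewrite /L addr0 ptE.
by rewrite -E1; ring.
Qed.

Lemma Iop_eq (f g : C -> C) (z : C) : (forall w, Re w = Re z -> f w = g w) -> Iop f z = Iop g z.
Proof.
move=> fg; rewrite /Iop; congr (_ * Cintegral _ _ _); apply/funext => t.
by apply: fg; csimp; rewrite addr0.
Qed.

Lemma iter_Iop n (f : R -> C) (z : C) : is_spaceS f -> 0 <= Re z ->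
  iter n Iop (LamK (iter n (@Xfun R) f)) z = (-1) ^+ n * Lam f z.
Proof.
elim: n f z => [|n IH] f z hf z0; first by rewrite /= LamK_E// expr0 mul1r.
rewrite [iter n.+1 (@Xfun R) f]iterSr iterS.
have hf' : is_spaceS (fun x => (-1) ^+ n * f x) by exact: S_scale.
rewrite (@Iop_eq _ (LamK (Xfun (fun x => (-1) ^+ n * f x)))).
  by rewrite Iop_Lam// LamZ// exprS; ring.
move=> w wz; have w0 : 0 <= Re w by rewrite wz.
rewrite (IH _ _ (S_X hf) w0) (LamK_E _ w0) -(LamZ _ (S_X hf) w0); congr Lam.
by apply/funext => x; rewrite /Xfun mulrCA.
Qed.

Lemma iterX_Rfun n (c h : C) al a (f : R -> C) :
  iter n (@Xfun R) (fun x => c * Rfun h al a f x) = (fun x => c * Rfun (h + n%:R) al a f x).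
Proof.
elim: n => [|n IH]; first by rewrite /= addr0.
rewrite iterS IH; apply/funext => x; rewrite /Xfun /Rfun; case: ltP => x0; last by rewrite !mulr0.
rewrite -natr1 addrA [in RHS]mulrDl [in RHS]cexpD mul1r cexp_real lnK//; ring.
Qed.

End Primitive.

Section Characterization.
Context (R : realType).
Local Notation C := (Cplx R).

Lemma value_eq c mu h al a (F : spaceK R) (z v : C) : 0 < mu ->
  al != 0 -> 0 < a -> 0 < Re z -> 0 < c -> 0 < Re h + mu - al * c -> 0 < Re h + mu ->
  Rtilde_value c mu h al a F z v <-> v = Rt mu h al a F z.
Proof.
move=> mu0 al0 a0 z0 c0 bc b0; have [mu1|mu1|mu1] := ltgtP mu 1.
- exact: value_eq_lt1.
- exact: value_eq_gt1.
- by rewrite mu1 in bc b0 *; exact: value_eq1.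
Qed.

Lemma Rt_pos_iff mu h al a (T : spaceK R -> spaceK R) : 0 < mu -> al != 0 -> 0 < a ->
  0 < Re h + mu -> is_Rtilde_pos mu h al a T <-> T = Rt mu h al a.
Proof.
move=> mu0 al0 a0 b0; split; last first.
  by move=> -> c c0 bc F z z0; apply/(value_eq F _ mu0 al0 a0 z0 c0 bc b0).
move=> hT; pose c := (Re h + mu) / (2 * `|al|).
have na : 0 < `|al| by rewrite normr_gt0.
have c0 : 0 < c by rewrite divr_gt0// mulr_gt0.
have bc : 0 < Re h + mu - al * c.
  have : al * c <= `|al| * c by rewrite ler_wpM2r ?ler_norm// ltW.
  have -> : `|al| * c = (Re h + mu) / 2 by rewrite /c; field; rewrite gt_eqF.
  by move: b0; set B := Re h + mu => b0; lra.
apply/funext => F; apply: spaceK_ext => z.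
suff -> : spaceK_val (T F) = spaceK_val (Rt mu h al a F) by [].
apply: K_eq; [exact: spaceKP|exact: spaceKP|] => w w0.
by apply/(value_eq F _ mu0 al0 a0 w0 c0 bc b0); exact: hT.
Qed.

Lemma TK_LamK c h al a (F : spaceK R) : al != 0 -> 0 < a ->
  spaceK_val (TK c h al a F) = LamK (fun x => c * Rfun h al a (Kinv F) x).
Proof.
by move=> al0 a0; rewrite /TK /=; congr LamK; apply/funext => x; exact: RSE.
Qed.

Lemma Rt_shift mu h al a n (F : spaceK R) (z : C) : al != 0 -> 0 < a -> 0 <= Re z ->
  (-1) ^+ n * iter n Iop (Rt mu (h + n%:R) al a F) z = Rt mu h al a F z.
Proof.
move=> al0 a0 z0; rewrite /Rt TK_LamK// addrAC -iterX_Rfun iter_Iop//; last exact: S_cRfun.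
by rewrite mulrA -exprMn mulrNN mulr1 expr1n mul1r TK_val.
Qed.

Lemma Re_nat n : Re (n%:R : C) = n%:R.
Proof. by elim: n => // n IH; rewrite -!natr1 cReD IH. Qed.

Lemma Rt_iff mu h al a (T : spaceK R -> spaceK R) : 0 < mu -> al != 0 -> 0 < a ->
  is_Rtilde mu h al a T <-> T = Rt mu h al a.
Proof.
move=> mu0 al0 a0; rewrite /is_Rtilde; case: ifP => [b0|nb]; first exact: Rt_pos_iff.
have pos n : 0 < Re h + n%:R -> 0 < Re (h + n%:R : C) + mu.
  by move=> hn; rewrite cReD Re_nat addr_gt0.
split => [hT|-> n n0 hn].
- pose n := (Num.Def.archi_bound `|Re h|).+1.
  have hn : 0 < Re h + n%:R.
    have := archi_boundP (normr_ge0 (Re h)); rewrite /n -natr1.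
    have := ler_norm (- Re h); rewrite normrN; lra.
  have [T' hT' TE] := hT n isT hn.
  have E := (Rt_pos_iff T' mu0 al0 a0 (pos _ hn)).1 hT'.
  apply/funext => F; apply: spaceK_ext => z; have [z0|z0] := leP 0 (Re z); last first.
    by rewrite !(fun H => spaceK_neg H z0).
  by apply: (etrans (TE F z z0)); rewrite E; exact: Rt_shift.
- exists (Rt mu (h + n%:R) al a); first exact: (Rt_pos_iff _ mu0 al0 a0 (pos _ hn)).2.
  by move=> F z z0; apply: esym; exact: Rt_shift.
Qed.

End Characterization.

(** * The product formula and the group *)

Section Group.
Context (R : realType).
Local Notation C := (Cplx R).

Lemma TK_eq (c c' h h' : C) (al al' a a' : R) (F : spaceK R) :
  c = c' -> h = h' -> al = al' -> a = a' -> TK c h al a F = TK c' h' al' a' F.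
Proof. by move=> -> -> -> ->. Qed.

Lemma RS_eq (c c' h h' : C) (al al' a a' : R) (f : spaceS R) :
  c = c' -> h = h' -> al = al' -> a = a' -> RS c h al a f = RS c' h' al' a' f.
Proof. by move=> -> -> -> ->. Qed.

Lemma Rt_prod mu (g h : C) (al be a b : R) (F : spaceK R) :
  al != 0 -> be != 0 -> 0 < a -> 0 < b ->
  Rt mu g be b (Rt mu h al a F) =
  cpow b%:C h *: Rt mu (g + h * be%:C) (al * be) (a * b `^ al) F.
Proof.
move=> al0 be0 a0 b0.
have al'0 : al * be != 0 by rewrite mulf_neq0.
have a'0 : 0 < a * b `^ al by rewrite mulr_gt0 ?powR_gt0.
apply: (etrans (@TK_comp R _ _ _ _ _ _ _ _ F al0 be0 a0 b0)).
apply: (etrans _ (esym (@TK_scale R _ _ _ _ _ F al'0 a'0))).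
rewrite (cpow_pos _ b0) ln_affine//; apply: TK_eq => //.
- rewrite -!cexpD; congr cexp; rewrite !(realCM, realCD, realCN, realC1); ring.
- rewrite !(realCM, realCD, realCN, realC1); ring.
Qed.

Lemma cexp_surj (c : C) : c != 0 -> exists w : C, cexp w = c.
Proof.
move=> c0; have [r0|r0] := leP 0 (Re c).
  by exists (cln c); exact: cexp_cln.
have epi : cexp (0 +i* pi) = -1 :> C.
  by apply: complex_ext; rewrite cexpE /= expR0 ?cospi ?sinpi ?mul1r ?oppr0.
exists (cln (- c) + (0 +i* pi)); rewrite cexpD epi cexp_cln ?mulrN1 ?opprK ?oppr_eq0//.
by rewrite cReN oppr_ge0 ltW.
Qed.

Lemma RS_inv (c h : C) (al a : R) : c != 0 -> al != 0 -> 0 < a ->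
  exists c' h' al' a', [/\ c' != 0, al' != 0, 0 < a',
    forall f : spaceS R, RS c' h' al' a' (RS c h al a f) = f &
    forall f : spaceS R, RS c h al a (RS c' h' al' a' f) = f].
Proof.
move=> c0 al0 a0.
pose h' : C := - h * (al^-1)%:C; pose a' := expR (- (al^-1 * ln a)).
pose c' := (c * cexp (h * (ln a')%:C))^-1.
have c'0 : c' != 0 by rewrite invr_eq0 mulf_neq0// cexp_neq0.
have ali0 : al^-1 != 0 by rewrite invr_eq0.
have a'0 : 0 < a' by exact: expR_gt0.
have alC : (al^-1)%:C * al%:C = 1 :> C by rewrite -realCM mulVf.
have lna' : ln a' = - (al^-1 * ln a) by exact: expRK.
exists c', h', al^-1, a'; split => // f.
- rewrite RS_comp// -[RHS]RS_id; apply: RS_eq.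
  + by rewrite -mulrA mulVf// mulf_neq0// cexp_neq0.
  + by rewrite /h'; ring.
  + exact: mulfV.
  + rewrite -[LHS]lnK ?posrE ?mulr_gt0 ?powR_gt0// ln_affine// lna'.
    by rewrite (_ : ln a + al * - (al^-1 * ln a) = 0) ?expR0//; field.
- rewrite RS_comp// -[RHS]RS_id; apply: RS_eq.
  + rewrite /c' invfM [X in X * _]mulrA mulfV// mul1r -cexpN -cexpD -[RHS]cexp0; congr cexp.
    by rewrite lna' /h' realCN realCM; ring.
  + by rewrite /h' -mulrA alC; ring.
  + exact: mulVf.
  + rewrite -[LHS]lnK ?posrE ?mulr_gt0 ?powR_gt0// ln_affine// lna'.
    by rewrite addNr expR0.
Qed.

Definition GS : set (spaceS R -> spaceS R) :=
  [set T | exists (c h : C) (al a : R), [/\ c != 0, al != 0, 0 < a & T = RS c h al a]].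

Definition GK : set (spaceK R -> spaceK R) :=
  [set T | exists (c h : C) (al a : R), [/\ c != 0, al != 0, 0 < a & T = TK c h al a]].

Lemma GS_opgroup : is_opgroup GS.
Proof.
split.
- exists 1, 0, 1, 1; rewrite !oner_neq0; split => //.
  by apply/funext => f; rewrite RS_id.
- move=> _ _ [c1 [g [be [b [c10 be0 b0 ->]]]]] [c2 [h [al [a [c20 al0 a0 ->]]]]].
  exists (c1 * c2 * cexp (h * (ln b)%:C)), (g + h * be%:C), (al * be), (a * b `^ al).
  rewrite !mulf_neq0 ?cexp_neq0// mulr_gt0 ?powR_gt0//; split => //.
  by apply/funext => f /=; rewrite RS_comp.
- move=> _ [c [h [al [a [c0 al0 a0 ->]]]]].
  have [c' [h' [al' [a' [c'0 al'0 a'0 e1 e2]]]]] := RS_inv h c0 al0 a0.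
  exists (RS c' h' al' a'); first by exists c', h', al', a'.
  by split; apply/funext => f /=; rewrite ?e1 ?e2.
Qed.

Definition toS (T : spaceK R -> spaceK R) (f : spaceS R) : spaceS R := KinvS (T (LamS f)).

Lemma toS_TK c h al a : toS (TK c h al a) = RS c h al a.
Proof. by apply/funext => f; rewrite /toS /TK !LamSK. Qed.

Lemma toS_comp S T : toS (S \o T) = toS S \o toS T.
Proof. by apply/funext => f; rewrite /toS /= KinvSK. Qed.

Lemma toS_inj : injective toS.
Proof.
move=> S T ST; apply/funext => F.
by rewrite -[S F]KinvSK -[T F]KinvSK -[F]KinvSK; congr LamS; exact: (congr1 (fun U => U (KinvS F)) ST).
Qed.

Lemma toS_id : toS id = id.
Proof. by apply/funext => f; exact: LamSK. Qed.

Lemma GK_GS T : GK T <-> GS (toS T).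
Proof.
split=> [[c [h [al [a [c0 al0 a0 ->]]]]]|[c [h [al [a [c0 al0 a0 E]]]]]].
  by exists c, h, al, a; rewrite toS_TK.
by exists c, h, al, a; split => //; apply: toS_inj; rewrite toS_TK.
Qed.

Lemma GK_opgroup : is_opgroup GK.
Proof.
have [G1 GM GV] := GS_opgroup; split.
- by apply/GK_GS; rewrite toS_id.
- by move=> S T /GK_GS GSS /GK_GS GST; apply/GK_GS; rewrite toS_comp; exact: GM.
- move=> _ [c [h [al [a [c0 al0 a0 ->]]]]].
  have [c' [h' [al' [a' [c'0 al'0 a'0 e1 e2]]]]] := RS_inv h c0 al0 a0.
  exists (TK c' h' al' a'); first by exists c', h', al', a'.
  by split; apply: toS_inj; rewrite toS_comp !toS_TK toS_id; apply/funext => f /=; rewrite ?e1 ?e2.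
Qed.

Lemma GS_circ : GS = @G_circ R.
Proof.
have E c h al a (f : spaceS R) x : al != 0 -> 0 < a -> 0 < x ->
    RS c h al a f x = c * (cpow x%:C h * f (a * x `^ al)).
  move=> al0 a0 x0; rewrite RSE// /Rfun x0 cpow_pos//; congr (_ * (_ * f _)).
  by rewrite -[RHS]lnK ?posrE ?mulr_gt0 ?powR_gt0// ln_affine// addrC.
apply/seteqP; split => T [c [h [al [a [c0 al0 a0 hT]]]]]; exists c, h, al, a; split => //.
  by move=> f x x0; rewrite hT E.
apply/funext => f; apply: spaceS_ext => x; have [x0|x0] := ltP 0 x; first by rewrite hT// E.
by rewrite !(S_out (spaceS_prop _) x0).
Qed.

(* Every scalar occurs because [b ^ h] does: an element of [GK] is already a
   product of two generators. *)
Lemma generated_GK mu :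
  generated_opgroup [set T | exists (h : C) (al a : R),
    [/\ al != 0, 0 < a & T = Rt mu h al a]] = GK.
Proof.
apply/seteqP; split.
  apply: smallest_sub; first exact: GK_opgroup.
  move=> _ [h [al [a [al0 a0 ->]]]].
  by exists (cexp ((1 - mu) * ln a)%:C), (h + ((mu - 1) * (1 - al))%:C), al, a; rewrite cexp_neq0.
move=> _ [c [h [al [a [c0 al0 a0 ->]]]]] M [[M1 MM MV] gM].
have [w cw] := cexp_surj c0.
pose b := expR 1 : R; pose a2 := expR (ln a - al).
have lb : ln b = 1 by exact: expRK.
have la2 : ln a2 = ln a - al by exact: expRK.
have gen h0 al1 a1 : al1 != 0 -> 0 < a1 -> M (TK (cexp ((1 - mu) * ln a1)%:C) h0 al1 a1).
  move=> al10 a10; apply: gM; exists (h0 - ((mu - 1) * (1 - al1))%:C), al1, a1; split => //.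
  by rewrite /Rt subrK.
pose h2 := w - ((1 - mu) * (1 + ln a2))%:C.
have b0 : 0 < b by exact: expR_gt0.
have a20 : 0 < a2 by exact: expR_gt0.
have := MM _ _ (gen (h - h2) 1 b (oner_neq0 _) b0) (gen h2 al a2 al0 a20).
suff -> : TK (cexp ((1 - mu) * ln b)%:C) (h - h2) 1 b \o TK (cexp ((1 - mu) * ln a2)%:C) h2 al a2 =
  TK c h al a by [].
apply/funext => F /=; apply: (etrans (@TK_comp R _ _ _ _ _ _ _ _ F al0 (oner_neq0 _) a20 b0)); apply: TK_eq.
- rewrite -cw -!cexpD lb; congr cexp; rewrite /h2 !(realCM, realCD, realCN, realC1); ring.
- by rewrite realC1 mulr1 subrK.
- exact: mulr1.
- rewrite -[LHS]lnK ?posrE ?mulr_gt0 ?powR_gt0// ln_affine// lb la2.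
  by rewrite mulr1 subrK lnK.
Qed.

End Group.

Theorem theorem3p2 (R : realType) (mu : R) (hmu : 0 < mu) :
  exists Rtilde : Cplx R -> R -> R -> spaceK R -> spaceK R,
  [/\ (forall (h : Cplx R) (alpha a : R), alpha != 0 -> 0 < a ->
         forall T : spaceK R -> spaceK R,
         is_Rtilde mu h alpha a T <-> T = Rtilde h alpha a),
      (forall (h : Cplx R) (alpha a : R), alpha != 0 -> 0 < a ->
         linear (Rtilde h alpha a) /\ continuous (Rtilde h alpha a)),
      (forall (g h : Cplx R) (alpha beta a b : R),
         alpha != 0 -> beta != 0 -> 0 < a -> 0 < b ->
         forall F : spaceK R,
         Rtilde g beta b (Rtilde h alpha a F) =
         cpow b%:C h *:
           Rtilde (g + h * beta%:C) (alpha * beta) (a * b `^ alpha) F) &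
      opgroup_isog
        (generated_opgroup
           [set T | exists (h : Cplx R) (alpha a : R),
              [/\ alpha != 0, 0 < a & T = Rtilde h alpha a]])
        (@G_circ R)].
Proof.
exists (Rt mu); split.
- by move=> h al a al0 a0 T; exact: Rt_iff.
- by move=> h al a al0 a0; split; [exact: TK_lin|exact: TK_continuous].
- by move=> *; exact: Rt_prod.
- rewrite generated_GK -GS_circ; split; [exact: GK_opgroup|exact: GS_opgroup|].
  exists (@toS R); last by move=> S T _ _; exact: toS_comp.
  split.
  + by move=> T /GK_GS.
  + by move=> S T _ _; exact: toS_inj.
  + move=> _ [c [h [al [a [c0 al0 a0 ->]]]]]; exists (TK c h al a); last exact: toS_TK.
    by exists c, h, al, a.
Qed.
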